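(* Suppose that condition $(C_\mu)$ (stated in the context) is satisfied, and let $h=(h_t)_{t\ge1}$ be such that $h_t$ is $\mathcal{Y}_t$-measurable for every $t\ge1$. For a general Gaussian signal $X$, the information state, that is, the density $\lambda_t$ with respect to Lebesgue measure of the non-normalized random measure $$\omega_t(dx)=\mathbb{E}\left[\mathbb{I}(X_t\in dx)\exp\left\{\frac{\mu}{2}\sum_{s=1}^{t-1}(X_s-h_s)^2Q_s\right\}\Big/\mathcal{Y}_t\right],$$ satisfies the equality $$\lambda_t(x)=\frac{1}{\sqrt{2\pi\widetilde{\gamma}_t}}\exp\left\{-\frac{(x-\widetilde{Z}^h_t)^2}{2\widetilde{\gamma}_t}\right\}\times\left(\prod_{r=1}^{t-1}\left[\frac{1+S_r\overline{\gamma}_r}{1+A_r^2\overline{\gamma}_r}\right]^{-1/2}\exp\left\{\frac{\mu}{2}Q_r\frac{1+A_r^2\overline{\gamma}_r}{1+S_r\overline{\gamma}_r}\big[h_r-\widetilde{Z}^h_r\big]^2\right\}\right)\times\mathcal{M}_t,$$ where $\widetilde{\gamma}_t=\dfrac{\overline{\gamma}_t}{1+A_t^2\overline{\gamma}_t}$, where $\widetilde{Z}^h_t=\dfrac{Z^h_t+A_t\overline{\gamma}_tY_t}{1+A_t^2\overline{\gamma}_t}$ is the solution of the recursive equation $$\widetilde{Z}^h_t=m_t-\sum_{l=1}^{t-1}\overline{\gamma}(t,l)\frac{\mu Q_l}{1+S_l\overline{\gamma}_l}(h_l-\widetilde{Z}^h_l)+\sum_{l=1}^{t}\overline{\gamma}(t,l)A_l(Y_l-A_l\widetilde{Z}^h_l),$$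 and where $\overline{\gamma}$, $S$, $Z^h$ and the martingale $\mathcal{M}$ are as defined in the context.
   Context: Setting: $X=(X_t)_{t\ge1}$ is an arbitrary real Gaussian sequence with mean $m_t=\mathbb{E}X_t$ and covariance $K(t,s)=\mathbb{E}(X_t-m_t)(X_s-m_s)$. The observations are $Y_t=A_tX_t+\varepsilon_t$, $t\ge 1$, where $(A_t)_{t\ge1}$ is a sequence of real numbers and $(\varepsilon_t)_{t\ge1}$ are i.i.d. $\mathcal{N}(0,1)$, independent of $X$. $\mathcal{Y}_t=\sigma(Y_u,\,1\le u\le t)$, with $\mathcal{Y}_0$ trivial. $\mu$ is a given real number and $(Q_t)_{t\ge1}$ a fixed sequence of nonnegative real numbers. $\mathbb{E}(\cdot/\mathcal{G})$ denotes conditional expectation given $\mathcal{G}$, and $\mathbb{I}$ denotes an indicator. $T$ denotes the time horizon, and times $t$ range over $1\le t\le T$. Condition $(C_\mu)$: the equation $$\overline{\gamma}(t,s)=K(t,s)-\sum_{l=1}^{s-1}\overline{\gamma}(t,l)\overline{\gamma}(s,l)\frac{S_l}{1+S_l\overline{\gamma}_l},\qquad S_l=A_l^2-\mu Q_l,\ \overline{\gamma}_l=\overline{\gamma}(l,l),$$ has a unique and bounded solution on $\{(t,s):1\le s\le t\le T\}$, such that $\overline{\gamma}_l\ge0$ and moreover $1+S_l\overline{\gamma}_l>0$ for $l\ge1$; $\overline{\gamma}$ denotes this solution. $Z^h$ is the solution of $$Z^h_t=m_t-\sum_{l=1}^{t-1}\overline{\gamma}(t,l)\frac{\mu Q_l}{1+S_l\overline{\gamma}_l}(h_l-Z^h_l)+\sum_{l=1}^{t-1}\overline{\gamma}(t,l)\frac{A_l}{1+S_l\overline{\gamma}_l}(Y_l-A_lZ^h_l).$$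 With $\pi_{r-1}(X_r)=\mathbb{E}(X_r/\mathcal{Y}_{r-1})$, $\nu_r=Y_r-A_r\pi_{r-1}(X_r)$, $\gamma_r=\mathbb{E}(X_r-\pi_{r-1}(X_r))^2$, the martingale $\mathcal{M}$ is $$\mathcal{M}_t=\prod_{r=1}^t\left[\frac{1+A_r^2\gamma_r}{1+A_r^2\overline{\gamma}_r}\right]^{1/2}\exp\left\{\frac{A_r(Z^h_r-\pi_{r-1}(X_r))\nu_r}{1+A_r^2\overline{\gamma}_r}-\frac12\frac{A_r^2(Z^h_r-\pi_{r-1}(X_r))^2}{1+A_r^2\overline{\gamma}_r}-\frac12\frac{A_r^2(\gamma_r-\overline{\gamma}_r)\nu_r^2}{(1+A_r^2\overline{\gamma}_r)(1+A_r^2\gamma_r)}\right\}.$$ *)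

(* Defs.v *)
From mathcomp Require Import all_boot all_order all_algebra.
From mathcomp Require Import all_classical all_reals all_analysis.
From mathcomp Require Import measurable_realfun.

Set Implicit Arguments.
Unset Strict Implicit.
Unset Printing Implicit Defensive.

Import Order.TTheory GRing.Theory Num.Theory.
Import numFieldNormedType.Exports.

Local Open Scope classical_set_scope.
Local Open Scope ring_scope.

(* Sequences indexed by t >= 1 are functions on nat whose value at 0 is never
   used: every sum, product and sigma-algebra below starts at index 1. *)

Section Probability.
Context {d : measure_display} {Omega : measurableType d} {R : realType}.
Implicit Types (P : probability Omega R) (Y : nat -> Omega -> R)
  (F : set (set Omega)).

Definition sigma_gen (I : set nat) Y : set (set Omega) :=
  <<s \bigcup_(u in I) preimage_set_system setT (Y u) measurable >>.

Definition filtration Y (t : nat) : set (set Omega) :=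
  sigma_gen [set u | (1 <= u <= t)%N] Y.

(* For a sigma-algebra F, the measurable sets of [g_sigma_algebraType F] are
   <<s F >> = F. *)
Definition sub_measurable {d'} {E : measurableType d'} F (f : Omega -> E) :=
  measurable_fun [set: g_sigma_algebraType F] (f : g_sigma_algebraType F -> E).

(* V is a version of E(U / F), for an integrable U. *)
Definition is_condexp P F (U V : Omega -> R) : Prop :=
  [/\ sub_measurable F V,
      P.-integrable setT (EFin \o V) &
      forall G, F G -> (\int[P]_(w in G) (V w)%:E = \int[P]_(w in G) (U w)%:E)%E].

(* V is a version of E(U / F), for a nonnegative U that need not be integrable:
   both sides of the defining identity may be infinite. *)
Definition is_condexp_ge0 P F (U V : Omega -> \bar R) : Prop :=
  [/\ sub_measurable F V,
      forall w, (0 <= V w)%E &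
      forall G, F G -> (\int[P]_(w in G) V w = \int[P]_(w in G) U w)%E].

(* [normal_prob m 0] is not a Dirac mass, hence the case distinction. *)
Definition is_gaussian P (Z : Omega -> R) : Prop :=
  exists m s : R, 0 <= s /\ forall B : set R, measurable B ->
    P (Z @^-1` B) = if s == 0 then \d_m B else normal_prob m s B.

Definition gaussian_sequence P (X : nat -> Omega -> R) : Prop :=
  forall (n : nat) (a : nat -> R),
    is_gaussian P (fun w => \sum_(1 <= i < n.+1) a i * X i w).

Definition iid_std_normal P (eps : nat -> Omega -> R) : Prop :=
  (forall t (B : set R), (1 <= t)%N -> measurable B ->
     P (eps t @^-1` B) = normal_prob 0 1 B) /\
  (forall (J : seq nat) (B : nat -> set R),
     uniq J -> (forall j, j \in J -> (1 <= j)%N) ->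
     (forall j, measurable (B j)) ->
     P (\bigcap_(j in [set` J]) (eps j @^-1` B j)) =
       (\prod_(j <- J) P (eps j @^-1` B j))%E).

Definition independent_sequences P (X eps : nat -> Omega -> R) : Prop :=
  forall F G : set Omega,
    sigma_gen [set u | (1 <= u)%N] X F -> sigma_gen [set u | (1 <= u)%N] eps G ->
    P (F `&` G) = (P F * P G)%E.

Definition mean P (X : nat -> Omega -> R) (t : nat) : R := fine ('E_P[X t])%E.

Definition cov P (X : nat -> Omega -> R) (t s : nat) : R :=
  fine (covariance P (X t) (X s)).

End Probability.

Section Riccati.
Context {R : realType}.
Implicit Types (T : nat) (K g : nat -> nat -> R) (A Q : nat -> R) (mu : R).

Definition Scoef mu A Q (l : nat) : R := A l ^+ 2 - mu * Q l.

(* Since x / 0 = 0 here, the meaningfulness of the quotients is required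
   explicitly. *)
Definition gammabar_solution T K mu A Q g : Prop :=
  (forall l, (1 <= l < T)%N -> 1 + Scoef mu A Q l * g l l != 0) /\
  (forall t s, (1 <= s <= t)%N -> (t <= T)%N ->
     g t s = K t s - \sum_(1 <= l < s)
       g t l * g s l * (Scoef mu A Q l / (1 + Scoef mu A Q l * g l l))).

(* Condition (C_mu), g being the solution. *)
Definition condition_C T K mu A Q g : Prop :=
  [/\ gammabar_solution T K mu A Q g,
      forall g', gammabar_solution T K mu A Q g' ->
        forall t s, (1 <= s <= t)%N -> (t <= T)%N -> g' t s = g t s,
      exists C : R, forall t s, (1 <= s <= t)%N -> (t <= T)%N -> `|g t s| <= C,
      forall l, (1 <= l <= T)%N -> 0 <= g l l &
      forall l, (1 <= l <= T)%N -> 0 < 1 + Scoef mu A Q l * g l l].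

End Riccati.

Section Filter.
Context {d : measure_display} {Omega : measurableType d} {R : realType}.
Variables (P : probability Omega R) (T : nat) (mu : R) (A Q m : nat -> R)
  (g : nat -> nat -> R).
Implicit Types X Y h Zh Zt xhat : nat -> Omega -> R.

Let S := Scoef mu A Q.

Definition observation X eps (t : nat) (w : Omega) : R := A t * X t w + eps t w.

Definition Zh_solution Y h Zh : Prop := forall t w, (1 <= t <= T)%N ->
  Zh t w = m t
    - \sum_(1 <= l < t)
        g t l * (mu * Q l / (1 + S l * g l l)) * (h l w - Zh l w)
    + \sum_(1 <= l < t)
        g t l * (A l / (1 + S l * g l l)) * (Y l w - A l * Zh l w).

Definition Ztilde_solution Y h Zt : Prop := forall t w, (1 <= t <= T)%N ->
  Zt t w = m t
    - \sum_(1 <= l < t)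
        g t l * (mu * Q l / (1 + S l * g l l)) * (h l w - Zt l w)
    + \sum_(1 <= l < t.+1) g t l * A l * (Y l w - A l * Zt l w).

Definition gammatilde (t : nat) : R := g t t / (1 + A t ^+ 2 * g t t).

Definition Ztilde Y Zh (t : nat) (w : Omega) : R :=
  (Zh t w + A t * g t t * Y t w) / (1 + A t ^+ 2 * g t t).

(* [xhat r] stands for pi_{r-1}(X_r). *)
Definition filter_error X xhat (r : nat) : R :=
  fine ('E_P[(fun w => (X r w - xhat r w) ^+ 2)%R])%E.

Definition innovation Y xhat (r : nat) (w : Omega) : R :=
  Y r w - A r * xhat r w.

Definition martM X Y Zh xhat (t : nat) (w : Omega) : R :=
  \prod_(1 <= r < t.+1)
    (let gam := filter_error X xhat r in
     let nu := innovation Y xhat r w in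
     let dZ := Zh r w - xhat r w in
     Num.sqrt ((1 + A r ^+ 2 * gam) / (1 + A r ^+ 2 * g r r)) *
     expR (A r * dZ * nu / (1 + A r ^+ 2 * g r r)
           - 2^-1 * (A r ^+ 2 * dZ ^+ 2 / (1 + A r ^+ 2 * g r r))
           - 2^-1 * (A r ^+ 2 * (gam - g r r) * nu ^+ 2
                     / ((1 + A r ^+ 2 * g r r) * (1 + A r ^+ 2 * gam))))).

Definition weight X h (t : nat) (w : Omega) : R :=
  expR (mu / 2 * \sum_(1 <= s < t) (X s w - h s w) ^+ 2 * Q s).

(* om is a version of the random measure omega_t: for every Borel set B,
   om(B) = E(1(X_t in B) weight_t / Y_1, ..., Y_t) almost surely. *)
Definition is_info_measure X Y h (t : nat)
    (om : Omega -> {measure set (measurableTypeR R) -> \bar R}) : Prop :=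
  forall B : set R, measurable B ->
    is_condexp_ge0 P (filtration Y t)
      (fun w => (\1_(X t @^-1` B) w * weight X h t w)%:E) (fun w => om w B).

Definition info_density X Y h Zh xhat (t : nat) (w : Omega) (x : R) : R :=
  (Num.sqrt (2 * pi * gammatilde t))^-1
    * expR (- ((x - Ztilde Y Zh t w) ^+ 2 / (2 * gammatilde t)))
    * (\prod_(1 <= r < t)
        ((Num.sqrt ((1 + S r * g r r) / (1 + A r ^+ 2 * g r r)))^-1 *
         expR (mu / 2 * Q r
               * ((1 + A r ^+ 2 * g r r) / (1 + S r * g r r))
               * (h r w - Ztilde Y Zh r w) ^+ 2)))
    * martM X Y Zh xhat t w.

End Filter.

Definition is_lebesgue_density {R : realType}
    (nu : {measure set (measurableTypeR R) -> \bar R})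
    (f : R -> R) : Prop :=
  [/\ measurable_fun setT f, forall x, 0 <= f x &
      forall B : set R, measurable B ->
        nu B = (\int[lebesgue_measure]_(x in B) (f x)%:E)%E].

(* Main.v *)
(* The idea is to remove the observation noise and then to condition the Gaussian
   signal one step at a time.  Under the reference measure whose density with
   respect to P is
     exp (- sum_(s <= n) (A_s X_s eps_s + A_s^2 X_s^2 / 2)),
   the Cameron-Martin formula for the noise shows that X keeps its law and is
   independent of Y_1, ..., Y_n.  Up to a factor depending on h only, the inverse
   density times exp (sum_s q_s (X_s - h_s)^2 / 2) is
     exp (sum_s (b_s X_s - S_s X_s^2 / 2)),  b = A Y - q h,  S = A^2 - q,
   and since Y and h can be frozen by independence, everything reduces to the effect
   of such quadratic tilts on a Gaussian family.  Each tilt multiplies the moment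
   generating function by an explicit mass and updates mean and covariance by a rank
   one (Kalman) formula; the marginal laws are then recovered from the moment
   generating function.  With q = mu Q at the times before t and q_t = 0, the updated
   covariance and mean are gammabar, gammatilde and Zh, Ztilde; with q = 0 they are
   gamma and pi_(r-1)(X_r).  The ratio of the two products of masses is the scalar
   factor in lambda_t. *)
From HB Require Import structures.
Require Import Defs.
From mathcomp Require Import all_boot all_order all_algebra.
From mathcomp Require Import all_classical all_reals all_analysis.
From mathcomp Require Import measurable_realfun.
From mathcomp Require Import ring lra.

Set Implicit Arguments.
Unset Strict Implicit.
Unset Printing Implicit Defensive.

Import Order.TTheory GRing.Theory Num.Theory.
Import numFieldNormedType.Exports.

Local Open Scope classical_set_scope.
Local Open Scope ring_scope.

(** Covariances may be singular, so the signal need not have joint densities. A weighted signal is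
    described by its moment generating function, for which the rank one updates need no inverse
    matrix; the price is a uniqueness theorem for measures on the line, which rests on the
    integrability of some exp (delta x^2). For mu > 0 the weight is unbounded and nothing says
    beforehand that it is integrable. The formulas therefore concern nonnegative functions with
    values in [0, +oo], and finiteness results from the positivity of the denominators 1 + S_l
    gammabar_l. Nonnegativity of the updated variances is read off from the moment generating
    function after each tilt, just in time for the next one. Conditional objects are only defined up
    to null sets. An explicit kernel is built, and every version is compared with it on countably
    many rays, so that one null set serves all Borel sets. When [gammabar t t = 0] this kernel is a
    multiple of a Dirac mass, which has no density; this is why the existence of the density is
    stated under [0 < gammabar t t]. *)

Ltac mfun_step := first
  [ assumption | exact: measurable_cst | exact: measurable_id
  | exact: measurable_fst | exact: measurable_snd
  | match goal with |- measurable_fun _ (fun x => expR _) =>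
      apply: (measurableT_comp (@measurable_expR _)) end
  | match goal with |- measurable_fun _ (fun x => _ + - _) => apply: measurable_funB end
  | match goal with |- measurable_fun _ (fun x => _ + _) => apply: measurable_funD end
  | match goal with |- measurable_fun _ (fun x => _ * _) => apply: measurable_funM end
  | match goal with |- measurable_fun _ ( *%R _) => apply: measurable_funM end
  | match goal with |- measurable_fun _ ( +%R _) => apply: measurable_funD end
  | match goal with |- measurable_fun _ (fun x => _ ^+ _) => apply: measurable_funX end
  | match goal with |- measurable_fun _ (fun x => - _) => apply: measurable_funN end
  | match goal with |- measurable_fun _ (fun x => \sum_(i <- _ | _) _) =>
      apply: measurable_sum => ? end ].
Ltac mfun := rewrite /=; solve [repeat mfun_step].

(** * Gaussian measures *)

Section MeasureWithDensity.
Context {d : measure_display} {T : measurableType d} {R : realType}.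
Variables (mu : {measure set T -> \bar R}) (f : T -> R).
Hypotheses (mf : measurable_fun setT f) (f0 : forall x, 0 <= f x).
Local Open Scope ereal_scope.

Definition mdensity (A : set T) : \bar R := \int[mu]_(x in A) (f x)%:E.

Let mdensity0 : mdensity set0 = 0.
Proof. by rewrite /mdensity integral_set0. Qed.

Let mdensity_ge0 A : 0 <= mdensity A.
Proof. by apply: integral_ge0 => x _; rewrite lee_fin. Qed.

Let mdensity_sigma_additive : semi_sigma_additive mdensity.
Proof.
apply: semi_sigma_additive_nng_induced; first exact/measurable_EFinP.
by move=> x; rewrite lee_fin.
Qed.

Definition mdens_def := mdensity.
HB.instance Definition _ := isMeasure.Build _ _ _
  mdens_def mdensity0 mdensity_ge0 mdensity_sigma_additive.
Definition mdens : {measure set T -> \bar R} := mdens_def.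

Lemma mdensE A : mdens A = \int[mu]_(x in A) (f x)%:E. Proof. by []. Qed.

Import HBNNSimple.

Lemma ge0_integral_mdens (g : T -> \bar R) :
  measurable_fun setT g -> (forall x, 0 <= g x) ->
  \int[mdens]_x g x = \int[mu]_x (g x * (f x)%:E).
Proof.
move=> mg g0.
have mf' : measurable_fun setT (EFin \o f) by exact/measurable_EFinP.
pose g_ := nnsfun_approx measurableT mg.
have g_g x : EFin (g_ n x) @[n --> \oo] --> g x.
  by apply: cvg_nnsfun_approx.
have -> : \int[mdens]_x g x = limn (fun n => \int[mdens]_x (g_ n x)%:E).
  rewrite -monotone_convergence//.
  - by apply: eq_integral => x _; apply/esym/cvg_lim => //; exact: g_g.
  - by move=> n; exact/measurable_EFinP.
  - by move=> n x _; rewrite lee_fin.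
  - by move=> x _ a b ab; rewrite lee_fin; exact/lefP/nd_nnsfun_approx.
have -> : \int[mu]_x (g x * (f x)%:E) =
    limn (fun n => \int[mu]_x ((g_ n x)%:E * (f x)%:E)).
  rewrite -monotone_convergence//.
  - apply: eq_integral => x _; apply/esym/cvg_lim => //.
    by apply: cvgeZr => //; exact: g_g.
  - by move=> n; apply: emeasurable_funM => //; exact/measurable_EFinP.
  - by move=> n x _; rewrite mule_ge0// lee_fin.
  - move=> x _ a b ab; rewrite lee_wpmul2r ?lee_fin//.
    exact/lefP/nd_nnsfun_approx.
congr (limn _); apply/funext => n.
rewrite integralT_nnsfun sintegralE.
under [RHS]eq_integral.
  move=> x _; rewrite fimfunE -fsumEFin// ge0_mule_fsuml; last first.
    by move=> y; rewrite lee_fin; exact: nnfun_muleindic_ge0.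
  over.
rewrite ge0_integral_fsum//; last 2 first.
  - move=> r; apply: emeasurable_funM => //; apply/measurable_EFinP.
    by apply: measurable_funM => //.
  - by move=> r x _; rewrite mule_ge0 ?lee_fin//; exact: nnfun_muleindic_ge0.
apply: eq_fsbigr => r _.
have [r0|r0] := ltP r 0%R.
  rewrite preimage_nnfun0// measure0 mule0 integral0_eq// => x _.
  by rewrite indic0 mulr0 mul0e.
rewrite mdensE integral_mkcond -ge0_integralZl//.
- apply: eq_integral => x _; rewrite EFinM -muleA; congr (_ * _).
  rewrite patchE indicE; case: ifPn => _; first by rewrite mul1e.
  by rewrite mul0e.
- apply: (measurable_restrictT _ _).1 => //; exact: measurable_funTS.
- by move=> x _; apply: erestrict_ge0 => y _; rewrite lee_fin.
Qed.

End MeasureWithDensity.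


Section GaussianMeasure.
Context {R : realType}.
Implicit Types m K b S x : R.

(** Parametrised by the variance, so that the updates of K involve no square root. The Dirac case
    matches [is_gaussian] and is reached whenever the signal is degenerate. *)
Definition gaussm m K : probability (measurableTypeR R) R :=
  if K == 0 then (\d_(m : measurableTypeR R) : probability (measurableTypeR R) R)
  else (normal_prob m (Num.sqrt K) : probability (measurableTypeR R) R).

Lemma ge0_integral_normal_prob m s (g : measurableTypeR R -> \bar R) :
  measurable_fun setT g -> (forall x, 0 <= g x)%E ->
  (\int[normal_prob m s]_x g x =
   \int[lebesgue_measure]_x (g x * (normal_pdf m s x)%:E))%E.
Proof.
move=> mg g0.
rewrite -(ge0_integral_mdens lebesgue_measure (measurable_normal_pdf m s)
  (normal_pdf_ge0 m s))//.
Qed.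

Lemma measurable_EFin_normal_pdf m s :
  measurable_fun [set: R] (fun x : R => (normal_pdf m s x)%:E).
Proof. by apply/measurable_EFinP; exact: measurable_normal_pdf. Qed.

(** Completing the square. The condition 1 + S K > 0 says that the new precision 1/K + S is
    positive; S itself may be negative. *)
Lemma normal_pdf_quad_tilt m K b S x : 0 < K -> 0 < 1 + S * K ->
  expR (b * x - 2^-1 * S * x ^+ 2) * normal_pdf m (Num.sqrt K) x =
  (Num.sqrt (1 + S * K))^-1 *
    expR ((b * m + 2^-1 * b ^+ 2 * K - 2^-1 * S * m ^+ 2) / (1 + S * K)) *
    normal_pdf ((m + b * K) / (1 + S * K)) (Num.sqrt (K / (1 + S * K))) x.
Proof.
move=> K0 D0.
have K'0 : 0 < K / (1 + S * K) by rewrite divr_gt0.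
rewrite !normal_pdfE ?gt_eqF ?sqrtr_gt0// /normal_peak /normal_fun.
rewrite !sqr_sqrtr ?ltW//.
have -> : Num.sqrt (K / (1 + S * K) * pi *+ 2) =
    Num.sqrt (K * pi *+ 2) / Num.sqrt (1 + S * K).
  rewrite -sqrtrV ?ltW// -sqrtrM ?mulrn_wge0 ?mulr_ge0 ?pi_ge0 ?ltW//.
  by congr Num.sqrt; rewrite mulrnAl mulrAC.
have -> : (Num.sqrt (1 + S * K))^-1 *
    expR ((b * m + 2^-1 * b ^+ 2 * K - 2^-1 * S * m ^+ 2) / (1 + S * K)) *
    ((Num.sqrt (K * pi *+ 2) / Num.sqrt (1 + S * K))^-1 *
     expR (- (x - (m + b * K) / (1 + S * K)) ^+ 2 / (K / (1 + S * K) *+ 2))) =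
   (Num.sqrt (K * pi *+ 2))^-1 *
    (expR ((b * m + 2^-1 * b ^+ 2 * K - 2^-1 * S * m ^+ 2) / (1 + S * K)) *
     expR (- (x - (m + b * K) / (1 + S * K)) ^+ 2 / (K / (1 + S * K) *+ 2))).
  have s0 : Num.sqrt (K * pi *+ 2) != 0.
    by rewrite gt_eqF// sqrtr_gt0 mulrn_wgt0// mulr_gt0// pi_gt0.
  have s1 : Num.sqrt (1 + S * K) != 0 by rewrite gt_eqF// sqrtr_gt0.
  by field; apply/andP.
rewrite mulrCA -!expRD; congr (_ * expR _).
have D1 : 1 + S * K != 0 by rewrite gt_eqF.
have K1 : K != 0 by rewrite gt_eqF.
by field; apply/andP.
Qed.

Lemma integral_gaussm_quad m K b S : 0 <= K -> 0 < 1 + S * K ->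
  (\int[gaussm m K]_x (expR (b * x - 2^-1 * S * x ^+ 2))%:E =
  ((Num.sqrt (1 + S * K))^-1 *
    expR ((b * m + 2^-1 * b ^+ 2 * K - 2^-1 * S * m ^+ 2) / (1 + S * K)))%:E)%E.
Proof.
move=> K0 D0.
have mf : measurable_fun setT
    (fun x : R => (expR (b * x - 2^-1 * S * x ^+ 2))%:E).
  by apply/measurable_EFinP; mfun.
rewrite /gaussm; have [->|K1] := eqVneq K 0.
  rewrite integral_dirac// diracT mul1e; congr EFin.
  by rewrite !(mulr0, addr0) sqrtr1 invr1 mul1r mulr1.
have {}K0 : 0 < K by rewrite lt_def K1.
rewrite ge0_integral_normal_prob//.
under eq_integral do rewrite -EFinM normal_pdf_quad_tilt// EFinM.
rewrite ge0_integralZl ?lee_fin//.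
- by rewrite integral_normal_pdf mule1.
- exact: measurable_EFin_normal_pdf.
- by move=> x _; rewrite lee_fin normal_pdf_ge0.
Qed.

Lemma integral_gaussm_exp m K b : 0 <= K ->
  (\int[gaussm m K]_x (expR (b * x))%:E =
    (expR (b * m + 2^-1 * b ^+ 2 * K))%:E)%E.
Proof.
move=> K0; have := @integral_gaussm_quad m K b 0 K0.
rewrite !(mulr0, mul0r, addr0, subr0) sqrtr1 invr1 mul1r mulr1 => <-//.
by apply: eq_integral => x _; rewrite mul0r subr0.
Qed.

End GaussianMeasure.

(** * Uniqueness of measures with exponential moments *)

Section ExponentialIntegrability.
Context {R : realType} (mu : {measure set (measurableTypeR R) -> \bar R}).
Implicit Types (g H : R -> R) (a c x : R).

(** Asking for all c makes the condition stable under multiplication by exponentials, so that a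
    single H dominates simultaneously for every tilt. *)
Definition expint H := measurable_fun [set: R] H /\
  forall c, mu.-integrable setT (fun x : R => (H x * expR (c * x))%:E).

Lemma measurable_mul_expR H c : measurable_fun [set: R] H ->
  measurable_fun [set: R] (fun x : R => (H x * expR (c * x))%:E).
Proof. by move=> mH; apply/measurable_EFinP; mfun. Qed.

Lemma expint_le g H : measurable_fun [set: R] g -> (forall x, `|g x| <= `|H x|) ->
  expint H -> expint g.
Proof.
move=> mg gH [mH iH]; split=> // c; apply: le_integrable (iH c) => //.
  exact: measurable_mul_expR.
by move=> x _; rewrite lee_fin !normrM ler_wpM2r.
Qed.

Lemma expintD g H : expint g -> expint H -> expint (fun x => g x + H x).
Proof.
move=> [mg ig] [mH iH]; split; first by mfun.
move=> c; have := integrableD measurableT (ig c) (iH c).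
by apply: eq_integrable => // x _; rewrite mulrDl EFinD.
Qed.

Lemma expintZ a H : expint H -> expint (fun x => a * H x).
Proof.
move=> [mH iH]; split; first by mfun.
move=> c; have := integrableZl measurableT a (iH c).
by apply: eq_integrable => // x _; rewrite -mulrA EFinM.
Qed.

Lemma expint_shift a H : expint H -> expint (fun x => H x * expR (a * x)).
Proof.
move=> [mH iH]; split; first by mfun.
by move=> c; under eq_fun do rewrite -mulrA -expRD -mulrDl; exact: iH.
Qed.

Lemma expint_norm H : expint H -> expint (fun x => `|H x|).
Proof.
move=> eH; have [mH _] := eH; apply: expint_le eH; last by move=> x; rewrite normr_id.
exact: measurableT_comp.
Qed.

End ExponentialIntegrability.

Lemma expRB1_le {R : realType} (y : R) : expR y - 1 <= y * expR y.
Proof.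
have := expR_ge1Dx (- y); rewrite -(ler_pM2r (expR_gt0 y)) expRN mulVf ?expR_eq0//.
by lra.
Qed.

Lemma abs_expRB1_le {R : realType} (y : R) : `|expR y - 1| <= `|y| * expR `|y|.
Proof.
have [y0|y0] := leP 0 y.
  rewrite ger0_norm ?subr_ge0 -?expR0 ?ler_expR// expR0 [`|y|]ger0_norm//.
  exact: expRB1_le.
have : expR y < 1 by rewrite -[ltRHS]expR0 ltr_expR.
rewrite -subr_lt0 => /ltr0_norm ->; rewrite (ltr0_norm y0).
have := expR_ge1Dx y; have : 1 <= expR (- y).
  by rewrite -[leLHS]expR0 ler_expR oppr_ge0 ltW.
by nra.
Qed.

(** Replaces an exponential of the absolute value by two true exponentials, which [expint]
    controls. *)
Lemma norm_le_cosh {R : realType} (a x : R) : 0 <= a ->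
  expR (a * `|x|) <= expR (a * x) + expR (- a * x).
Proof.
move=> a0; have [x0|x0] := ger0P x; first by rewrite lerDl expR_ge0.
by rewrite mulrN mulNr lerDr expR_ge0.
Qed.

Section SameTilts.
Context {R : realType} (mu nu : {measure set (measurableTypeR R) -> \bar R}).
Implicit Types (g H : R -> R) (a c x : R).

(** The test functions that cannot separate mu and nu, even after an exponential tilt. The
    uniqueness proof enlarges this class from constants to polynomials, then to Gaussian functions,
    then to indicators. *)
Definition same_tilts g := [/\ expint mu g, expint nu g & forall c,
  (\int[mu]_x (g x * expR (c * x))%:E = \int[nu]_x (g x * expR (c * x))%:E)%E].

(** Dominated convergence under both measures, with dominating function H times the exponential. *)
Lemma same_tilts_lim (g_ : nat -> R -> R) g H :
  (forall n, same_tilts (g_ n)) -> measurable_fun [set: R] g ->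
  (forall x, g_ ^~ x @ \oo --> g x) -> expint mu H -> expint nu H ->
  (forall n x, `|g_ n x| <= H x) -> same_tilts g.
Proof.
move=> sg mg gg emu enu gH.
have gH' x : `|g x| <= H x.
  have /cvg_norm cg := gg x.
  by apply: (ler_cvg_to cg (cvg_cst (H x))); exact: nearW.
have gHn x : `|g x| <= `|H x| by rewrite (le_trans (gH' x))// ler_norm.
have dc (m : {measure set (measurableTypeR R) -> \bar R}) c : expint m H ->
    (\int[m]_x (g_ n x * expR (c * x))%:E)%E @[n --> \oo] -->
    (\int[m]_x (g x * expR (c * x))%:E)%E.
  move=> [mH iH]; apply: (@dominated_cvg _ _ _ m setT _ _ _
     (fun x : R => (H x * expR (c * x))%:E)) => //.
  - by move=> n; apply: measurable_mul_expR; have [[]] := sg n.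
  - move=> x _; apply/cvg_EFin; first exact: nearW.
    by apply: cvgM => //; exact: cvg_cst.
  - by move=> n x _; rewrite lee_fin normrM ler_pM ?normr_ge0// ger0_norm ?expR_ge0.
split; [exact: expint_le emu | exact: expint_le enu|] => c.
apply: (cvg_unique _ (dc mu c emu)) => //.
have sgE n : (\int[mu]_x (g_ n x * expR (c * x))%:E =
    \int[nu]_x (g_ n x * expR (c * x))%:E)%E by have [_ _] := sg n.
by rewrite /= (funext sgE); exact: dc.
Qed.

Lemma same_tiltsD g H : same_tilts g -> same_tilts H ->
  same_tilts (fun x => g x + H x).
Proof.
move=> [g1 g2 g3] [h1 h2 h3]; split; [exact: expintD|exact: expintD|] => c.
under eq_integral do rewrite mulrDl EFinD.
rewrite integralD//; [|exact: g1.2|exact: h1.2].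
under [in RHS]eq_integral do rewrite mulrDl EFinD.
by rewrite integralD//; [rewrite g3 h3|exact: g2.2|exact: h2.2].
Qed.

Lemma same_tiltsZ a g : same_tilts g -> same_tilts (fun x => a * g x).
Proof.
move=> [g1 g2 g3]; split; [exact: expintZ|exact: expintZ|] => c.
under eq_integral do rewrite -mulrA EFinM.
rewrite integralZl//; last exact: g1.2.
under [in RHS]eq_integral do rewrite -mulrA EFinM.
by rewrite integralZl//; [rewrite g3|exact: g2.2].
Qed.

Lemma same_tilts_shift a g : same_tilts g ->
  same_tilts (fun x => g x * expR (a * x)).
Proof.
move=> [g1 g2 g3]; split; [exact: expint_shift|exact: expint_shift|] => c.
under eq_integral do rewrite -mulrA -expRD -mulrDl.
by under [in RHS]eq_integral do rewrite -mulrA -expRD -mulrDl.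
Qed.

Lemma eq_same_tilts g H : g =1 H -> same_tilts g -> same_tilts H.
Proof. by move=> /funext ->. Qed.

(* x * g is the limit of the difference quotients of a |-> g x * expR (a * x). *)
Lemma same_tilts_mulX g : same_tilts g -> same_tilts (fun x => g x * x).
Proof.
move=> sg.
(* For 0 < a <= 1 the quotient (exp (a x) - 1) / a is at most |x| exp |x| <= exp (2 |x|) in absolute
   value, hence the factor 2. *)
pose H x := `|g x| * expR (2 * x) + `|g x| * expR (- 2 * x).
have [[mg _] _ _] := sg.
apply: (@same_tilts_lim
  (fun n x => g x * ((expR (n.+1%:R^-1 * x) - 1) / n.+1%:R^-1)) _ H).
- move=> n; apply: (@eq_same_tilts (fun x =>
    n.+1%:R * (g x * expR (n.+1%:R^-1 * x) + -1 * g x))).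
    by move=> x; rewrite invrK; ring.
  apply: same_tiltsZ; apply: same_tiltsD; first exact: same_tilts_shift.
  exact: same_tiltsZ.
- by mfun.
- move=> x; apply: cvgM; first exact: cvg_cst.
  apply: (@squeeze_cvgr _ _ _ _ (fun=> x) (fun n => x * expR (n.+1%:R^-1 * x))).
  + apply: nearW => n; have h0 : 0 < n.+1%:R^-1 :> R by rewrite invr_gt0.
    move: h0; set h := n.+1%:R^-1; move: h => h h0.
    have := expR_ge1Dx (h * x); have := expRB1_le (h * x).
    by move: (expR _) => e ? ?; apply/andP; split;
      [rewrite ler_pdivlMr//|rewrite ler_pdivrMr//]; lra.
  + exact: cvg_cst.
  + have : x * expR (n.+1%:R^-1 * x) @[n --> \oo] --> x * expR (0 * x).
      apply: cvgM; first exact: cvg_cst.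
      apply: continuous_cvg; first exact: continuous_expR.
      by apply: cvgM; [exact: cvg_harmonic | exact: cvg_cst].
    by rewrite mul0r expR0 mulr1.
- apply: expintD; apply: expint_shift; apply: expint_norm; by case: sg.
- apply: expintD; apply: expint_shift; apply: expint_norm; by case: sg.
- move=> n x; rewrite /H -mulrDr normrM ler_wpM2l//.
  apply: le_trans (norm_le_cosh _ _) => //.
  have h0 : 0 < n.+1%:R^-1 :> R by rewrite invr_gt0.
  have h1 : n.+1%:R^-1 <= 1 :> R by rewrite invf_le1// ler1n.
  rewrite normrM normfV (gtr0_norm h0) ler_pdivrMr//.
  apply: le_trans (abs_expRB1_le _) _.
  rewrite normrM (gtr0_norm h0) -mulrA [leRHS]mulrC (ler_pM2l h0).
  rewrite [in leRHS]mulrDl mul1r expRD ler_pM//.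
    by apply: le_trans (expR_ge1Dx _); rewrite lerDr.
  by rewrite ler_expR ler_piMl.
Qed.

Lemma same_tilts_mulXn n g : same_tilts g -> same_tilts (fun x => g x * x ^+ n).
Proof.
move=> sg; elim: n => [|n IH]; first by under eq_fun do rewrite mulr1.
by under eq_fun do rewrite exprSr mulrA; exact: same_tilts_mulX.
Qed.

(** The partial sums of the exponential series at - eta x^2 are polynomials, and they are dominated
    by the full series at + eta x^2. This is why integrability is required with the opposite
    sign. *)
Lemma same_tilts_mul_gauss eta g : 0 <= eta -> same_tilts g ->
  expint mu (fun x => `|g x| * expR (eta * x ^+ 2)) ->
  expint nu (fun x => `|g x| * expR (eta * x ^+ 2)) ->
  same_tilts (fun x => g x * expR (- (eta * x ^+ 2))).
Proof.
move=> eta0 sg emu enu; have [[mg _] _ _] := sg.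
apply: (same_tilts_lim (g_ := fun n x =>
    g x * series (exp_coeff (- (eta * x ^+ 2))) n) _ _ _ emu enu).
- elim=> [|n IH].
    apply: (@eq_same_tilts (fun x => 0 * g x)); last exact: same_tiltsZ.
    by move=> x; rewrite /series/= big_geq// mulr0 mul0r.
  apply: (@eq_same_tilts (fun x => g x * series (exp_coeff (- (eta * x ^+ 2))) n
      + ((- eta) ^+ n / n`!%:R) * (g x * x ^+ (2 * n)))).
    move=> x; rewrite /series/= big_nat_recr//= mulrDr; congr (_ + _).
    rewrite /exp_coeff/= -mulNr exprMn exprM; ring.
  by apply: same_tiltsD => //; apply: same_tiltsZ; exact: same_tilts_mulXn.
- by mfun.
- move=> x; apply: cvgM; first exact: cvg_cst.
  exact: is_cvg_series_exp_coeff.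
- move=> n x; rewrite normrM ler_wpM2l//.
  apply: (@le_trans _ _ (series (exp_coeff (eta * x ^+ 2)) n)).
    rewrite /series/=; apply: le_trans (ler_norm_sum _ _ _) _.
    apply: ler_sum => i _; rewrite /exp_coeff/= normrM normrX normrN normfV.
    by rewrite normr_nat ger0_norm// mulr_ge0// sqr_ge0.
  apply: nondecreasing_cvgn_le; last exact: is_cvg_series_exp_coeff.
  apply/nondecreasing_seqP => m; rewrite /series/= big_nat_recr//= lerDl.
  by rewrite exp_coeff_ge0// mulr_ge0// sqr_ge0.
Qed.

Variable delta : R.
Hypotheses (delta0 : 0 < delta) (same1 : same_tilts (fun=> 1))
  (emu : expint mu (fun x => expR (delta * x ^+ 2)))
  (enu : expint nu (fun x => expR (delta * x ^+ 2))).

(** A bound on g reduces the integrability of |g| exp (eta x^2), for eta <= delta, to that of exp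
    (delta x^2). Multiplication by a Gaussian function preserves the bound, so it can be
    repeated. *)
Definition bounded_same_tilts g := same_tilts g /\ exists C, forall x, `|g x| <= C.

Lemma bounded_same_tilts_mul_gauss0 lam g : 0 <= lam -> bounded_same_tilts g ->
  bounded_same_tilts (fun x => g x * expR (- (lam * x ^+ 2))).
Proof.
move=> lam0 bg.
have small eta h : 0 <= eta <= delta -> bounded_same_tilts h ->
    bounded_same_tilts (fun x => h x * expR (- (eta * x ^+ 2))).
  move=> /andP[eta0 etad] [sh [C hC]].
  have [[mh _] _ _] := sh.
  have C0 : 0 <= C by apply: le_trans (hC 0).
  split; last first.
    exists C => x; rewrite normrM (ger0_norm (expR_ge0 _)).
    apply: le_trans (hC x); rewrite ler_piMr// -[leRHS]expR0 ler_expR.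
    by rewrite oppr_le0 mulr_ge0// sqr_ge0.
  have dom (m : {measure set (measurableTypeR R) -> \bar R}) :
      expint m (fun x => expR (delta * x ^+ 2)) ->
      expint m (fun x => `|h x| * expR (eta * x ^+ 2)).
    move=> em; apply: expint_le (expintZ C em).
      by apply: measurable_funM; [exact: measurableT_comp | mfun].
    move=> x; rewrite !normrM normr_id !(ger0_norm (expR_ge0 _)) (ger0_norm C0).
    by rewrite ler_pM ?expR_ge0// ler_expR ler_wpM2r// sqr_ge0.
  by apply: same_tilts_mul_gauss => //; exact: dom.
(* The available delta is fixed and may be smaller than lam: the Gaussian factor is split into n + 1
   equal factors, each narrow enough for [small]. *)
have [n lamn] : exists n : nat, lam / n.+1%:R <= delta.
  exists (Num.truncn (lam / delta)); rewrite ler_pdivrMr// mulrC -ler_pdivrMr//.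
  by rewrite ltW// truncnS_gt.
have : forall k : nat, bounded_same_tilts
    (fun x => g x * expR (- (lam / n.+1%:R * k%:R * x ^+ 2))).
  elim=> [|k IH].
    by under eq_fun do rewrite mulr0 mul0r oppr0 expR0 mulr1.
  under eq_fun do
    rewrite -[k.+1%:R]natr1 mulrDr mulr1 mulrDl opprD expRD mulrA.
  by apply: small => //; rewrite lamn andbT divr_ge0.
by move=> /(_ n.+1); rewrite divfK.
Qed.

Lemma bounded_same_tilts_mul_gauss lam y g : 0 <= lam -> bounded_same_tilts g ->
  bounded_same_tilts (fun x => g x * expR (- (lam * (x - y) ^+ 2))).
Proof.
move=> lam0 bg; have [sg [C gC]] := bg; split; last first.
  exists C => x; rewrite normrM (ger0_norm (expR_ge0 _)).
  apply: le_trans (gC x); rewrite ler_piMr// -[leRHS]expR0 ler_expR.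
  by rewrite oppr_le0 mulr_ge0// sqr_ge0.
apply: (@eq_same_tilts (fun x => expR (- (lam * y ^+ 2)) *
    (g x * expR (- (lam * x ^+ 2)) * expR (2 * lam * y * x)))).
  by move=> x; rewrite mulrC -!mulrA -!expRD; congr (_ * expR _); ring.
apply: same_tiltsZ; apply: same_tilts_shift.
by have [] := bounded_same_tilts_mul_gauss0 lam0 bg.
Qed.

(** With u the Gaussian function, (1 - u)^(k+1) = (1 - u)^k - (1 - u)^k u, and everything stays in
    [0, 1]. *)
Lemma bounded_same_tilts_comp lam y k : 0 <= lam ->
  bounded_same_tilts (fun x => (1 - expR (- (lam * (x - y) ^+ 2))) ^+ k).
Proof.
move=> lam0; elim: k => [|k IH].
  by split=> //; exists 1 => x; rewrite expr0 normr1.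
have u01 x : 0 <= 1 - expR (- (lam * (x - y) ^+ 2)) <= 1.
  rewrite subr_ge0 gerBl expR_ge0 andbT -[leRHS]expR0 ler_expR.
  by rewrite oppr_le0 mulr_ge0// sqr_ge0.
split; last first.
  exists 1 => x; have /andP[u0 u1] := u01 x.
  by rewrite ger0_norm ?exprn_ge0// exprn_ile1.
apply: (@eq_same_tilts (fun x => (1 - expR (- (lam * (x - y) ^+ 2))) ^+ k +
   -1 * ((1 - expR (- (lam * (x - y) ^+ 2))) ^+ k * expR (- (lam * (x - y) ^+ 2))))).
  by move=> x; rewrite (exprSr _ k) mulN1r mulrBr mulr1.
apply: same_tiltsD; first by case: IH.
by apply: same_tiltsZ; have [] := bounded_same_tilts_mul_gauss y lam0 IH.
Qed.

(* The approximation of the indicator of [u < 1/2] by the polynomials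
   (1 - u ^ n) ^ (n 2 ^ n), with u = expR (- (lam * (x - y) ^+ 2)). *)
Lemma same_tilts_outside (y r : R) : 0 < r ->
  same_tilts \1_[set x : R | r < `|x - y|].
Proof.
(* This lam makes u < 1/2 equivalent to r < |x - y|. Below, [v n] is u to the power n + 1. *)
move=> r0; pose lam := ln 2 / r ^+ 2.
have ln20 : 0 < ln 2 :> R by rewrite ln_gt0// ltr1n.
have lam0 : 0 < lam by rewrite divr_gt0// exprn_gt0.
have lamr : lam * r ^+ 2 = ln 2 by rewrite divfK// expf_neq0// gt_eqF.
pose v n x := expR (- (n.+1%:R * lam * (x - y) ^+ 2)).
pose k n := (n.+1 * 2 ^ n.+1)%N.
have v1 n x : 0 <= v n x <= 1.
  rewrite expR_ge0/= -[leRHS]expR0 ler_expR oppr_le0 mulr_ge0 ?sqr_ge0//.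
  by rewrite mulr_ge0// ltW.
(* With p = n + 1 and b = lam (x - y)^2 - ln 2, the product of the exponent and [v n x] is p exp (-
   p b): it tends to 0 for b > 0 and to infinity for b <= 0. *)
have kv n x : (k n)%:R * v n x =
    n.+1%:R * expR (- (n.+1%:R * (lam * (x - y) ^+ 2 - ln 2))).
  rewrite natrM -mulrA natrX -[2%:R as X in X ^+ _]lnK ?posrE// -expRM_natl.
  by rewrite -expRD; congr (_ * expR _); ring.
apply: (@same_tilts_lim (fun n x => (1 - v n x) ^+ k n) _ (fun=> 1)).
- move=> n; have nlam0 : 0 <= n.+1%:R * lam by rewrite mulr_ge0// ltW.
  by have [] := bounded_same_tilts_comp y (k n) nlam0.
- apply: measurable_indic.
  rewrite (_ : [set x | _] = (fun x : R => `|x - y|) @^-1` `]r, +oo[).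
    have mabs : measurable_fun [set: R] (fun x : R => `|x - y|).
      by apply: measurableT_comp => //; mfun.
    by rewrite -[X in measurable X]setTI; exact: mabs.
  by apply/seteqP; split=> x /=; rewrite in_itv/= andbT.
- move=> x; have [xr|xr] := ltP r `|x - y|.
  + have b0 : 0 < lam * (x - y) ^+ 2 - ln 2.
      rewrite subr_gt0 -lamr ltr_pM2l// -[(x - y) ^+ 2]real_normK ?num_real//.
      by rewrite ltr_pXn2r// ?nnegrE// ltW.
    rewrite indicE mem_set//=; set b := _ - _ in b0.
    apply: (@squeeze_cvgr _ _ _ _ (fun n => 1 - (2 / b ^+ 2) * n.+1%:R^-1) (fun=> 1)).
    * apply: nearW => n; have /andP[v0 v1'] := v1 n x; apply/andP; split; last first.
        by rewrite exprn_ile1 ?subr_ge0// gerBl.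
      (* Bernoulli's inequality, followed by exp y >= y^2 / 2 to bound p exp (- p b) by 2 / (b^2
         p). *)
      apply: (@le_trans _ _ (1 - (k n)%:R * v n x)); last first.
        elim: (k n) => [|j IH]; first by rewrite mul0r subr0 expr0.
        rewrite (exprSr _ j) -natr1 mulrDl mul1r.
        have := ler_wpM2r (_ : 0 <= 1 - v n x) IH; rewrite subr_ge0 => /(_ v1').
        apply: le_trans; have : 0 <= j%:R * v n x ^+ 2 by rewrite mulr_ge0// sqr_ge0.
        by lra.
      rewrite lerD2l lerN2 kv -/b expRN.
      have n0 : 0 < n.+1%:R :> R by [].
      have nb0 : 0 < n.+1%:R * b by rewrite mulr_gt0.
      have eb : (n.+1%:R * b) ^+ 2 / 2 <= expR (n.+1%:R * b).
        by apply: le_trans (expR_ge1Dxn 1 (ltW nb0)); rewrite lerDr.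
      rewrite ler_pdivrMr ?expR_gt0//.
      rewrite [leLHS](_ : _ = 2 / b ^+ 2 / n.+1%:R * ((n.+1%:R * b) ^+ 2 / 2)).
        by rewrite ler_wpM2l// !divr_ge0// ?sqr_ge0// ltW.
      move: (n.+1%:R) n0 => p p0; field.
      by rewrite !gt_eqF.
    * have : (1 - (2 / b ^+ 2) * n.+1%:R^-1) @[n --> \oo] --> 1 - (2 / b ^+ 2) * 0.
        apply: cvgB; first exact: cvg_cst.
        by apply: cvgM; [exact: cvg_cst | exact: cvg_harmonic].
      by rewrite mulr0 subr0.
    * exact: cvg_cst.
  + rewrite indicE memNset/=; last by apply/negP; rewrite -leNgt.
    apply: (@squeeze_cvgr _ _ _ _ (fun=> 0) (fun n => expR (- n.+1%:R))).
    * apply: nearW => n; have /andP[v0 v1'] := v1 n x.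
      rewrite exprn_ge0 ?subr_ge0//=.
      (* From 1 - v <= exp (- v), the power is at most exp (- p exp (- p b)) <= exp (- p), since b
         <= 0. *)
      apply: (@le_trans _ _ (expR (- v n x) ^+ k n)).
        rewrite lerXn2r ?nnegrE ?expR_ge0 ?subr_ge0//.
        exact: expR_ge1Dx.
      rewrite -expRM_natl ler_expR mulrN lerN2 kv ler_peMr//.
      rewrite -[leLHS]expR0 ler_expR oppr_ge0 mulr_ge0_le0// subr_le0 -lamr.
      rewrite ler_pM2l// -[(x - y) ^+ 2]real_normK ?num_real//.
      by rewrite lerXn2r// ?nnegrE// ltW.
    * exact: cvg_cst.
    * by have := @cvgn_expR R; rewrite -cvg_shiftS.
- by case: same1.
- by case: same1.
- move=> n x; have /andP[v0 v1'] := v1 n x.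
  by rewrite ger0_norm ?exprn_ge0 ?subr_ge0// exprn_ile1 ?subr_ge0// gerBl.
Qed.

Lemma measure_unique_same_tilts A : measurable A -> mu A = nu A.
Proof.
have total (B : set R) : measurable B -> same_tilts \1_B -> mu B = nu B.
  move=> mB [_ _ /(_ 0)].
  under eq_integral do rewrite mul0r expR0 mulr1.
  under [in RHS]eq_integral do rewrite mul0r expR0 mulr1.
  by rewrite !integral_indic// !setIT.
have muT : (mu setT < +oo)%E.
  have [[_ /(_ 0) i1] _ _] := same1.
  have /integrableP[_] := i1.
  under eq_integral do rewrite mul1r mul0r expR0 abse1.
  by rewrite integral_cst// mul1e.
have nuT : (nu setT < +oo)%E.
  have [_ [_ /(_ 0) i1] _] := same1.
  have /integrableP[_] := i1.
  under eq_integral do rewrite mul1r mul0r expR0 abse1.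
  by rewrite integral_cst// mul1e.
have fin (m : {measure set (measurableTypeR R) -> \bar R})
    (B : set (measurableTypeR R)) :
    measurable B -> (m setT < +oo)%E -> (m B < +oo)%E.
  by move=> mB; apply: le_lt_trans; apply: le_measure => //; exact: mem_set.
(* With p = n + 1, this is the complement of [a - 2p, a]: it is of the form treated by
   [same_tilts_outside], and it decreases to the ray of origin a. *)
pose F (a : R) (n : nat) := [set x : R | n.+1%:R < `|x - (a - n.+1%:R)|].
have mF a n : measurable (F a n).
  have mabs : measurable_fun [set: R] (fun x : R => `|x - (a - n.+1%:R)|).
    by apply: measurableT_comp => //; mfun.
  rewrite (_ : F a n = (fun x : R => `|x - (a - n.+1%:R)|) @^-1` `]n.+1%:R, +oo[).
    by rewrite -[X in measurable X]setTI; exact: mabs.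
  by apply/seteqP; split=> x /=; rewrite in_itv/= andbT.
have capF a : \bigcap_n F a n = `]a, +oo[%classic.
  apply/seteqP; split=> x /=; rewrite in_itv/= andbT.
    move=> Fx; rewrite ltNge; apply/negP => xa.
    have := Fx (Num.truncn (a - x)) I; rewrite /F/=.
    have := truncnS_gt (a - x); set n := _.+1%:R => nx.
    by rewrite ltNge ler_norml; lra.
  move=> ax n _; rewrite /F/=; have : 0 < n.+1%:R :> R by [].
  move: (n.+1%:R) => p p0.
  by rewrite ger0_norm; lra.
have ndF a : nonincreasing_seq (F a).
  move=> i j ij; apply/subsetPset => x; rewrite /F/=.
  have : i.+1%:R <= j.+1%:R :> R by rewrite ler_nat ltnS.
  have : 0 < i.+1%:R :> R by []. 
  move: (i.+1%:R) (j.+1%:R) => p q p0 pq.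
  by rewrite !ltr_normr; lra.
move=> mA; refine (@measure_unique _ R (measurableTypeR R) (@RGenOInfty.G R)
  (fun n => `]- n%:R, +oo[%classic) _ _ _ _ mu nu _ _ A mA).
- exact: RGenOInfty.measurableE.
- move=> _ _ [x ->] [y ->]; exists (Num.max x y).
  by apply/seteqP; split => z /=; rewrite !in_itv/= !andbT gt_max => /andP.
- by move=> i; exists (- i%:R).
- apply/seteqP; split=> // x _; exists (Num.truncn `|x|).+1 => //=.
  rewrite in_itv/= andbT ltrNl; apply: le_lt_trans (truncnS_gt _).
  by rewrite -normrN ler_norm.
- move=> _ [a ->].
  have cF (m : {measure set (measurableTypeR R) -> \bar R}) : (m setT < +oo)%E ->
      m (F a n) @[n --> \oo] --> m `]a, +oo[%classic.
    move=> mT; rewrite -capF; apply: nonincreasing_cvg_mu => //.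
    - by apply: fin => //; exact: mF.
    - by move=> i; exact: mF.
    - by apply: bigcapT_measurable => i; exact: mF.
  apply: (cvg_unique _ (cF mu muT)) => //.
  rewrite (_ : (fun n => mu (F a n)) = (fun n => nu (F a n))); first exact: cF.
  by apply/funext => n; apply: total => //; exact: same_tilts_outside.
- by move=> k; apply: fin => //; exact: measurable_itv.
Qed.

End SameTilts.

Section FiniteMeasureOfMass.
Context {d : measure_display} {T : measurableType d} {R : realType}.
Variable mu : {measure set T -> \bar R}.
Hypothesis muT : (mu setT < +oo)%E.

Definition finite_mass_def : set T -> \bar R := mu.
HB.instance Definition _ := Measure.on finite_mass_def.
HB.instance Definition _ :=
  @Measure_isFinite.Build _ _ _ finite_mass_def (lty_fin_num_fun muT).
Definition finite_mass : {finite_measure set T -> \bar R} := finite_mass_def.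

End FiniteMeasureOfMass.

Section GaussianUniqueness.
Context {R : realType}.
Implicit Types (m K C : R).

Definition gaussian_mgf (mu : {measure set (measurableTypeR R) -> \bar R}) C m K :=
  forall c, (\int[mu]_x (expR (c * x))%:E =
    (C * expR (c * m + 2^-1 * c ^+ 2 * K))%:E)%E.

Lemma measurable_EFin_expR c : measurable_fun [set: R] (fun x : R => (expR (c * x))%:E).
Proof. by apply/measurable_EFinP; mfun. Qed.

Lemma gaussian_mgf_mass mu C m K : gaussian_mgf mu C m K -> mu setT = C%:E.
Proof.
move=> /(_ 0); rewrite mul0r expr0n/= mulr0 mul0r addr0 expR0 mulr1 => <-.
under eq_integral do rewrite mul0r expR0.
by rewrite integral_cst// mul1e.
Qed.

Lemma gaussian_mgf_expint1 mu C m K : gaussian_mgf mu C m K -> expint mu (fun=> 1).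
Proof.
move=> gm; split=> // c; under eq_fun do rewrite mul1r.
apply/integrableP; split; first exact: measurable_EFin_expR.
under eq_integral do rewrite gee0_abs ?lee_fin ?expR_ge0//.
by rewrite gm ltry.
Qed.

(* expR (x ^+ 2 / 2) is itself a Gaussian mixture of exponentials, which reduces
   the claim to the moment generating function by Tonelli. *)
Lemma gaussian_mgf_expint_quad mu C m K (delta : R) : 0 <= K -> 0 <= delta ->
  2 * delta * K < 1 -> gaussian_mgf mu C m K ->
  expint mu (fun x => expR (delta * x ^+ 2)).
Proof.
move=> K0 delta0 dK gm; split; first by mfun.
move=> c.
have muT : (mu setT < +oo)%E by rewrite (gaussian_mgf_mass gm) ltry.
have mq : measurable_fun [set: R]
    (fun x : R => (expR (delta * x ^+ 2) * expR (c * x))%:E).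
  by apply/measurable_EFinP; mfun.
apply/integrableP; split => //.
under eq_integral do rewrite gee0_abs ?lee_fin ?mulr_ge0 ?expR_ge0//.
have gE x : ((expR (delta * x ^+ 2) * expR (c * x))%:E =
    \int[gaussm 0 (2 * delta)]_y (expR (y * x) * expR (c * x))%:E)%E.
  under eq_integral do rewrite EFinM mulrC.
  rewrite ge0_integralZr//.
  - rewrite integral_gaussm_exp ?mulr_ge0// mulr0 add0r -EFinM.
    by congr (expR _ * _)%:E; field.
  - exact: measurable_EFin_expR.
under eq_integral do rewrite gE.
have mF : measurable_fun [set: R * R]
   (fun z : R * R => (expR (z.2 * z.1) * expR (c * z.1))%:E).
  by apply/measurable_EFinP; mfun.
rewrite (@fubini_tonelli _ _ (measurableTypeR R) (measurableTypeR R) R (finite_mass muT) (gaussm 0 (2 * delta))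
  (fun z : R * R => (expR (z.2 * z.1) * expR (c * z.1))%:E) mF); last first.
  by move=> z; rewrite lee_fin mulr_ge0 ?expR_ge0.
rewrite /=.
under eq_integral.
  move=> y _; under eq_integral do rewrite -expRD -mulrDl.
  rewrite gm; over.
(* After Tonelli, the integrand in y is a quadratic tilt with coefficient - K of the law
   [gaussm 0 (2 * delta)]; its integral is finite because 1 - 2 delta K > 0. *)
have eE y : C * expR ((y + c) * m + 2^-1 * (y + c) ^+ 2 * K) =
  (C * expR (c * m + 2^-1 * c ^+ 2 * K)) *
     expR ((m + c * K) * y - 2^-1 * (- K) * y ^+ 2).
  by rewrite -[RHS]mulrA -expRD; congr (_ * expR _); field.
under eq_integral do rewrite eE EFinM.
have C0 : 0 <= C by rewrite -lee_fin -(gaussian_mgf_mass gm).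
rewrite ge0_integralZl//.
- by rewrite integral_gaussm_quad ?mulr_ge0 -?EFinM ?ltry//; nra.
- by apply/measurable_EFinP; mfun.
- by rewrite lee_fin mulr_ge0// expR_ge0.
Qed.

Theorem gaussian_mgf_unique mu C m K : 0 <= K -> gaussian_mgf mu C m K ->
  forall A, measurable A -> mu A = (C%:E * gaussm m K A)%E.
Proof.
move=> K0 gm A mA.
have C0 : 0 <= C by rewrite -lee_fin -(gaussian_mgf_mass gm).
pose nu : {measure set (measurableTypeR R) -> \bar R} := mscale (NngNum C0) (gaussm m K).
have gn : gaussian_mgf nu C m K.
  move=> c; rewrite ge0_integral_mscale//; last exact: measurable_EFin_expR.
  by rewrite integral_gaussm_exp// [in RHS]EFinM.
(* Any positive delta with 2 delta K < 1 will do; K + 1 covers the case K = 0. *)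
pose delta := (4 * (K + 1))^-1.
have d0 : 0 < delta by rewrite invr_gt0 mulr_gt0// ltr_wpDl.
have dK : 2 * delta * K < 1.
  have : 4 * (K + 1) * delta = 1 by rewrite mulfV// gt_eqF// mulr_gt0// ltr_wpDl.
  by nra.
apply: (@measure_unique_same_tilts R mu nu delta d0) => //.
- split; [exact: gaussian_mgf_expint1 gm|exact: gaussian_mgf_expint1 gn|] => c.
  under eq_integral do rewrite mul1r.
  by under [in RHS]eq_integral do rewrite mul1r; rewrite gm gn.
- by apply: gaussian_mgf_expint_quad gm => //; exact: ltW.
- by apply: gaussian_mgf_expint_quad gn => //; exact: ltW.
Qed.

End GaussianUniqueness.

Section PushforwardMeasure.
Context {d1 d2 : measure_display} {T1 : measurableType d1} {T2 : measurableType d2}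
  {R : realType}.
Variables (mu : {measure set T1 -> \bar R}) (phi : T1 -> T2).
Hypothesis mphi : measurable_fun setT phi.

Definition pushm : {measure set T2 -> \bar R} :=
  measure_function_pushforward__canonical__measure_function_Measure mu mphi.

Lemma pushmE A : pushm A = mu (phi @^-1` A). Proof. by []. Qed.

Lemma ge0_integral_pushm (f : T2 -> \bar R) : measurable_fun setT f ->
  (forall y, 0 <= f y)%E -> (\int[pushm]_y f y = \int[mu]_x f (phi x))%E.
Proof. by move=> mf f0; rewrite ge0_integral_pushforward. Qed.

End PushforwardMeasure.

(** Plays the part of the limit t -> 0 in the variance squeeze, where the error is linear in t. *)
Lemma ler_add_vanishing {R : realType} (a b c : R) :
  (forall t, 0 < t < 1 -> a <= b + c * t) -> a <= b.
Proof.
move=> H; apply/ler_addgt0Pr => e e0.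
pose t := Num.min (2^-1) (e / (`|c| + 1)).
have c0 : 0 < `|c| + 1 by rewrite ltr_wpDl.
have t0 : 0 < t by rewrite lt_min invr_gt0 ltr0n/= divr_gt0.
have t1 : t < 1.
  by apply: (@le_lt_trans _ _ 2^-1); rewrite ?ge_min ?lexx// invf_lt1// ltr1n.
apply: le_trans (H t _) _; first by rewrite t0.
rewrite lerD2l; apply: le_trans (ler_norm _) _; rewrite normrM (gtr0_norm t0).
apply: (@le_trans _ _ ((`|c| + 1) * (e / (`|c| + 1)))).
  apply: ler_pM; [by []|exact: ltW|by rewrite lerDl|].
  by rewrite /t ge_min lexx orbT.
by rewrite mulrC divfK// gt_eqF.
Qed.

(** * Moments of Gaussian laws and variables *)

Section GaussianMoments.
Context {R : realType}.
Implicit Types (m K S x : R).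

Lemma measurable_EFin_sqr m : measurable_fun [set: R] (fun x : R => ((x - m) ^+ 2)%:E).
Proof. by apply/measurable_EFinP; mfun. Qed.

Lemma integral_gaussm_centered_quad m K S : 0 <= K -> 0 < 1 + S * K ->
  (\int[gaussm m K]_x (expR (- (2^-1 * S * (x - m) ^+ 2)))%:E =
   ((Num.sqrt (1 + S * K))^-1)%:E)%E.
Proof.
move=> K0 D0.
have E x : expR (- (2^-1 * S * (x - m) ^+ 2)) =
    expR (- (2^-1 * S * m ^+ 2)) * expR ((S * m) * x - 2^-1 * S * x ^+ 2).
  by rewrite -expRD; congr expR; field.
under eq_integral do rewrite E EFinM.
rewrite ge0_integralZl//.
- rewrite integral_gaussm_quad// -EFinM mulrCA -expRD [X in expR X](_ : _ = 0).
    by rewrite expR0 mulr1.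
  by field; rewrite gt_eqF.
- by apply/measurable_EFinP; mfun.
Qed.

(* Squeezed between the Laplace transforms of (x - m) ^+ 2 at small arguments of
   both signs. *)
Lemma gaussm_variance m K : 0 <= K ->
  (\int[gaussm m K]_x ((x - m) ^+ 2)%:E = K%:E)%E.
Proof.
move=> K0.
have [->|K1] := eqVneq K 0.
  rewrite /gaussm eqxx integral_dirac// ?diracT ?mul1e ?subrr ?expr0n//.
  exact: measurable_EFin_sqr.
have K0' := K0; have {K1}K0 : 0 < K by rewrite lt_def K1.
set V := (\int[_]_x _)%E.
have V0 : (0 <= V)%E by apply: integral_ge0 => x _; rewrite lee_fin sqr_ge0.
have intS S : 0 <= S -> (\int[gaussm m K]_x (2^-1 * S * (x - m) ^+ 2)%:E = (2^-1 * S)%:E * V)%E.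
  move=> S0; under eq_integral do rewrite EFinM.
  rewrite ge0_integralZl//.
  - exact: measurable_EFin_sqr.
  - by move=> x _; rewrite lee_fin sqr_ge0.
  - by rewrite lee_fin mulr_ge0.
have int1 : (\int[gaussm m K]_x 1%:E = 1)%E.
  by rewrite integral_cst// mul1e; exact: probability_setT.
have DE (s : R) : 1 + (s / K) * K = 1 + s by rewrite divfK// gt_eqF.
(* From 1 + y <= exp y, with the growing tilt of coefficient - t / K. *)
have upper t : 0 < t < 1 ->
    (1 + (2^-1 * (t / K))%:E * V <= ((Num.sqrt (1 - t))^-1)%:E)%E.
  move=> /andP[t0 t1].
  have S0 : 0 <= t / K by rewrite divr_ge0// ltW.
  have y0 x : 0 <= 2^-1 * (t / K) * (x - m) ^+ 2.
    by rewrite mulr_ge0 ?sqr_ge0// mulr_ge0.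
  rewrite -DE mulNr -(@integral_gaussm_centered_quad m K (- (t / K)))//; last first.
    by rewrite -mulNr DE subr_gt0.
  rewrite -intS// -int1 -ge0_integralD//.
  - apply: ge0_le_integral => //.
    + by move=> x _; rewrite adde_ge0// lee_fin.
    + apply: emeasurable_funD => //; by apply/measurable_EFinP; mfun.
    + by apply/measurable_EFinP; mfun.
    + by move=> x _; rewrite -[1%E]/(1%:E) -EFinD lee_fin; apply: le_trans (expR_ge1Dx _); lra.
  - by move=> x _; rewrite lee_fin.
  - by apply/measurable_EFinP; mfun.
(* From 1 <= exp (- y) + y, with the decaying tilt of coefficient t / K. *)
have lower t : 0 < t < 1 ->
    (1 <= ((Num.sqrt (1 + t))^-1)%:E + (2^-1 * (t / K))%:E * V)%E.
  move=> /andP[t0 t1].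
  have S0 : 0 <= t / K by rewrite divr_ge0// ltW.
  have y0 x : 0 <= 2^-1 * (t / K) * (x - m) ^+ 2.
    by rewrite mulr_ge0 ?sqr_ge0// mulr_ge0.
  rewrite -DE -(@integral_gaussm_centered_quad m K (t / K))//; last first.
    by rewrite DE addr_gt0.
  rewrite -intS// -[leLHS]int1 -ge0_integralD//.
  - apply: ge0_le_integral => //.
    + by apply: emeasurable_funD; apply/measurable_EFinP; mfun.
    + move=> x _; rewrite -EFinD lee_fin.
      by have := expR_ge1Dx (- (2^-1 * (t / K) * (x - m) ^+ 2)); lra.
  - by apply/measurable_EFinP; mfun.
  - by move=> x _; rewrite lee_fin.
  - by apply/measurable_EFinP; mfun.
(* An infinite variance would contradict [upper] at t = 1/2. *)
case: V V0 {intS} upper lower => [v| |]//; last first.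
  move=> _ /(_ 2^-1); rewrite gt0_muley ?lte_fin ?mulr_gt0 ?divr_gt0 ?invr_gt0//.
  have h1 : (2^-1 < 1 :> R) by rewrite invf_lt1// ltr1n.
  by rewrite ltr0n h1 addey// leye_eq => /(_ isT).
rewrite lee_fin => v0 upper lower; congr EFin; apply: le_anti; apply/andP; split.
- apply: (@ler_add_vanishing _ _ _ v) => t t01; have /andP[t0 t1] := t01.
  have := upper t t01; rewrite -EFinM -EFinD lee_fin.
  have q0 : 0 < Num.sqrt (1 - t) by rewrite sqrtr_gt0 subr_gt0.
  have qq : Num.sqrt (1 - t) ^+ 2 = 1 - t by rewrite sqr_sqrtr// subr_ge0 ltW.
  move: (Num.sqrt _) q0 qq => q q0 qq H.
  (* With q^2 = 1 - t one has 1/q - 1 = t / (q (1 + q)), so t cancels from the inequality. *)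
  have {}H : v * (q * (1 + q)) <= 2 * K.
    have := ler_wpM2r (ltW (_ : 0 < K * q * (1 + q) * 2)) H.
    rewrite !mulr_gt0 ?addr_gt0// => /(_ isT).
    rewrite (_ : q^-1 * _ = 2 * K * (1 + q)); last by field; rewrite gt_eqF.
    rewrite (_ : (1 + _) * _ = 2 * K * q * (1 + q) + t * v * q * (1 + q)); last first.
      by field; rewrite gt_eqF.
    have -> : 2 * K * (1 + q) = 2 * K * q * (1 + q) + 2 * K * (1 - q ^+ 2) by ring.
    rewrite qq lerD2l => H'.
    by rewrite -(ler_pM2l t0); lra.
  have q1 : q <= 1 by nra.
  (* Since q <= 1, q (1 + q) >= 2 q^2 = 2 - 2 t. *)
  have : v * (2 - 2 * t) <= v * (q * (1 + q)) by rewrite ler_wpM2l//; nra.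
  by lra.
- apply: (@ler_add_vanishing _ _ _ v) => t t01; have /andP[t0 t1] := t01.
  have := lower t t01; rewrite -EFinM -EFinD lee_fin.
  have q0 : 0 < Num.sqrt (1 + t) by rewrite sqrtr_gt0 addr_gt0.
  have qq : Num.sqrt (1 + t) ^+ 2 = 1 + t by rewrite sqr_sqrtr// addr_ge0// ltW.
  move: (Num.sqrt _) q0 qq => q q0 qq H.
  have {}H : 2 * K <= v * (q * (1 + q)).
    have := ler_wpM2r (ltW (_ : 0 < K * q * (1 + q) * 2)) H.
    rewrite !mulr_gt0 ?addr_gt0// => /(_ isT).
    rewrite (_ : (q^-1 + _) * _ = 2 * K * (1 + q) + t * v * q * (1 + q)); last first.
      by field; rewrite !gt_eqF.
    have -> : 1 * (K * q * (1 + q) * 2) = 2 * K * (1 + q) + 2 * K * (q ^+ 2 - 1) by ring.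
    rewrite qq lerD2l => H'.
    by rewrite -(ler_pM2l t0); lra.
  have q1 : 1 <= q by nra.
  have : v * (q * (1 + q)) <= v * (2 + 2 * t) by rewrite ler_wpM2l//; nra.
  by lra.
Qed.

(** The reflected law has the same moment generating function. First moments are computed by this
    symmetry: it exchanges the positive and negative parts of x - m. *)
Lemma gaussm_reflect m K (f : R -> \bar R) : 0 <= K ->
  measurable_fun [set: R] f -> (forall x, 0 <= f x)%E ->
  (\int[gaussm m K]_x f (2 * m - x)%R = \int[gaussm m K]_x f x)%E.
Proof.
move=> K0 mf f0.
have mr : measurable_fun [set: measurableTypeR R]
    (fun x : measurableTypeR R => 2 * m - x : measurableTypeR R).
  by apply: measurable_funB => //; exact: measurable_cst.
rewrite -(ge0_integral_pushm (gaussm m K) mr mf f0).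
apply: eq_measure_integral => A mA _.
rewrite (@gaussian_mgf_unique _ _ 1 m K)// ?mul1e// => c.
rewrite ge0_integral_pushm//; last exact: measurable_EFin_expR.
have E x : expR (c * (2 * m - x)) = expR (2 * c * m) * expR ((- c) * x).
  by rewrite -expRD; congr expR; ring.
under eq_integral do rewrite E EFinM.
rewrite ge0_integralZl//; last exact: measurable_EFin_expR.
rewrite integral_gaussm_exp// -EFinM -expRD mul1r; congr (expR _)%:E.
by ring.
Qed.

End GaussianMoments.

Section CenteredVariables.
Context {d : measure_display} {T : measurableType d} {R : realType}.
Variable P : probability T R.

Lemma sqr_integrable_integrable (W : T -> R) : measurable_fun setT W ->
  (\int[P]_w ((W w) ^+ 2)%:E < +oo)%E -> P.-integrable setT (EFin \o W).
Proof.
move=> mW W2.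
have i2 : P.-integrable setT (fun w => ((W w) ^+ 2)%:E).
  apply/integrableP; split; first by apply/measurable_EFinP; mfun.
  by under eq_integral do rewrite gee0_abs ?lee_fin ?sqr_ge0//.
have i1 : P.-integrable setT (EFin \o (cst 1 : T -> R)).
  exact: finite_measure_integrable_cst.
apply: le_integrable (integrableD measurableT i1 i2) => //.
  exact/measurable_EFinP.
move=> w _; have W20 : 0 <= 1 + W w ^+ 2 by rewrite addr_ge0// sqr_ge0.
rewrite [leRHS](_ : _ = (1 + W w ^+ 2)%:E); last first.
  by rewrite gee0_abs -?EFinD// lee_fin.
rewrite /= lee_fin; have := sqr_ge0 (W w - 1); have := sqr_ge0 (W w + 1).
by have [] := ger0P (W w); lra.
Qed.

(** The change of law formulas concern nonnegative functions, so a signed integral is shown to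
    vanish by matching its two parts. *)
Lemma integral_eq0_pos_neg (W : T -> R) : measurable_fun setT W ->
  P.-integrable setT (EFin \o W) ->
  (\int[P]_w (Num.max (W w) 0)%:E = \int[P]_w (Num.max (- W w) 0)%:E)%E ->
  (\int[P]_w (W w)%:E = 0)%E.
Proof.
move=> mW iW WE; rewrite integralE.
have -> : (\int[P]_x (fun w => (W w)%:E)^\+ x = \int[P]_w (Num.max (W w) 0)%:E)%E.
  by apply: eq_integral => w _; rewrite funeposE EFin_max.
have <- : (\int[P]_w (Num.max (- W w) 0)%:E = \int[P]_x (fun w => (W w)%:E)^\- x)%E.
  by apply: eq_integral => w _; rewrite funenegE EFin_max.
rewrite -WE subee//; have := integrable_pos_fin_num measurableT iW.
by congr (_ \is a fin_num); apply: eq_integral => w _; rewrite funeposE EFin_max.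
Qed.

End CenteredVariables.

Section GaussianVariables.
Context {d : measure_display} {T : measurableType d} {R : realType}.
Variables (P : probability T R) (Z : T -> R).
Hypotheses (mZ : measurable_fun setT Z) (gZ : is_gaussian P Z).

Lemma is_gaussian_law : exists m K, 0 <= K /\
  forall f : R -> \bar R, measurable_fun [set: R] f -> (forall x, 0 <= f x)%E ->
    (\int[P]_w f (Z w) = \int[gaussm m K]_x f x)%E.
Proof.
have [m [s [s0 PZ]]] := gZ; exists m, (s ^+ 2); split; first exact: sqr_ge0.
move=> f mf f0.
have mZ' : measurable_fun setT (Z : T -> measurableTypeR R) by exact: mZ.
rewrite -(ge0_integral_pushm P mZ' mf f0).
apply: eq_measure_integral => A mA _.
rewrite pushmE [LHS](PZ A mA) /gaussm sqrf_eq0; case: ifPn => // _.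
by rewrite sqrtr_sqr ger0_norm.
Qed.

Lemma is_gaussian_moments : exists m K, [/\ 0 <= K,
  P.-integrable setT (EFin \o Z), (\int[P]_w (Z w)%:E = m%:E)%E,
  (\int[P]_w ((Z w - m) ^+ 2)%:E = K%:E)%E &
  forall c, (\int[P]_w (expR (c * Z w))%:E = (expR (c * m + 2^-1 * c ^+ 2 * K))%:E)%E].
Proof.
have [m [K [K0 ZE]]] := is_gaussian_law.
have mZm : measurable_fun setT (fun w => Z w - m) by mfun.
have var : (\int[P]_w ((Z w - m) ^+ 2)%:E = K%:E)%E.
  rewrite (ZE (fun x => ((x - m) ^+ 2)%:E)) ?gaussm_variance//.
    exact: measurable_EFin_sqr.
  by move=> x; rewrite lee_fin sqr_ge0.
have iZm : P.-integrable setT (EFin \o (fun w => Z w - m)).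
  by apply: sqr_integrable_integrable => //; rewrite var ltry.
have im : P.-integrable setT (EFin \o (cst m : T -> R)).
  exact: finite_measure_integrable_cst.
have iZ : P.-integrable setT (EFin \o Z).
  have := integrableD measurableT iZm im.
  by apply: eq_integrable => // w _ /=; rewrite -EFinD subrK.
exists m, K; split => //.
- have Zm0 : (\int[P]_w (Z w - m)%:E = 0)%E.
    apply: integral_eq0_pos_neg => //.
    have mmax (g : R -> R) : measurable_fun [set: R] g ->
        measurable_fun [set: R] (fun x => (Num.max (g x) 0)%:E).
      by move=> mg; apply/measurable_EFinP; apply: measurable_maxr.
    rewrite (ZE (fun x => (Num.max (x - m) 0)%:E)); last 2 first.
      - by apply: mmax; mfun.
      - by move=> x; rewrite lee_fin le_max lexx orbT.
    rewrite (ZE (fun x => (Num.max (- (x - m)) 0)%:E)); last 2 first.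
      - by apply: mmax; mfun.
      - by move=> x; rewrite lee_fin le_max lexx orbT.
    rewrite -gaussm_reflect//; last 2 first.
      - by apply: mmax; mfun.
      - by move=> x; rewrite lee_fin le_max lexx orbT.
    by apply: eq_integral => x _; congr (Num.max _ _)%:E; ring.
  have -> : (\int[P]_w (Z w)%:E = \int[P]_w ((Z w - m)%:E + m%:E))%E.
    by apply: eq_integral => w _; rewrite -EFinD subrK.
  rewrite integralD// Zm0 add0e integral_cst//.
  by rewrite [X in (_ * X)%E]probability_setT mule1.
- move=> c; rewrite (ZE (fun x => (expR (c * x))%:E)) ?integral_gaussm_exp//.
  exact: measurable_EFin_expR.
Qed.

End GaussianVariables.

Lemma sum_delta {R : pzRingType} (N s : nat) (F : nat -> R) : (1 <= s <= N)%N ->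
  \sum_(1 <= i < N.+1) (i == s)%:R * F i = F s.
Proof.
move=> /andP[s1 sN]; rewrite (bigD1_seq s)/= ?mem_index_iota ?s1 ?iota_uniq//.
rewrite eqxx mul1r big1 ?addr0// => i /negbTE ->.
by rewrite mul0r.
Qed.

(** * Quadratic tilts of Gaussian families *)

Section QuadraticForms.
Context {R : realType}.
Implicit Types (a m : nat -> R) (K : nat -> nat -> R) (N s : nat).

Definition linf N a m := \sum_(1 <= i < N.+1) a i * m i.
Definition quadf N a K :=
  \sum_(1 <= i < N.+1) \sum_(1 <= j < N.+1) a i * a j * K i j.

Lemma linf_shift N a m s (c : R) : (1 <= s <= N)%N ->
  linf N (fun i => a i + c * (i == s)%:R) m = linf N a m + c * m s.
Proof.
move=> sN; rewrite /linf -(sum_delta m sN) mulr_sumr -big_split/=.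
by apply: eq_bigr => i _; rewrite mulrDl mulrA.
Qed.

Lemma quadf_shift N a K s (c : R) : (1 <= s <= N)%N -> (forall i j, K i j = K j i) ->
  quadf N (fun i => a i + c * (i == s)%:R) K =
  quadf N a K + 2 * c * linf N a (K ^~ s) + c ^+ 2 * K s s.
Proof.
move=> sN KC; rewrite /quadf.
under eq_bigr => i _.
  rewrite (eq_bigr (fun j => (a i + c * (i == s)%:R) * ((a j + c * (j == s)%:R) * K i j)));
    last by move=> j _; rewrite mulrA.
  rewrite -mulr_sumr -/(linf N (fun j => a j + c * (j == s)%:R) (K i)) linf_shift//.
  over.
rewrite -/(linf N (fun i => a i + c * (i == s)%:R) (fun i => linf N a (K i) + c * K i s)).
rewrite linf_shift// mulrDr -!addrA [RHS]addrA.
have -> : linf N a (fun i => linf N a (K i) + c * K i s) =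
    \sum_(1 <= i < N.+1) \sum_(1 <= j < N.+1) a i * a j * K i j + c * linf N a (K ^~ s).
  rewrite /linf mulr_sumr -big_split/=; apply: eq_bigr => i _.
  rewrite mulrDr mulr_sumr; congr (_ + _); last by rewrite mulrCA.
  by apply: eq_bigr => j _; rewrite mulrA.
have -> : linf N a (K s) = linf N a (K ^~ s) by apply: eq_bigr => i _; rewrite KC.
by ring.
Qed.

End QuadraticForms.

Section GaussianTilt.
Context {d : measure_display} {T : measurableType d} {R : realType}.
Variables (P : probability T R) (X : nat -> T -> R) (N : nat).
Hypothesis mX : forall i, measurable_fun setT (X i).
Implicit Types (W : T -> R) (a m : nat -> R) (K : nat -> nat -> R).

Lemma measurable_linf a : measurable_fun setT (fun w => linf N a (X ^~ w)).
Proof. by apply: measurable_sum => i; apply: measurable_funM. Qed.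

(** W P behaves as C times a Gaussian law for X_1, ..., X_N. Its finiteness, and that of all its
    exponential moments, is part of the identity. *)
Definition joint_mgf W C m K := forall a,
  (\int[P]_w (W w * expR (linf N a (X ^~ w)))%:E =
   (C * expR (linf N a m + 2^-1 * quadf N a K))%:E)%E.

Definition quad_weight (b S x : R) := expR (b * x - 2^-1 * S * x ^+ 2).
(** For invertible K this is the inverse of K^(-1) + S e_s e_s^T, by the Sherman-Morrison formula;
    in this form it also makes sense for singular K. *)
Definition tilt_cov (S : R) s K i j :=
  K i j - K i s * K j s * (S / (1 + S * K s s)).
Definition tilt_mean (b S : R) s m K i :=
  m i + K i s * ((b - S * m s) / (1 + S * K s s)).
(** The integral of [quad_weight b S] against [gaussm m K]. *)
Definition tilt_mass (b S m K : R) :=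
  (Num.sqrt (1 + S * K))^-1 *
    expR ((b * m + 2^-1 * b ^+ 2 * K - 2^-1 * S * m ^+ 2) / (1 + S * K)).

Section Marginal.
Variables (W : T -> R) (C : R) (m : nat -> R) (K : nat -> nat -> R).
Hypotheses (mW : measurable_fun setT W) (W0 : forall w, 0 <= W w)
  (KC : forall i j, K i j = K j i) (WX : joint_mgf W C m K).

(** Replacing a_s by a_s + c in the joint moment generating function gives that of X_s under the
    weight W exp (sum a_i X_i); it is Gaussian in c, with mean shifted by (K a)_s, and uniqueness
    applies. Keeping a arbitrary is what lets the next lemma recover a joint statement from a
    marginal one. *)
Lemma joint_mgf_marginal a s (f : R -> \bar R) : (1 <= s <= N)%N -> 0 <= K s s ->
  measurable_fun [set: R] f -> (forall x, 0 <= f x)%E ->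
  (\int[P]_w ((W w * expR (linf N a (X ^~ w)))%:E * f (X s w)) =
   (C * expR (linf N a m + 2^-1 * quadf N a K))%:E *
     \int[gaussm (m s + linf N a (K ^~ s)) (K s s)]_x f x)%E.
Proof.
move=> sN Ks mf f0.
have mWa : measurable_fun setT (fun w => W w * expR (linf N a (X ^~ w))).
  apply: measurable_funM => //; apply: measurableT_comp => //.
  exact: measurable_linf.
have Wa0 w : 0 <= W w * expR (linf N a (X ^~ w)) by rewrite mulr_ge0// expR_ge0.
have mXs : measurable_fun setT (X s : T -> measurableTypeR R) by exact: mX.
set C' := C * _.
have gm : gaussian_mgf (pushm (mdens P mWa Wa0) mXs) C'
    (m s + linf N a (K ^~ s)) (K s s).
  move=> c; rewrite ge0_integral_pushm//; last exact: measurable_EFin_expR.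
  rewrite ge0_integral_mdens; last 2 first.
    - by apply/measurable_EFinP; apply: measurableT_comp => //; apply: measurable_funM.
    - by move=> w; rewrite lee_fin expR_ge0.
  have := WX (fun i => a i + c * (i == s)%:R).
  rewrite linf_shift// quadf_shift// => WE.
  transitivity (\int[P]_w (W w * expR (linf N (fun i => a i + c * (i == s)%:R) (X ^~ w)))%:E)%E.
    apply: eq_integral => w _; rewrite -EFinM linf_shift// expRD.
    by congr EFin; ring.
  by rewrite WE /C' -[in RHS]mulrA -expRD; congr (_ * expR _)%:E; field.
have C'0 : 0 <= C' by rewrite -lee_fin -(gaussian_mgf_mass gm).
transitivity (\int[mdens P mWa Wa0]_w f (X s w))%E.
  rewrite ge0_integral_mdens//; last exact: measurableT_comp.
  by apply: eq_integral => w _; rewrite muleC.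
rewrite -(ge0_integral_pushm _ mXs)//.
rewrite -[X in (X * _)%E]/((NngNum C'0)%:num%:E) -ge0_integral_mscale//.
apply: eq_measure_integral => A mA _.
by rewrite (gaussian_mgf_unique Ks gm mA).
Qed.

(** The tilt only involves X_s, so the marginal formula applies for each a. The exponent of the
    resulting mass is quadratic in (K a)_s: its linear part updates the mean and its quadratic part
    the covariance. *)
Lemma joint_mgf_tilt s b S : (1 <= s <= N)%N -> 0 <= K s s -> 0 < 1 + S * K s s ->
  joint_mgf (fun w => W w * quad_weight b S (X s w))
    (C * tilt_mass b S (m s) (K s s)) (tilt_mean b S s m K) (tilt_cov S s K).
Proof.
move=> sN Ks D0 a.
transitivity (\int[P]_w ((W w * expR (linf N a (X ^~ w)))%:E *
    (quad_weight b S (X s w))%:E))%E.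
  by apply: eq_integral => w _; rewrite -EFinM; congr EFin; ring.
rewrite (@joint_mgf_marginal a s (fun x => (quad_weight b S x)%:E))//; last 2 first.
  - by apply/measurable_EFinP; rewrite /quad_weight; mfun.
  - by move=> x; rewrite lee_fin expR_ge0.
rewrite integral_gaussm_quad// -EFinM /tilt_mass; congr EFin.
have -> : linf N a (tilt_mean b S s m K) =
    linf N a m + linf N a (K ^~ s) * ((b - S * m s) / (1 + S * K s s)).
  rewrite /linf mulr_suml -big_split/=; apply: eq_bigr => i _.
  by rewrite /tilt_mean mulrDr mulrA.
have -> : quadf N a (tilt_cov S s K) =
    quadf N a K - linf N a (K ^~ s) ^+ 2 * (S / (1 + S * K s s)).
  rewrite expr2 {1}/linf !mulr_suml -sumrB; apply: eq_bigr => i _.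
  rewrite mulr_sumr mulr_suml -sumrB; apply: eq_bigr => j _.
  by rewrite /tilt_cov; ring.
rewrite -!mulrA; congr (_ * _).
rewrite mulrCA; congr (_ * _); rewrite -!expRD; congr expR.
by field; rewrite gt_eqF.
Qed.

(** If the variance were negative, the moment generating function of X_s would tend to 0 both at c
    and at - c as c grows, whereas exp y + exp (- y) >= 2 bounds the sum of the two values below by
    2 C. *)
Lemma joint_mgf_cov_ge0 s : 0 < C -> (1 <= s <= N)%N -> 0 <= K s s.
Proof.
move=> C0 sN; rewrite leNgt; apply/negP => Ks.
have WE c : (\int[P]_w (W w * expR (c * X s w))%:E =
    (C * expR (c * m s + 2^-1 * c ^+ 2 * K s s))%:E)%E.
  have := WX (fun i => 0 + c * (i == s)%:R).
  rewrite linf_shift// quadf_shift//.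
  rewrite (_ : linf N _ m = 0); last by rewrite /linf big1// => i _; rewrite mul0r.
  rewrite (_ : linf N _ (K ^~ s) = 0); last by rewrite /linf big1// => i _; rewrite mul0r.
  rewrite (_ : quadf N _ K = 0); last first.
    by rewrite /quadf big1// => i _; rewrite big1// => j _; rewrite !mul0r.
  rewrite mulr0 !add0r mulrA => <-; apply: eq_integral => w _.
  rewrite linf_shift// (_ : linf N _ (X ^~ w) = 0) ?add0r//.
  by rewrite /linf big1// => i _; rewrite mul0r.
have mWc c : measurable_fun setT (fun w => (W w * expR (c * X s w))%:E).
  apply/measurable_EFinP; apply: measurable_funM => //.
  by apply: measurableT_comp => //; apply: measurable_funM.
have Wc0 c w : (0 <= (W w * expR (c * X s w))%:E)%E.
  by rewrite lee_fin mulr_ge0// expR_ge0.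
have W1 : (\int[P]_w (W w)%:E = C%:E)%E.
  have := WE 0; rewrite expr0n/= mulr0 mul0r addr0 mul0r expR0 mulr1 => <-.
  by apply: eq_integral => w _; rewrite mul0r expR0 mulr1.
have le c : 2 * C <= C * expR (`|c * m s| + 2^-1 * c ^+ 2 * K s s) * 2.
  have : (\int[P]_w ((W w)%:E + (W w)%:E) <=
      \int[P]_w ((W w * expR (c * X s w))%:E + (W w * expR (- c * X s w))%:E))%E.
    apply: ge0_le_integral => //.
    - by move=> w _; rewrite adde_ge0// lee_fin.
    - by apply: emeasurable_funD; exact/measurable_EFinP.
    - exact: emeasurable_funD.
    - move=> w _; rewrite -!EFinD lee_fin -!mulrDr -[leLHS]/(_ + _) -[W w in leLHS]mulr1 -mulrDr.
      rewrite ler_wpM2l// mulNr expRN.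
      have := expR_gt0 (c * X s w); move: (expR _) => e e0.
      rewrite -(ler_pM2r e0) [leRHS]mulrDl mulVf ?gt_eqF//.
      by have := sqr_ge0 (e - 1); lra.
  rewrite ge0_integralD//; [|by move=> w _; rewrite lee_fin|exact/measurable_EFinP
    |by move=> w _; rewrite lee_fin|exact/measurable_EFinP].
  rewrite ge0_integralD// !WE W1 -!EFinD lee_fin sqrrN.
  move=> H; rewrite mulrC [leLHS]mulrDr mulr1; apply: le_trans H _.
  rewrite mulrDr mulr1; have C0' := ltW C0.
  apply: lerD; rewrite ler_wpM2l// ler_expR lerD2r ?ler_norm//.
  by rewrite mulNr -normrN ler_norm.
(* Chosen so that the exponent c |m_s| + c^2 K_ss / 2 equals - c / 2. *)
pose c := (2 * `|m s| + 1) / - K s s.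
have c0 : 0 < c by rewrite divr_gt0 ?oppr_gt0// ltr_wpDl// mulr_ge0.
have cK : c * K s s = - (2 * `|m s| + 1).
  by rewrite /c invrN mulrN mulNr divfK// lt_eqF.
have := le c; rewrite mulrC -mulrA (ler_pM2l C0) ler_pMl//.
rewrite -[leLHS]expR0 ler_expR normrM (gtr0_norm c0) leNgt => /negP; apply.
have -> : c * `|m s| + 2^-1 * c ^+ 2 * K s s = c * (`|m s| + 2^-1 * (c * K s s)) by ring.
by rewrite cK pmulr_rlt0//; lra.
Qed.

End Marginal.

End GaussianTilt.

Section GaussianSequenceMgf.
Context {d : measure_display} {T : measurableType d} {R : realType}.
Variables (P : probability T R) (X : nat -> {RV P >-> R}).
Hypothesis gX : gaussian_sequence P X.

Let mX i : measurable_fun setT (X i : T -> R). Proof. exact: measurable_funPT. Qed.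

Lemma gaussian_sequence_moments i : (1 <= i)%N -> exists K, [/\ P.-integrable setT (EFin \o X i),
  (\int[P]_w (X i w)%:E = (mean P X i)%:E)%E &
  (\int[P]_w ((X i w - mean P X i) ^+ 2)%:E = K%:E)%E].
Proof.
move=> i1; have gXi : is_gaussian P (X i).
  have := gX i (fun j => (j == i)%:R).
  congr (is_gaussian P _); apply/funext => w.
  by rewrite (sum_delta (fun j => X j w))// i1 leqnn.
have [m [K [_ iX XE VE _]]] := is_gaussian_moments (mX i) gXi.
have mE : mean P X i = m by rewrite /mean expectation_def XE.
by exists K; rewrite mE.
Qed.

Let Xc i (w : T) := X i w - mean P X i.

Let mXc i : measurable_fun setT (Xc i). Proof. by apply: measurable_funB. Qed.

Let iXcc i j : (1 <= i)%N -> (1 <= j)%N ->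
  P.-integrable setT (fun w => (Xc i w * Xc j w)%:E).
Proof.
move=> i1 j1; have [Ki [_ _ Vi]] := gaussian_sequence_moments i1; have [Kj [_ _ Vj]] := gaussian_sequence_moments j1.
have i2 k K : (\int[P]_w ((X k w - mean P X k) ^+ 2)%:E = K%:E)%E ->
    P.-integrable setT (fun w => (Xc k w ^+ 2)%:E).
  move=> VE; apply/integrableP; split.
    by apply/measurable_EFinP; apply: measurable_funX.
  by under eq_integral do rewrite gee0_abs ?lee_fin ?sqr_ge0//; rewrite VE ltry.
apply: le_integrable (integrableD measurableT (i2 _ _ Vi) (i2 _ _ Vj)) => //.
  by apply/measurable_EFinP; apply: measurable_funM.
move=> w _; rewrite -EFinD lee_fin [leRHS]ger0_norm ?addr_ge0 ?sqr_ge0//.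
have := sqr_ge0 (Xc i w - Xc j w); have := sqr_ge0 (Xc i w + Xc j w).
by rewrite ler_norml; move: (Xc i w) (Xc j w) => x y; nra.
Qed.

Let covE i j : (1 <= i)%N -> (1 <= j)%N ->
  (\int[P]_w (Xc i w * Xc j w)%:E = (cov P X i j)%:E)%E.
Proof.
move=> i1 j1.
have mE k : fine (\int[P]_w (X k w)%:E)%E = mean P X k.
  by rewrite /mean expectation.unlock.
rewrite /cov covariance.unlock expectation.unlock !mE fineK//.
exact: integrable_fin_num (iXcc i1 j1).
Qed.

(** A linear combination is Gaussian by definition, and its moment generating function at 1 is the
    joint one at a. Its mean and variance are then expanded by linearity. *)
Lemma gaussian_sequence_joint_mgf N :
  joint_mgf P X N (fun=> 1) 1 (mean P X) (cov P X).
Proof.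
move=> a.
have mL : measurable_fun setT (fun w => linf N a (fun i => X i w)).
  exact: measurable_linf.
have [m [K [_ iL LE VE mgfL]]] := is_gaussian_moments mL (gX N a).
have mE : m = linf N a (mean P X).
  apply: EFin_inj; rewrite -LE /linf.
  under eq_integral do rewrite -sumEFin big_add1.
  rewrite integral_sum//.
    rewrite big_add1 -sumEFin; apply: eq_bigr => i _.
    have [Ki [iX XE _]] := gaussian_sequence_moments (ltn0Sn i).
    under eq_integral do rewrite EFinM.
    by rewrite integralZl// XE.
  move=> i; under eq_fun do rewrite EFinM.
  by apply: integrableZl => //; have [? []] := gaussian_sequence_moments (ltn0Sn i).
have KE : K = quadf N a (cov P X).
  apply: EFin_inj; rewrite -VE /quadf mE.
  have E w : ((linf N a (fun i => X i w) - linf N a (mean P X)) ^+ 2)%:E =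
     (\sum_(0 <= i < N) \sum_(0 <= j < N) (a i.+1 * a j.+1 * (Xc i.+1 w * Xc j.+1 w))%:E)%E.
    under eq_bigr do rewrite sumEFin.
    rewrite sumEFin; congr EFin.
    rewrite /linf -sumrB; under eq_bigr do rewrite -mulrBr.
    rewrite expr2 big_distrlr/= big_add1; apply: eq_bigr => i _.
    by rewrite big_add1; apply: eq_bigr => j _; rewrite /Xc; ring.
  under eq_integral do rewrite E.
  have iE i j : P.-integrable setT
      (fun w => (a i.+1 * a j.+1 * (Xc i.+1 w * Xc j.+1 w))%:E).
    by under eq_fun do rewrite EFinM; apply: integrableZl => //; exact: iXcc.
  rewrite integral_sum//; last by move=> i; apply: integrable_sum.
  rewrite big_add1 -sumEFin; apply: eq_bigr => i _.
  rewrite integral_sum// big_add1 -sumEFin; apply: eq_bigr => j _.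
  under eq_integral do rewrite EFinM.
  by rewrite integralZl//; [rewrite covE|exact: iXcc].
have := mgfL 1; rewrite mul1r expr1n mulr1 -mE -KE mul1r => <-.
by apply: eq_integral => w _; rewrite !mul1r.
Qed.

Lemma cov_sym i j : cov P X i j = cov P X j i.
Proof. by rewrite /cov covarianceC. Qed.

End GaussianSequenceMgf.

(** * Independence and the reference measure *)

Section Freezing.
Context {d : measure_display} {T : measurableType d} {R : realType}.
(** Three measures, because the factorisation serves both for the independence of signal and noise
    under P, and for the reference measure, under which the signal keeps its law under P. *)
Variables (F1 F2 : set (set T)) (mu mu1 mu2 : {measure set T -> \bar R}).
Hypotheses (mF1 : F1 `<=` measurable) (mF2 : F2 `<=` measurable).
Hypotheses (mu1T : (mu1 setT < +oo)%E) (mu2T : (mu2 setT < +oo)%E).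
Hypothesis indep : forall A B, <<s F1 >> A -> <<s F2 >> B ->
  (mu (A `&` B) = mu1 A * mu2 B)%E.

Let G1 := g_sigma_algebraType F1.
Let G2 := g_sigma_algebraType F2.

Lemma measurable_id_sub (F : set (set T)) : F `<=` measurable ->
  measurable_fun [set: T] (fun w => w : g_sigma_algebraType F).
Proof.
move=> mF _ A mA; rewrite setTI.
exact: (smallest_sub (@sigma_algebra_measurable _ T) mF).
Qed.

Let mid1 : measurable_fun [set: T] (fun w => w : G1) := measurable_id_sub mF1.
Let mid2 : measurable_fun [set: T] (fun w => w : G2) := measurable_id_sub mF2.
Let mdiag : measurable_fun [set: T] (fun w => (w, w) : G1 * G2).
Proof. exact: measurable_fun_pair. Qed.

Let m1 : {measure set G1 -> \bar R} := pushm mu1 mid1.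
Let m2 : {measure set G2 -> \bar R} := pushm mu2 mid2.
Let fm1 : (m1 setT < +oo)%E. Proof. exact: mu1T. Qed.
Let fm2 : (m2 setT < +oo)%E. Proof. exact: mu2T. Qed.

(* The law of the diagonal embedding into the product of the two
   sub-sigma-algebras is a product measure. *)
Lemma integral_freeze (Phi : T * T -> \bar R) :
  measurable_fun [set: G1 * G2] (Phi : G1 * G2 -> \bar R) ->
  (forall z, 0 <= Phi z)%E ->
  measurable_fun [set: G2] (fun w' : G2 => (\int[mu1]_w Phi (w, w'))%E) /\
  (\int[mu]_w Phi (w, w) = \int[mu2]_w' \int[mu1]_w Phi (w, w'))%E.
Proof.
move=> mPhi Phi0.
have innerE (w' : T) : (\int[finite_mass fm1]_w Phi (w, w') = \int[mu1]_w Phi (w, w'))%E.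
  rewrite (ge0_integral_pushm mu1 mid1 (f := fun w : G1 => Phi (w, w')))//.
  exact: measurableT_comp mPhi (measurable_pair2 _).
have mG : measurable_fun [set: G2] (fun w' : G2 => (\int[mu1]_w Phi (w, w'))%E).
  have := @measurable_fun_fubini_tonelli_G _ _ G1 G2 R (finite_mass fm1) Phi mPhi Phi0.
  by apply: eq_measurable_fun => w' _; rewrite /fubini_G innerE.
split=> //.
rewrite -(ge0_integral_pushm mu mdiag mPhi Phi0).
transitivity (\int[(finite_mass fm1 \x finite_mass fm2)%E]_z Phi z)%E.
  apply: eq_measure_integral => A mA _; apply/esym.
  exact: product_measure_unique.
rewrite (@fubini_tonelli2 _ _ G1 G2 R (finite_mass fm1) (finite_mass fm2) Phi)//.
transitivity (\int[m2]_w' \int[mu1]_w Phi (w, w'))%E.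
  by apply: eq_integral => w' _; exact: innerE.
rewrite (ge0_integral_pushm mu2 mid2 (f := fun w' : G2 => (\int[mu1]_w Phi (w, w'))%E))//.
by move=> w'; apply: integral_ge0.
Qed.

End Freezing.

Section SigmaGen.
Context {d : measure_display} {T : measurableType d} {R : realType}.
Implicit Types (Y : nat -> T -> R) (I : set nat).

Lemma sigma_gen_idem I Y : <<s sigma_gen I Y >> = sigma_gen I Y.
Proof. by rewrite sigma_algebra_id//; exact: smallest_sigma_algebra. Qed.

Lemma sigma_gen_sub I Y (F : set (set T)) : sigma_algebra setT F ->
  (forall u, I u -> preimage_set_system setT (Y u) measurable `<=` F) ->
  sigma_gen I Y `<=` F.
Proof.
by move=> sF YF; apply: smallest_sub => // A [u Iu]; exact: YF.
Qed.

Lemma sigma_gen_measurable I Y : (forall u, I u -> measurable_fun setT (Y u)) ->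
  sigma_gen I Y `<=` measurable.
Proof.
move=> mY; apply: sigma_gen_sub; first exact: sigma_algebra_measurable.
by move=> u Iu _ [B mB <-]; apply: mY.
Qed.

Lemma sub_measurable_gen I Y u : I u -> sub_measurable (sigma_gen I Y) (Y u).
Proof.
move=> Iu _ B mB; rewrite setTI; apply: sub_sigma_algebra.
by apply: sub_sigma_algebra; exists u => //; exists B => //; rewrite setTI.
Qed.

Lemma filtrationS Y s t : (s <= t)%N -> filtration Y s `<=` filtration Y t.
Proof.
move=> st; apply: sigma_gen_sub; first exact: smallest_sigma_algebra.
move=> u /andP[u1 us] A YA; apply: sub_sigma_algebra; exists u => //=.
by rewrite u1 (leq_trans us).
Qed.

Lemma sub_measurableS {d'} {E : measurableType d'} (F G : set (set T)) (f : T -> E) :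
  F `<=` G -> sub_measurable F f -> sub_measurable G f.
Proof.
move=> FG mf _ B mB; have := mf measurableT B mB.
exact: (sub_smallest2r _ FG).
Qed.

Lemma sub_measurable_measurable {d'} {E : measurableType d'} (F : set (set T)) (f : T -> E) :
  F `<=` measurable -> sub_measurable F f -> measurable_fun setT f.
Proof.
move=> mF mf _ B mB; have := mf measurableT B mB.
exact: (smallest_sub (@sigma_algebra_measurable _ T) mF).
Qed.

End SigmaGen.

Lemma prod_indic {T : Type} {R : realType} (s : seq nat) (A : nat -> set T) w :
  \prod_(j <- s) (\1_(A j) w : R) = \1_(\bigcap_(j in [set` s]) A j) w.
Proof.
rewrite [RHS]indicE; case: (boolP (w \in _)) => [/set_mem Aw|nAw].
  by rewrite big_seq big1// => j js; rewrite indicE mem_set//; apply: Aw.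
have [j js nAj] : exists2 j, j \in s & ~ A j w.
  apply: contrapT => H; move/negP: nAw; apply; apply/mem_set => j js.
  by apply: contrapT => nAj; apply: H; exists j.
by apply/eqP; rewrite prodf_seq_eq0; apply/hasP; exists j => //=; rewrite indicE memNset.
Qed.

Section ShiftedNormal.
Context {R : realType}.

Lemma gaussm01E (B : set (measurableTypeR R)) : gaussm 0 1 B = normal_prob 0 1 B.
Proof. by rewrite /gaussm oner_eq0 sqrtr1. Qed.

Lemma measurable_indic_comp {d} {T : measurableType d} (f : T -> R) (B : set R) :
  measurable_fun setT f -> measurable B -> measurable_fun setT (fun w => \1_B (f w) : R).
Proof.
move=> mf mB; have mI : measurable_fun [set: R] (\1_B : R -> R) by exact: measurable_indic.
exact: measurableT_comp mI mf.
Qed.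

(** The tilted law pushed by x -> a + x has moment generating function exp (c a - a^2 / 2 + (c -
    a)^2 / 2) = exp (c^2 / 2), that of the standard normal law. *)
Lemma gaussm_cameron_martin (a : R) (B : set R) : measurable B ->
  (\int[gaussm 0 1]_x (expR (- (a * x) - 2^-1 * a ^+ 2) * \1_B (a + x))%:E = gaussm 0 1 B)%E.
Proof.
move=> mB; pose f (x : R) := expR (- (a * x) - 2^-1 * a ^+ 2).
have mf : measurable_fun [set: measurableTypeR R] f.
  have : measurable_fun [set: R] f by rewrite /f; mfun.
  by [].
have f0 x : 0 <= f x by exact: expR_ge0.
have ms : measurable_fun [set: measurableTypeR R] (fun x : measurableTypeR R => a + x : measurableTypeR R).
  have : measurable_fun [set: R] (fun x : R => a + x) by mfun.
  by [].
have mBs : measurable_fun [set: R] (fun x : R => (\1_B x : R)%:E).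
  by apply/measurable_EFinP; exact: measurable_indic.
have gm : gaussian_mgf (pushm (mdens (gaussm 0 1) mf f0) ms) 1 0 1.
  move=> c; rewrite ge0_integral_pushm//; last exact: measurable_EFin_expR.
  rewrite ge0_integral_mdens//; last first.
    by apply/measurable_EFinP; mfun.
  have E x : expR (c * (a + x)) * f x =
     expR (c * a - 2^-1 * a ^+ 2) * expR ((c - a) * x).
    by rewrite -!expRD; congr expR; ring.
  under eq_integral do rewrite -EFinM E EFinM.
  rewrite ge0_integralZl//; last exact: measurable_EFin_expR.
  rewrite integral_gaussm_exp// -EFinM -expRD mul1r; congr (expR _)%:E.
  by field.
rewrite -[RHS]mul1e -(gaussian_mgf_unique ler01 gm mB).
have <- : (\int[pushm (mdens (gaussm 0 1) mf f0) ms]_x (\1_B x : R)%:E =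
    pushm (mdens (gaussm 0 1) mf f0) ms B)%E.
  by rewrite integral_indic// setIT.
rewrite ge0_integral_pushm//.
rewrite ge0_integral_mdens//.
  by apply: eq_integral => x _; rewrite -EFinM mulrC.
by apply/measurable_EFinP; apply: measurable_indic_comp.
Qed.

End ShiftedNormal.

Section IidProduct.
Context {d : measure_display} {T : measurableType d} {R : realType}.
Variables (P : probability T R) (eps : nat -> {RV P >-> R}).
Hypothesis iid : iid_std_normal P eps.

Let meps i : measurable_fun setT (eps i : T -> R). Proof. exact: measurable_funPT. Qed.

(** Independence is only given for events. The induction turns indicators into functions one index
    at a time: J carries the functions, J2 the indices still tested by sets. *)
Lemma iid_integral_prod (f : nat -> R -> R) (c : nat -> R) (J J2 : seq nat) (B : nat -> set R) :
  uniq (J ++ J2) -> (forall j, j \in J ++ J2 -> (1 <= j)%N) ->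
  (forall j, measurable_fun [set: R] (f j)) -> (forall j x, 0 <= f j x) ->
  (forall j, \int[gaussm 0 1]_x (f j x)%:E = (c j)%:E)%E ->
  (forall j, measurable (B j)) ->
  (\int[P]_w (\prod_(j <- J) f j (eps j w) * \prod_(j <- J2) \1_(B j) (eps j w))%:E =
   (\prod_(j <- J) c j * \prod_(j <- J2) fine (gaussm 0 1 (B j)))%:E)%E.
Proof.
move=> uJ J1 mf f0 fc.
elim: J => [|j J IH] in J2 B uJ J1 *; move=> mB.
  rewrite big_nil mul1r.
  under eq_integral do rewrite big_nil mul1r (prod_indic J2 (fun j => eps j @^-1` B j)).
  have mcap : measurable (\bigcap_(j in [set` J2]) (eps j @^-1` B j)).
    apply: fin_bigcap_measurable; first exact: finite_seq.
    by move=> j _; rewrite -[X in measurable X]setTI; exact: meps.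
  rewrite integral_indic// setIT [LHS](iid.2 J2 B uJ J1 mB).
  rewrite (big_morph (@EFin R) (@EFinM R) erefl) !big_seq; apply: eq_bigr => j jJ.
  rewrite [LHS](iid.1 j (B j) (J1 _ jJ) (mB j)) -gaussm01E fineK//.
  by rewrite fin_num_measure//; exact: mB.
pose W w := \prod_(i <- J) f i (eps i w) * \prod_(i <- J2) \1_(B i) (eps i w).
have mW : measurable_fun setT W.
  apply: measurable_funM; apply: measurable_prod => i _.
    exact: measurableT_comp.
  exact: measurable_indic_comp.
have W0 w : 0 <= W w.
  by rewrite mulr_ge0//; apply: prodr_ge0 => i _; rewrite ?f0// indicE.
have mj : measurable_fun setT (eps j : T -> measurableTypeR R) by exact: meps.
pose C := \prod_(i <- J) c i * \prod_(i <- J2) fine (gaussm 0 1 (B i)).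
have C0 : 0 <= C.
  rewrite mulr_ge0//; apply: prodr_ge0 => i _; last by rewrite fine_ge0.
  by rewrite -lee_fin -fc integral_ge0// => x _; rewrite lee_fin.
(* The induction hypothesis with j moved to the indicator side: under the weight W, the law of
   [eps j] is C times the standard normal law, so any nonnegative [f j] can be integrated against
   it. *)
have nuE (B0 : set R) : measurable B0 -> pushm (mdens P mW W0) mj B0 = (C%:E * gaussm 0 1 B0)%E.
  move=> mB0.
  pose B' (i : nat) : set R := if i == j then B0 else B i.
  have mB' i : measurable (B' i) by rewrite /B'; case: (i == j); [exact: mB0|exact: mB].
  have B'j : B' j = B0 by rewrite /B' eqxx.
  have BB' (S : Type) (idx : S) (op : S -> S -> S) (F : nat -> set R -> S) :
      \big[op/idx]_(i <- J2) F i (B' i) = \big[op/idx]_(i <- J2) F i (B i).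
    apply: eq_big_seq => i iJ2; rewrite /B'; case: eqP => // ij.
    move: uJ; rewrite /= mem_cat negb_or => /andP[/andP[_]].
    by rewrite -ij iJ2.
  have pJ : perm_eq (J ++ j :: J2) (j :: J ++ J2) by rewrite -cat1s perm_catCA.
  have uJ' : uniq (J ++ (j :: J2)) by rewrite (perm_uniq pJ).
  have J1' i : i \in J ++ (j :: J2) -> (1 <= i)%N.
    by rewrite (perm_mem pJ); exact: J1.
  have := IH (j :: J2) B' uJ' J1' mB'.
  rewrite big_cons (BB' _ _ _ (fun i B => fine (gaussm 0 1 B))) B'j.
  rewrite mulrCA EFinM fineK ?fin_num_measure// muleC => <-.
  rewrite pushmE mdensE integral_mkcond; apply: eq_integral => w _.
  rewrite big_cons B'j (BB' _ _ _ (fun i B => \1_B (eps i w))) patchE mulrCA.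
  rewrite indicE -/(W w) -[eps j w \in B0]/(w \in eps j @^-1` B0).
  by case: (w \in _); rewrite ?mul1r ?mul0r.
have mfE : measurable_fun [set: R] (fun x => (f j x)%:E) by exact/measurable_EFinP.
have meE : measurable_fun setT (fun w => (f j (eps j w))%:E).
  by apply/measurable_EFinP; exact: measurableT_comp (mf j) (meps j).
transitivity (\int[pushm (mdens P mW W0) mj]_x (f j x)%:E)%E.
  rewrite ge0_integral_pushm; [|exact: mfE|by move=> x; rewrite lee_fin].
  rewrite ge0_integral_mdens; [|exact: meE|by move=> x; rewrite lee_fin].
  by apply: eq_integral => w _; rewrite big_cons -mulrA EFinM.
transitivity (\int[mscale (NngNum C0) (gaussm 0 1)]_x (f j x)%:E)%E.
  by apply: eq_measure_integral => A mA _; exact: nuE.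
rewrite ge0_integral_mscale; [|by []|exact: mfE|by move=> x _; rewrite lee_fin].
by rewrite fc -EFinM big_cons mulrC mulrA.
Qed.

End IidProduct.

Section ReferenceMeasure.
Context {d : measure_display} {T : measurableType d} {R : realType}.
Variables (P : probability T R) (X eps : nat -> {RV P >-> R}) (A : nat -> R).
Hypotheses (iid : iid_std_normal P eps) (indep : independent_sequences P X eps).

Let Y : nat -> T -> R := observation A X eps.
Let FX := sigma_gen [set u | (1 <= u)%N] X.
Let Fe := sigma_gen [set u | (1 <= u)%N] eps.

Let mX i : measurable_fun setT (X i : T -> R). Proof. exact: measurable_funPT. Qed.
Let meps i : measurable_fun setT (eps i : T -> R). Proof. exact: measurable_funPT. Qed.

Lemma measurable_observation t : measurable_fun setT (Y t).
Proof. by apply: measurable_funD => //; apply: measurable_funM. Qed.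

Lemma sigma_signal_measurable : FX `<=` measurable.
Proof. by apply: sigma_gen_measurable => u _. Qed.

Lemma filtration_measurable t : filtration Y t `<=` measurable.
Proof. by apply: sigma_gen_measurable => u _; exact: measurable_observation. Qed.

Let mFe : Fe `<=` measurable.
Proof. by apply: sigma_gen_measurable => u _. Qed.

Definition girsanov n (w : T) :=
  \prod_(s <- index_iota 1 n.+1)
    expR (- (A s * X s w * eps s w) - 2^-1 * (A s * X s w) ^+ 2).

Lemma girsanov_gt0 n w : 0 < girsanov n w.
Proof. by apply: prodr_gt0 => s _; exact: expR_gt0. Qed.

Lemma girsanov_ge0 n w : 0 <= girsanov n w.
Proof. exact/ltW/girsanov_gt0. Qed.

Lemma measurable_girsanov n : measurable_fun setT (girsanov n).
Proof.
apply: measurable_prod => s _; apply: measurableT_comp => //.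
apply: measurable_funB; last first.
  by apply: measurable_funM => //; apply: measurable_funX; apply: measurable_funM.
by apply: measurable_funN; apply: measurable_funM => //; apply: measurable_funM.
Qed.

Definition refm n : {measure set T -> \bar R} :=
  mdens P (measurable_girsanov n) (girsanov_ge0 n).

(** Once the signal is frozen, each factor is a Cameron-Martin integral in [eps s], whose value does
    not depend on the signal. So Y_1, ..., Y_n become standard normal whatever X is. *)
Lemma refm_rectangle n (F : set T) (B : nat -> set R) : FX F ->
  (forall s, measurable (B s)) ->
  (\int[P]_w (girsanov n w * \1_F w * \prod_(s <- index_iota 1 n.+1) \1_(B s) (Y s w))%:E
   = P F * (\prod_(s <- index_iota 1 n.+1) fine (gaussm 0 1 (B s)))%:E)%E.
Proof.
move=> FF mB.
pose f (x : T) s (e : R) := expR (- (A s * X s x * e) - 2^-1 * (A s * X s x) ^+ 2) *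
  \1_(B s) (A s * X s x + e).
pose Phi (z : T * T) : \bar R := (\1_F z.2 * \prod_(s <- index_iota 1 n.+1) f z.2 s (eps s z.1))%:E.
have mFXg : sub_measurable FX (\1_F : T -> R).
  by apply: measurable_indic; exact: sub_sigma_algebra.
have mPhi : measurable_fun [set: g_sigma_algebraType Fe * g_sigma_algebraType FX]
    (Phi : g_sigma_algebraType Fe * g_sigma_algebraType FX -> \bar R).
  apply/measurable_EFinP; apply: measurable_funM.
    exact: measurableT_comp mFXg measurable_snd.
  apply: measurable_prod => s; rewrite mem_index_iota => /andP[s1 _].
  have mXs : measurable_fun [set: g_sigma_algebraType Fe * g_sigma_algebraType FX]
      (fun z : g_sigma_algebraType Fe * g_sigma_algebraType FX => X s z.2).
    apply: measurableT_comp measurable_snd.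
    exact: (@sub_measurable_gen _ _ _ [set u | (1 <= u)%N] X).
  have mes : measurable_fun [set: g_sigma_algebraType Fe * g_sigma_algebraType FX]
      (fun z : g_sigma_algebraType Fe * g_sigma_algebraType FX => eps s z.1).
    apply: measurableT_comp measurable_fst.
    exact: (@sub_measurable_gen _ _ _ [set u | (1 <= u)%N] eps).
  apply: measurable_funM; first by mfun.
  by apply: measurable_indic_comp => //; mfun.
have Phi0 z : (0 <= Phi z)%E.
  rewrite lee_fin mulr_ge0//.
  by apply: prodr_ge0 => s _; rewrite mulr_ge0 ?expR_ge0// indicE.
have PT : (P setT < +oo)%E by rewrite probability_setT ltry.
have ind' B1 B2 : <<s Fe >> B1 -> <<s FX >> B2 -> (P (B1 `&` B2) = P B1 * P B2)%E.
  rewrite /Fe /FX !sigma_gen_idem => FB1 FB2.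
  by rewrite setIC indep// muleC.
transitivity (\int[P]_w Phi (w, w))%E.
  apply: eq_integral => w _; rewrite /Phi/= -mulrA mulrCA; congr (_ * _)%:E.
  by rewrite /girsanov -big_split/=.
have [_ ->] := integral_freeze mFe sigma_signal_measurable PT PT ind' mPhi Phi0.
have innerE x : (\int[P]_w Phi (w, x) =
    (\1_F x)%:E * (\prod_(s <- index_iota 1 n.+1) fine (gaussm 0 1 (B s)))%:E)%E.
  have mB1 : forall j : nat, measurable (setT : set R) by [].
  have mf s : measurable_fun [set: R] (f x s).
    apply: measurable_funM; first by mfun.
    by apply: measurable_indic_comp => //; mfun.
  have f0 s e : 0 <= f x s e by rewrite mulr_ge0 ?expR_ge0// indicE.
  have fE s : (\int[gaussm 0 1]_e (f x s e)%:E = (fine (gaussm 0 1 (B s)))%:E)%E.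
    rewrite (gaussm_cameron_martin (A s * X s x) (mB s)) fineK//.
    by rewrite fin_num_measure//; exact: mB.
  have := @iid_integral_prod _ _ _ P eps iid (f x) (fun s => fine (gaussm 0 1 (B s)))
    (index_iota 1 n.+1) [::] (fun=> setT) _ _ mf f0 fE mB1.
  rewrite cats0 iota_uniq big_nil mulr1 => <-//; last first.
    by move=> j; rewrite mem_index_iota => /andP[].
  rewrite -ge0_integralZl//.
  - by apply: eq_integral => w _; rewrite big_nil mulr1 -EFinM.
  - apply/measurable_EFinP; apply: measurable_funM; last first.
      by under eq_fun do rewrite big_nil; exact: measurable_cst.
    by apply: measurable_prod => s _; exact: measurableT_comp (mf s) (meps s).
  - move=> w _; rewrite big_nil mulr1 lee_fin; exact: prodr_ge0.
under eq_integral do rewrite innerE.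
have mF : measurable F by exact: sigma_signal_measurable.
rewrite ge0_integralZr//.
- by rewrite integral_indic// setIT.
- by apply/measurable_EFinP; exact: measurable_indic.
- by rewrite lee_fin; apply: prodr_ge0 => s _; rewrite fine_ge0.
Qed.

Lemma refmT n : refm n setT = 1%E.
Proof.
have FXT : FX setT by rewrite /FX -sigma_gen_idem; exact: (@measurableT _ (g_sigma_algebraType FX)).
have := refm_rectangle n FXT (fun=> @measurableT _ R).
rewrite probability_setT mul1e big1; last first.
  by move=> s _; rewrite [X in fine X]probability_setT.
rewrite /refm mdensE => <-.
apply: eq_integral => w _; rewrite indicT mulr1 big1 ?mulr1// => s _.
by rewrite indicT.
Qed.

(** For fixed F both sides are finite measures in G. They agree on the cylinder events of Y_1, ...,
    Y_n by [refm_rectangle], and these form a pi-system generating the filtration. *)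
Lemma refm_indep n (F G : set T) : FX F -> filtration Y n G ->
  refm n (F `&` G) = (P F * refm n G)%E.
Proof.
move=> FF.
have mF : measurable F by exact: sigma_signal_measurable.
have FXT : FX setT by rewrite /FX -sigma_gen_idem; exact: (@measurableT _ (g_sigma_algebraType FX)).
have mL : measurable_fun setT (fun w => girsanov n w * \1_F w).
  by apply: measurable_funM; [exact: measurable_girsanov|exact: measurable_indic].
have L0 w : 0 <= girsanov n w * \1_F w by rewrite mulr_ge0 ?girsanov_ge0// indicE.
have PF0 : 0 <= fine (P F) by rewrite fine_ge0.
pose C : set (set T) := [set G | exists2 B : nat -> set R, (forall s, measurable (B s)) &
  G = [set w | forall s, (1 <= s <= n)%N -> B s (Y s w)]].
have indC (B : nat -> set R) w :
    \prod_(s <- index_iota 1 n.+1) (\1_(B s) (Y s w) : R) =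
    \1_[set w | forall s, (1 <= s <= n)%N -> B s (Y s w)] w.
  rewrite (prod_indic _ (fun s => Y s @^-1` B s)); congr (\1_ _ w).
  apply/seteqP; split=> x H s /=.
    by move=> sn; apply: H; rewrite /= mem_index_iota ltnS.
  by rewrite /= mem_index_iota ltnS => /H.
have mC : C `<=` measurable.
  move=> _ [B mB ->].
  rewrite (_ : [set w | _] = \bigcap_(s in [set` index_iota 1 n.+1]) (Y s @^-1` B s)).
    apply: fin_bigcap_measurable; first exact: finite_seq.
    move=> s _; rewrite -[X in measurable X]setTI.
    exact: (measurable_observation s).
  apply/seteqP; split=> x H s /=.
    by rewrite mem_index_iota ltnS => /H.
  by move=> sn; apply: H; rewrite /= mem_index_iota ltnS.
have CT : C setT.
  by exists (fun=> setT) => //; apply/seteqP; split.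
have CE G' : C G' -> mdens P mL L0 G' = mscale (NngNum PF0) (refm n) G'.
  move=> CG'; have mG' := mC _ CG'; case: CG' => B mB G'E.
  rewrite -[RHS]/((fine (P F))%:E * refm n G')%E /refm !mdensE.
  have E F' (h : T -> R) : (\int[P]_(w in G') (h w * F' w)%:E =
      \int[P]_w (h w * F' w * \prod_(s <- index_iota 1 n.+1) (\1_(B s) (Y s w)))%:E)%E.
    rewrite integral_mkcond; apply: eq_integral => w _.
    by rewrite indC patchE indicE -G'E; case: (w \in _); rewrite ?mulr1 ?mulr0.
  have -> : (\int[P]_(x in G') (girsanov n x)%:E =
     \int[P]_(x in G') (girsanov n x * \1_setT x)%:E)%E.
    by apply: eq_integral => w _; rewrite indicT mulr1.
  rewrite !E !refm_rectangle// probability_setT mul1e fineK//.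
  exact: fin_num_measure.
move=> FG.
have GC : <<s C >> G.
  move: FG; apply: sigma_gen_sub; first exact: smallest_sigma_algebra.
  move=> u /= un _ [B mB <-]; apply: sub_sigma_algebra; rewrite setTI.
  exists (fun s => if s == u then B else setT).
    by move=> s; case: (s == u).
  apply/seteqP; split=> [w Bw s sn|w /(_ u un)]; last by rewrite eqxx.
  by case: eqP => // ->.
have fin : (mdens P mL L0 setT < +oo)%E.
  by rewrite CE// -[ltLHS]/((fine (P F))%:E * refm n setT)%E refmT mule1 ltry.
have covT : \bigcup_(k in [set: nat]) [set: T] = setT.
  by apply/seteqP; split => // w _; exists 0%N.
have CI : setI_closed C.
  move=> _ _ [B mB ->] [B' mB' ->].
  exists (fun s => B s `&` B' s); first by move=> s; exact: measurableI.
  apply/seteqP; split=> [w [H1 H2] s sn|w H]; first by split; [exact: H1|exact: H2].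
  by split=> s /H [].
have uniq := @g_sigma_algebra_measure_unique _ _ _ C mC (fun=> setT) (fun=> CT) covT
  (mdens P mL L0) (mscale (NngNum PF0) (refm n)) CI CE (fun=> fin) G GC.
transitivity (mdens P mL L0 G); last first.
  rewrite uniq -[LHS]/((fine (P F))%:E * refm n G)%E fineK//.
  exact: fin_num_measure.
rewrite /refm !mdensE setIC integral_mkcondr; apply: eq_integral => w _.
by rewrite patchE indicE; case: (w \in _); rewrite ?mulr1 ?mulr0.
Qed.

End ReferenceMeasure.

Lemma measurable_quad_weight {R : realType} (b S : R) :
  measurable_fun [set: R] (quad_weight b S).
Proof.
have : measurable_fun [set: R] (fun x : R => expR (b * x - 2^-1 * S * x ^+ 2)) by mfun.
by [].
Qed.

(** * Filtering formula *)

Section TiltRecursion.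
Context {R : realType}.
Variables (S : nat -> R) (K0 : nat -> nat -> R).
Implicit Types (b m : nat -> R).

(** Contains the tilts at times 1 to n. Hence [cov_after s.-1] is the state just before the tilt at
    time s, the one that enters its denominator and its mass. *)
Fixpoint cov_after n : nat -> nat -> R :=
  if n is n'.+1 then tilt_cov (S n) n (cov_after n') else K0.

Fixpoint mean_after b m n : nat -> R :=
  if n is n'.+1 then tilt_mean (b n) (S n) n (mean_after b m n') (cov_after n') else m.

Definition step_mass b m s :=
  tilt_mass (b s) (S s) (mean_after b m s.-1 s) (cov_after s.-1 s s).

Definition step_den s := 1 + S s * cov_after s.-1 s s.

Lemma cov_after_sym n : (forall i j, K0 i j = K0 j i) ->
  forall i j, cov_after n i j = cov_after n j i.
Proof. by move=> K0C; elim: n => //= n IH i j; rewrite /tilt_cov IH [X in _ - X * _]mulrC. Qed.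

Lemma cov_afterE n i j :
  cov_after n i j = K0 i j - \sum_(1 <= l < n.+1)
    cov_after l.-1 i l * cov_after l.-1 j l * (S l / (1 + S l * cov_after l.-1 l l)).
Proof.
elim: n => [|n IH]; first by rewrite big_geq// subr0.
by rewrite big_nat_recr//= opprD addrA -IH.
Qed.

Lemma mean_afterE b m n i :
  mean_after b m n i = m i + \sum_(1 <= l < n.+1)
    cov_after l.-1 i l * ((b l - S l * mean_after b m l.-1 l) / (1 + S l * cov_after l.-1 l l)).
Proof.
elim: n => [|n IH]; first by rewrite big_geq// addr0.
by rewrite big_nat_recr//= addrA -IH.
Qed.

Lemma step_mass_gt0 b m s : 0 < step_den s -> 0 < step_mass b m s.
Proof. by move=> D0; rewrite mulr_gt0 ?expR_gt0// invr_gt0 sqrtr_gt0. Qed.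

End TiltRecursion.

Section TiltedSignal.
Context {d : measure_display} {T : measurableType d} {R : realType}.
Variables (P : probability T R) (X : nat -> {RV P >-> R}) (N : nat).
Hypothesis gX : gaussian_sequence P X.
Variable S : nat -> R.

Let m0 := mean P X.
Let K0 := cov P X.
Let mX i : measurable_fun setT (X i : T -> R). Proof. exact: measurable_funPT. Qed.

Lemma measurable_quad_weights b n :
  measurable_fun setT (fun w => \prod_(1 <= s < n.+1) quad_weight (b s) (S s) (X s w)).
Proof.
apply: measurable_prod => s _; apply: measurableT_comp => //.
exact: measurable_quad_weight.
Qed.

Lemma quad_weights_ge0 b n w :
  0 <= \prod_(1 <= s < n.+1) quad_weight (b s) (S s) (X s w).
Proof. by apply: prodr_ge0 => s _; exact: expR_ge0. Qed.

(** At each step the moment generating function already obtained yields the nonnegative variance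
    that the next tilt requires. *)
Lemma tilted_joint_mgf b n : (n <= N)%N ->
  (forall s, (1 <= s <= n)%N -> 0 < step_den S K0 s) ->
  joint_mgf P X N (fun w => \prod_(1 <= s < n.+1) quad_weight (b s) (S s) (X s w))
    (\prod_(1 <= s < n.+1) step_mass S K0 b m0 s)
    (mean_after S K0 b m0 n) (cov_after S K0 n).
Proof.
move=> nN; elim: n nN => [|n IH] nN D0.
  rewrite big_geq//; under [X in joint_mgf _ _ _ X]eq_fun do rewrite big_geq//.
  exact: gaussian_sequence_joint_mgf.
have D0' s : (1 <= s <= n)%N -> 0 < step_den S K0 s.
  by move=> /andP[s1 sn]; apply: D0; rewrite s1 leqW.
have {}IH := IH (ltnW nN) D0'.
have C0 : 0 < \prod_(1 <= s < n.+1) step_mass S K0 b m0 s.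
  rewrite big_seq; apply: prodr_gt0 => s; rewrite mem_index_iota ltnS => sn.
  by apply: step_mass_gt0; exact: D0'.
have KC := cov_after_sym S n (cov_sym X).
have nN' : (1 <= n.+1 <= N)%N by [].
have Ks := joint_mgf_cov_ge0 mX (measurable_quad_weights b n) (quad_weights_ge0 b n)
  KC IH C0 nN'.
have D1 : 0 < 1 + S n.+1 * cov_after S K0 n n.+1 n.+1 by apply: (D0 n.+1); rewrite ltnSn.
have J := joint_mgf_tilt mX (measurable_quad_weights b n) (quad_weights_ge0 b n)
  KC IH (b n.+1) nN' Ks D1.
rewrite big_nat_recr//= => a; rewrite -(J a).
by apply: eq_integral => w _; rewrite big_nat_recr.
Qed.

Lemma cov_after_ge0 n t : (n <= N)%N -> (1 <= t <= N)%N ->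
  (forall s, (1 <= s <= n)%N -> 0 < step_den S K0 s) -> 0 <= cov_after S K0 n t t.
Proof.
move=> nN tN D0.
(* The covariance does not depend on b, so b = 0 serves. *)
have J := tilted_joint_mgf (fun=> 0) nN D0.
apply: (joint_mgf_cov_ge0 mX (measurable_quad_weights _ n) (quad_weights_ge0 _ n) _ J) => //.
  exact/cov_after_sym/cov_sym.
rewrite big_seq; apply: prodr_gt0 => s; rewrite mem_index_iota ltnS => sn.
by apply: step_mass_gt0; exact: D0.
Qed.

Lemma tilted_signal_law b n t (f : R -> \bar R) : (n <= N)%N -> (1 <= t <= N)%N ->
  (forall s, (1 <= s <= n)%N -> 0 < step_den S K0 s) ->
  measurable_fun [set: R] f -> (forall x, 0 <= f x)%E ->
  (\int[P]_w ((\prod_(1 <= s < n.+1) quad_weight (b s) (S s) (X s w))%:E * f (X t w)) =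
   (\prod_(1 <= s < n.+1) step_mass S K0 b m0 s)%:E *
     \int[gaussm (mean_after S K0 b m0 n t) (cov_after S K0 n t t)]_x f x)%E.
Proof.
move=> nN tN D0 mf f0.
have J := tilted_joint_mgf b nN D0.
have lin0 (m : nat -> R) : linf N (fun=> 0) m = 0.
  by rewrite /linf big1// => i _; rewrite mul0r.
have quad0 (K : nat -> nat -> R) : quadf N (fun=> 0) K = 0.
  by rewrite /quadf big1// => i _; rewrite big1// => j _; rewrite !mul0r.
have := joint_mgf_marginal mX (measurable_quad_weights b n) (quad_weights_ge0 b n)
  (cov_after_sym S n (cov_sym X)) J (fun=> 0) tN (cov_after_ge0 nN tN D0) mf f0.
rewrite !lin0 quad0 mulr0 !addr0 expR0 mulr1 => <-.
by apply: eq_integral => w _; rewrite lin0 expR0 mulr1.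
Qed.

End TiltedSignal.

Lemma measurable_inv_pos {d} {T : measurableType d} {R : realType} (f : T -> R) :
  measurable_fun setT f -> (forall x, 0 < f x) -> measurable_fun setT (fun x => (f x)^-1).
Proof.
move=> mf f0; apply: (eq_measurable_fun (fun x => expR (- ln (f x)))).
  by move=> x _; rewrite expRN lnK// posrE.
apply: measurableT_comp => //; apply: measurable_funN.
exact: measurableT_comp (@measurable_ln R) mf.
Qed.

Section FilterFormula.
Context {d : measure_display} {T : measurableType d} {R : realType}.
Variables (P : probability T R) (X eps : nat -> {RV P >-> R}) (A : nat -> R) (N : nat).
Hypotheses (gX : gaussian_sequence P X) (iid : iid_std_normal P eps)
  (indep : independent_sequences P X eps).

Let Y : nat -> T -> R := observation A X eps.
Let m0 := mean P X.
Let K0 := cov P X.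
Let FX := sigma_gen [set u | (1 <= u)%N] X.
Let mX i : measurable_fun setT (X i : T -> R). Proof. exact: measurable_funPT. Qed.

Section Defs.
Variables (q : nat -> R) (h : nat -> T -> R).

Definition tilt_S s := A s ^+ 2 - q s.
Definition tilt_b w s := A s * Y s w - q s * h s w.
Definition qmean n w t := mean_after tilt_S K0 (tilt_b w) m0 n t.
Definition qcov n t := cov_after tilt_S K0 n t t.
(** The first factor is the term q h^2 / 2 of the expanded square, which is constant once h is
    frozen. *)
Definition qstep s w :=
  expR (2^-1 * q s * h s w ^+ 2) * step_mass tilt_S K0 (tilt_b w) m0 s.
Definition qmass n w := \prod_(1 <= s < n.+1) qstep s w.
Definition qweight n w := \prod_(1 <= s < n.+1) expR (2^-1 * q s * (X s w - h s w) ^+ 2).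

End Defs.

Section Formula.
Variables (q : nat -> R) (h : nat -> T -> R) (n t : nat).
Hypotheses (nN : (n <= N)%N) (tN : (1 <= t <= N)%N).
Hypothesis D0 : forall s, (1 <= s <= n)%N -> 0 < step_den (tilt_S q) K0 s.

Let G := g_sigma_algebraType (filtration Y n).
Hypothesis hn : forall s, (1 <= s <= n)%N -> measurable_fun [set: G] (h s : G -> R).

Let mY s : (1 <= s <= n)%N -> measurable_fun [set: G] (Y s : G -> R).
Proof. by move=> sn; exact: sub_measurable_gen. Qed.

Let mtilt_b s : (1 <= s <= n)%N -> measurable_fun [set: G] (fun w : G => tilt_b q h w s).
Proof.
move=> sn; apply: measurable_funB; apply: measurable_funM => //.
  exact: mY.
exact: hn.
Qed.

Lemma measurable_qmean k i : (k <= n)%N -> measurable_fun [set: G] (fun w : G => qmean q h k w i).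
Proof.
elim: k i => [|k IH] i kn; first exact: measurable_cst.
have kn' : (1 <= k.+1 <= n)%N by [].
have IHi := IH i (ltnW kn); have IHk := IH k.+1 (ltnW kn).
have mb := mtilt_b kn'.
rewrite /qmean /= /tilt_mean; apply: measurable_funD => //.
apply: measurable_funM => //; apply: measurable_funM => //.
by apply: measurable_funB => //; apply: measurable_funM.
Qed.

Lemma measurable_qmass : measurable_fun [set: G] (fun w : G => qmass q h n w).
Proof.
apply: measurable_prod => s; rewrite mem_index_iota ltnS => sn.
have mb := mtilt_b sn; have mh := hn sn.
have mm : measurable_fun [set: G] (fun w : G => qmean q h s.-1 w s).
  by apply: measurable_qmean; case/andP: sn => s1 /(leq_trans _); apply; exact: leq_pred.
apply: measurable_funM.
  by apply: measurableT_comp => //; apply: measurable_funM => //; apply: measurable_funX.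
apply: measurable_funM => //; apply: measurableT_comp => //.
apply: measurable_funM => //; rewrite -/(qmean q h s.-1 _ s).
apply: measurable_funB.
  apply: measurable_funD; first by apply: measurable_funM.
  by apply: measurable_funM => //; apply: measurable_funM => //; apply: measurable_funX.
by apply: measurable_funM => //; apply: measurable_funX.
Qed.

Lemma qmass_gt0 w : 0 < qmass q h n w.
Proof.
rewrite /qmass big_seq; apply: prodr_gt0 => s; rewrite mem_index_iota ltnS => sn.
by rewrite mulr_gt0 ?expR_gt0//; apply: step_mass_gt0; exact: D0.
Qed.

Variable Phi : T * R -> \bar R.
Hypotheses (mPhi : measurable_fun [set: G * R] (Phi : G * R -> \bar R))
  (Phi0 : forall z, (0 <= Phi z)%E).

Let inner w' := (\int[gaussm (qmean q h n w' t) (qcov q n t)]_x Phi (w', x))%E.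

Let inner0 w' : (0 <= inner w')%E. Proof. exact: integral_ge0. Qed.

(** Measurability of the integral over the kernel is proved together with the formula because both
    come from Tonelli. The last observation n and the signal time t are separate: n = t is used for
    the information state, n = t - 1 for the one step predictor. *)
Lemma reference_formula :
  measurable_fun [set: G] (fun w' : G => (qmass q h n w')%:E * inner w')%E /\
  (\int[P]_w ((qweight q h n w)%:E * Phi (w, X t w)) =
   \int[refm X eps A n]_w' ((qmass q h n w')%:E * inner w'))%E.
Proof.
pose L (w w' : T) := \prod_(1 <= s < n.+1)
  expR (A s * X s w * Y s w' - 2^-1 * (A s * X s w) ^+ 2).
pose W (w w' : T) := \prod_(1 <= s < n.+1) expR (2^-1 * q s * (X s w - h s w') ^+ 2).
pose Psi (z : T * T) : \bar R := ((L z.1 z.2 * W z.1 z.2)%:E * Phi (z.2, X t z.1))%E.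
have L0 w w' : 0 <= L w w' by apply: prodr_ge0 => s _; exact: expR_ge0.
have W0 w w' : 0 <= W w w' by apply: prodr_ge0 => s _; exact: expR_ge0.
have mXs s : (1 <= s)%N -> measurable_fun [set: g_sigma_algebraType FX * G]
    (fun z : g_sigma_algebraType FX * G => X s z.1).
  move=> s1; apply: measurableT_comp measurable_fst.
  exact: (@sub_measurable_gen _ _ _ [set u | (1 <= u)%N] X).
have mYs s : (1 <= s <= n)%N -> measurable_fun [set: g_sigma_algebraType FX * G]
    (fun z : g_sigma_algebraType FX * G => Y s z.2).
  by move=> sn; apply: measurableT_comp measurable_snd; exact: mY.
have mhs s : (1 <= s <= n)%N -> measurable_fun [set: g_sigma_algebraType FX * G]
    (fun z : g_sigma_algebraType FX * G => h s z.2).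
  by move=> sn; apply: measurableT_comp measurable_snd; exact: hn.
have mPsi : measurable_fun [set: g_sigma_algebraType FX * G]
    (Psi : g_sigma_algebraType FX * G -> \bar R).
  apply: emeasurable_funM.
    apply/measurable_EFinP; apply: measurable_funM; apply: measurable_prod => s;
      rewrite mem_index_iota ltnS => sn.
      have mx := mXs s (andP sn).1; have my := mYs s sn; mfun.
    have mx := mXs s (andP sn).1; have mh := mhs s sn; mfun.
  apply: measurableT_comp mPhi _; apply: measurable_fun_pair.
    exact: measurable_snd.
  by apply: mXs; case/andP: tN.
have Psi0 z : (0 <= Psi z)%E by rewrite mule_ge0// lee_fin mulr_ge0.
have PT : (P setT < +oo)%E by rewrite probability_setT ltry.
have refT : (refm X eps A n setT < +oo)%E by rewrite refmT// ltry.
have ind' B1 B2 : <<s FX >> B1 -> <<s filtration Y n >> B2 ->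
    (refm X eps A n (B1 `&` B2) = P B1 * refm X eps A n B2)%E.
  by rewrite /FX /filtration !sigma_gen_idem; exact: refm_indep.
have [mI IE] := integral_freeze (@sigma_signal_measurable _ _ _ P X)
  (@filtration_measurable _ _ _ P X eps A n) PT refT ind' mPsi Psi0.
have innerE w' : (\int[P]_w Psi (w, w') = (qmass q h n w')%:E * inner w')%E.
  have mPw' : measurable_fun [set: R] (fun x : R => Phi (w', x)).
    exact: measurableT_comp mPhi (measurable_pair1 _).
  pose c := \prod_(1 <= s < n.+1) expR (2^-1 * q s * h s w' ^+ 2).
  have LWE w : L w w' * W w w' =
      c * \prod_(1 <= s < n.+1) quad_weight (tilt_b q h w' s) (tilt_S q s) (X s w).
    rewrite -!big_split/=; apply: eq_bigr => s _.
    by rewrite /quad_weight /tilt_b /tilt_S -!expRD; congr expR; field.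
  under eq_integral do rewrite /Psi/= LWE EFinM -muleA.
  rewrite ge0_integralZl//.
  - rewrite (tilted_signal_law gX _ nN tN D0 mPw')// muleA -EFinM.
    have -> : qmass q h n w' = c * \prod_(1 <= s < n.+1)
        step_mass (tilt_S q) K0 (tilt_b q h w') m0 s.
      by rewrite /qmass /qstep big_split.
    exact: erefl.
  - apply: emeasurable_funM.
      by apply/measurable_EFinP; exact: measurable_quad_weights.
    exact: measurableT_comp mPw' (mX t).
  - by move=> w _; rewrite mule_ge0// lee_fin quad_weights_ge0.
  - by rewrite lee_fin; apply: prodr_ge0 => s _; exact: expR_ge0.
split; first by apply: eq_measurable_fun mI => w' _; rewrite innerE.
under [RHS]eq_integral do rewrite -innerE.
have mPsiT : measurable_fun [set: T] (fun w => Psi (w, w)).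
  have mdiag : measurable_fun [set: T] (fun w => (w, w) : g_sigma_algebraType FX * G).
    apply: measurable_fun_pair; apply: measurable_id_sub.
      exact: sigma_signal_measurable.
    exact: filtration_measurable.
  exact: measurableT_comp mPsi mdiag.
rewrite -IE /refm ge0_integral_mdens//.
apply: eq_integral => w _; rewrite /Psi/= muleAC -EFinM; congr (_%:E * _)%E.
(* It remains to see that L and the density are inverse to each other on the diagonal; this is where
   Y = A X + eps enters. *)
rewrite mulrAC -[LHS]mul1r; congr (_ * _).
rewrite /L /girsanov -big_split/= big1// => s _.
by rewrite -expRD -[RHS]expR0; congr expR; rewrite /Y /observation; field.
Qed.

End Formula.

(** The likelihood ratio of the observations: the density of P with respect to the reference measure
    on the observation filtration. *)
Definition obs_mass n w := qmass (fun=> 0) (fun=> cst 0) n w.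

(** Strong induction: positive denominators before s make the variance at s nonnegative, and then
    A_s^2 >= 0 makes the denominator at s at least 1. *)
Lemma obs_step_den s : (1 <= s <= N)%N -> 0 < step_den (tilt_S (fun=> 0)) K0 s.
Proof.
elim/ltn_ind: s => s IH /andP[s1 sN].
have sN1 : (s.-1 <= N)%N by rewrite (leq_trans (leq_pred s)).
have sN2 : (1 <= s <= N)%N by rewrite s1.
rewrite /step_den ltr_wpDr// mulr_ge0 ?/tilt_S ?subr0 ?sqr_ge0//.
apply: (cov_after_ge0 gX sN1 sN2) => s' /andP[s'1 s's].
apply: IH; first by rewrite -(prednK s1) ltnS.
by rewrite s'1 (leq_trans s's).
Qed.

Lemma obs_mass_gt0 n w : (n <= N)%N -> 0 < obs_mass n w.
Proof.
move=> nN; apply: qmass_gt0 => s /andP[s1 sn].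
by apply: obs_step_den; rewrite s1 (leq_trans sn).
Qed.

Lemma measurable_obs_mass n :
  measurable_fun [set: g_sigma_algebraType (filtration Y n)]
    (obs_mass n : g_sigma_algebraType (filtration Y n) -> R).
Proof. by apply: measurable_qmass => s _; exact: measurable_cst. Qed.

Lemma obs_change n (g : T -> \bar R) : (1 <= N)%N -> (n <= N)%N ->
  measurable_fun [set: g_sigma_algebraType (filtration Y n)]
    (g : g_sigma_algebraType (filtration Y n) -> \bar R) -> (forall w, 0 <= g w)%E ->
  (\int[P]_w g w = \int[refm X eps A n]_w ((obs_mass n w)%:E * g w))%E.
Proof.
move=> N1 nN mg g0.
(* Here the integrand ignores the signal, so 1 is merely an admissible signal time. *)
have tN : (1 <= 1 <= N)%N by [].
have D0 s : (1 <= s <= n)%N -> 0 < step_den (tilt_S (fun=> 0)) K0 s.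
  by move=> /andP[s1 sn]; apply: obs_step_den; rewrite s1 (leq_trans sn).
have mPhi : measurable_fun [set: g_sigma_algebraType (filtration Y n) * R]
    (fun z : g_sigma_algebraType (filtration Y n) * R => g z.1).
  exact: measurableT_comp mg measurable_fst.
have [_ H] := @reference_formula (fun=> 0) (fun=> cst 0) n 1 nN tN D0
  (fun _ _ => measurable_cst _) (fun z => g z.1) mPhi (fun z => g0 z.1).
transitivity (\int[P]_w ((qweight (fun=> 0%R) (fun=> cst 0%R) n w)%:E * g w))%E.
  apply: eq_integral => w _; rewrite /qweight big1 ?mul1e// => s _.
  by rewrite mulr0 mul0r expR0.
rewrite H; apply: eq_integral => w _; congr (_ * _)%E.
have gc (nu : probability (measurableTypeR R) R) (c : \bar R) : (\int[nu]_x c = c)%E.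
  by rewrite integral_cst// [X in (_ * X)%E]probability_setT mule1.
exact: (gc (gaussm _ _) (g w)).
Qed.

Section Formula2.
Variables (q : nat -> R) (h : nat -> T -> R) (n t : nat).
Hypotheses (nN : (n <= N)%N) (tN : (1 <= t <= N)%N).
Hypothesis D0 : forall s, (1 <= s <= n)%N -> 0 < step_den (tilt_S q) K0 s.

Let G := g_sigma_algebraType (filtration Y n).
Hypothesis hn : forall s, (1 <= s <= n)%N -> measurable_fun [set: G] (h s : G -> R).

Variable Phi : T * R -> \bar R.
Hypotheses (mPhi : measurable_fun [set: G * R] (Phi : G * R -> \bar R))
  (Phi0 : forall z, (0 <= Phi z)%E).

Lemma measurable_ratio :
  measurable_fun [set: G] (fun w : G => qmass q h n w / obs_mass n w).
Proof.
apply: measurable_funM; first exact: measurable_qmass.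
apply: measurable_inv_pos; first exact: measurable_obs_mass.
by move=> w; rewrite obs_mass_gt0.
Qed.

Lemma ratio_gt0 w : 0 < qmass q h n w / obs_mass n w.
Proof. by apply: divr_gt0; [exact: qmass_gt0|exact: obs_mass_gt0]. Qed.

Lemma measurable_inner : measurable_fun [set: G]
  (fun w : G => \int[gaussm (qmean q h n w t) (qcov q n t)]_x Phi (w, x))%E.
Proof.
have [mI _] := reference_formula nN tN D0 hn mPhi Phi0.
have mq : measurable_fun [set: G] (fun w : G => ((qmass q h n w)^-1)%:E).
  apply/measurable_EFinP; apply: measurable_inv_pos; first exact: measurable_qmass.
  by move=> w; rewrite qmass_gt0.
apply: eq_measurable_fun (emeasurable_funM mq mI) => w _.
by rewrite muleA -EFinM mulVf ?mul1e// gt_eqF// qmass_gt0.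
Qed.

(** The integrand over the reference measure is a function of the observations, so [obs_change]
    brings P back at the cost of dividing by the likelihood ratio. This is a Bayes formula. *)
Lemma filter_formula :
  (\int[P]_w ((qweight q h n w)%:E * Phi (w, X t w)) =
   \int[P]_w ((qmass q h n w / obs_mass n w)%:E *
     \int[gaussm (qmean q h n w t) (qcov q n t)]_x Phi (w, x)))%E.
Proof.
have [_ ->] := reference_formula nN tN D0 hn mPhi Phi0.
rewrite (@obs_change n)//.
- apply: eq_integral => w _; rewrite [in RHS]muleA -EFinM [obs_mass n w * _]mulrC.
  by rewrite divfK// gt_eqF// obs_mass_gt0.
- by case/andP: tN => t1; exact: leq_trans.
- apply: emeasurable_funM; last exact: measurable_inner.
  by apply/measurable_EFinP; exact: measurable_ratio.
- move=> w; apply: mule_ge0; last exact: integral_ge0.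
  by rewrite lee_fin ltW// ratio_gt0.
Qed.

End Formula2.

End FilterFormula.

(** * Almost sure uniqueness of conditional expectations *)

Section SubSigmaAlgebraUniqueness.
Context {d : measure_display} {T : measurableType d} {R : realType}.
Variables (P : probability T R) (F : set (set T)).
Hypothesis mF : F `<=` measurable.
Let G := g_sigma_algebraType F.
Let mid : measurable_fun [set: T] (fun w => w : G) := measurable_id_sub mF.
Let m : {measure set G -> \bar R} := pushm P mid.

Lemma ge0_integral_pushm_id (E : set G) (V : G -> \bar R) : measurable E ->
  measurable_fun E V -> (forall w, 0 <= V w)%E ->
  (\int[m]_(w in E) V w = \int[P]_(w in (E : set T)) V w)%E.
Proof.
move=> mE mV V0; rewrite [LHS]integral_mkcond [RHS]integral_mkcond.
rewrite [LHS](ge0_integral_pushm P mid)//.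
  by apply/(measurable_restrictT _ _).1.
by move=> w; apply: erestrict_ge0.
Qed.

Lemma integral_pushm_id (E : set G) (V : G -> \bar R) : measurable E ->
  measurable_fun E V ->
  (\int[m]_(w in E) V w = \int[P]_(w in (E : set T)) V w)%E.
Proof.
move=> mE mV; rewrite integralE [in RHS]integralE.
rewrite !ge0_integral_pushm_id//.
- exact: measurable_funeneg.
- exact: measurable_funepos.
Qed.

(** The argument is run for the restriction of P to the sub-sigma-algebra, where only sets of F have
    to be tested; the exceptional set found there is also P-null in the large space. *)
Lemma sub_integral_ae_eq (D : set T) (V W : T -> \bar R) : <<s F >> D ->
  measurable_fun [set: G] (V : G -> \bar R) -> measurable_fun [set: G] (W : G -> \bar R) ->
  P.-integrable D W ->
  (forall E, E `<=` D -> <<s F >> E -> \int[P]_(w in E) W w = \int[P]_(w in E) V w)%E ->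
  {ae P, forall w, D w -> W w = V w}.
Proof.
move=> FD mV mW iW WV.
have mWD : measurable_fun (D : set G) (W : G -> \bar R) by exact: measurable_funTS.
have mVD : measurable_fun (D : set G) (V : G -> \bar R) by exact: measurable_funTS.
have iWm : m.-integrable (D : set G) W.
  apply/integrableP; split => //; rewrite integral_pushm_id//.
    by have /integrableP[] := iW.
  exact: measurableT_comp.
have [E [mE mE0 HE]] : {ae m, forall w, D w -> W w = V w}.
  apply: integral_ae_eq => // E ED mE.
  rewrite !integral_pushm_id//; first exact: WV.
  - exact: measurable_funS mVD.
  - exact: measurable_funS mWD.
exists E; split => //.
exact: (smallest_sub (@sigma_algebra_measurable _ T) mF).
Qed.

Lemma condexp_unique (U V W : T -> R) : is_condexp P F U V -> is_condexp P F U W ->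
  <<s F >> = F -> {ae P, forall w, V w = W w}.
Proof.
move=> [mV iV VU] [mW iW WU] Fid.
have mV' : measurable_fun [set: G] (EFin \o V : G -> \bar R).
  by apply/measurable_EFinP; exact: mV.
have mW' : measurable_fun [set: G] (EFin \o W : G -> \bar R).
  by apply/measurable_EFinP; exact: mW.
have FT : <<s F >> setT by exact: (@measurableT _ G).
have [] := @sub_integral_ae_eq setT (EFin \o W) (EFin \o V) FT mW' mV' iV.
  by move=> E _; rewrite Fid => FE; rewrite [LHS](VU E FE) [RHS](WU E FE).
move=> E [mE E0 HE]; exists E; split => // w nVW; apply: HE => /= H; apply: nVW.
by have [] := H I.
Qed.

(** Neither version need be integrable, so they are compared on the sets where W <= k. These lie in
    F and exhaust the space because W is finite. *)
Lemma condexp_ge0_unique (U V W : T -> \bar R) :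
  is_condexp_ge0 P F U V -> is_condexp_ge0 P F U W -> (forall w, W w \is a fin_num) ->
  <<s F >> = F -> {ae P, forall w, W w = V w}.
Proof.
move=> [mV V0 VU] [mW W0 WU] Wfin Fid.
pose D (k : nat) : set T := [set w | (W w <= k%:R%:E)%E].
have mD k : <<s F >> (D k).
  rewrite -[D k]setTI.
  exact: (@measurable_lee _ G R setT measurableT W (cst k%:R%:E)).
have DP k : {ae P, forall w, D k w -> W w = V w}.
  apply: sub_integral_ae_eq => //.
    have mDk : measurable (D k) by exact: (smallest_sub (@sigma_algebra_measurable _ T) mF).
    have ik : P.-integrable (D k) (EFin \o cst (k%:R : R)).
      have i1 : P.-integrable setT (EFin \o (cst (k%:R : R) : T -> R)).
        exact: finite_measure_integrable_cst.
      exact: integrableS i1.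
    apply: le_integrable ik => //.
      by apply: measurable_funTS; exact: sub_measurable_measurable mW.
    by move=> w Dw; rewrite gee0_abs// /= ger0_norm.
  by move=> E _; rewrite Fid => FE; rewrite VU// WU.
have := ae_foralln DP.
apply: filterS => w H; apply: (H (Num.truncn (fine (W w))).+1).
by rewrite /D/= -[W w]fineK// lee_fin ltW// truncnS_gt.
Qed.

End SubSigmaAlgebraUniqueness.

(** * The optimal filter *)

Section ObservedFilter.
Context {d : measure_display} {T : measurableType d} {R : realType}.
Variables (P : probability T R) (X eps : nat -> {RV P >-> R}) (A : nat -> R) (N : nat).
Hypotheses (gX : gaussian_sequence P X) (iid : iid_std_normal P eps)
  (indep : independent_sequences P X eps).

Let Y : nat -> T -> R := observation A X eps.
Let mX i : measurable_fun setT (X i : T -> R). Proof. exact: measurable_funPT. Qed.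

Definition obs_mean n w t := qmean X eps A (fun=> 0) (fun=> cst 0) n w t.
Definition obs_cov n t := qcov X A (fun=> 0) n t.

Variables (n t : nat).
Hypotheses (nN : (n <= N)%N) (tN : (1 <= t <= N)%N).
Let G := g_sigma_algebraType (filtration Y n).

Let D0 s : (1 <= s <= n)%N -> 0 < step_den (tilt_S A (fun=> 0)) (cov P X) s.
Proof.
by move=> /andP[s1 sn]; apply: (obs_step_den _ gX) => //; rewrite s1 (leq_trans sn).
Qed.

Let h0 s : (1 <= s <= n)%N ->
  measurable_fun [set: G] ((fun=> cst 0 : T -> R) s : G -> R).
Proof. by move=> _; exact: measurable_cst. Qed.

Lemma obs_cov_ge0 : 0 <= obs_cov n t.
Proof. exact: (cov_after_ge0 gX nN tN D0). Qed.

Lemma measurable_obs_mean : measurable_fun [set: G] (fun w : G => obs_mean n w t).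
Proof. exact: measurable_qmean. Qed.

(** For q = 0 the ratio of masses is 1: the conditional law of X_t given Y_1, ..., Y_n is Gaussian,
    with a deterministic variance. *)
Lemma obs_formula (Phi : T * R -> \bar R) :
  measurable_fun [set: G * R] (Phi : G * R -> \bar R) -> (forall z, (0 <= Phi z)%E) ->
  (\int[P]_w Phi (w, X t w) =
   \int[P]_w \int[gaussm (obs_mean n w t) (obs_cov n t)]_x Phi (w, x))%E.
Proof.
move=> mPhi Phi0.
have := filter_formula gX iid indep nN tN D0 h0 mPhi Phi0.
under eq_integral.
  move=> w _; rewrite /qweight big1 ?mul1e; last by move=> s _; rewrite mulr0 mul0r expR0.
  over.
move=> ->; apply: eq_integral => w _.
by rewrite divff ?mul1e// gt_eqF// (obs_mass_gt0 eps A gX w nN).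
Qed.

Let mZ : measurable_fun setT (fun w => obs_mean n w t).
Proof.
apply: (@sub_measurable_measurable _ _ _ _ (filtration Y n)).
  exact: filtration_measurable.
exact: measurable_obs_mean.
Qed.

Let mz : measurable_fun [set: G * R] (fun z : G * R => z.2 - obs_mean n z.1 t).
Proof.
apply: measurable_funB; first exact: measurable_snd.
exact: measurableT_comp measurable_obs_mean measurable_fst.
Qed.

Lemma obs_error : (\int[P]_w ((X t w - obs_mean n w t) ^+ 2)%:E = (obs_cov n t)%:E)%E.
Proof.
rewrite (obs_formula (Phi := fun z => ((z.2 - obs_mean n z.1 t) ^+ 2)%:E)).
- under eq_integral do rewrite gaussm_variance ?obs_cov_ge0//.
  by rewrite integral_cst// [X in (_ * X)%E]probability_setT mule1.
- by apply/measurable_EFinP; apply: measurable_funX.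
- by move=> z; rewrite lee_fin sqr_ge0.
Qed.

Let iX : P.-integrable setT (EFin \o X t).
Proof. by have [Kt []] := gaussian_sequence_moments gX (andP tN).1. Qed.

Let iXZ : P.-integrable setT (EFin \o (fun w => X t w - obs_mean n w t)).
Proof.
apply: sqr_integrable_integrable; first exact: measurable_funB.
by rewrite obs_error ltry.
Qed.

Let iZ : P.-integrable setT (EFin \o (fun w => obs_mean n w t)).
Proof.
have := integrableB measurableT iX iXZ.
by apply: eq_integrable => // w _ /=; rewrite -EFinB opprB addrC subrK.
Qed.

(** The conditional law is symmetric about [obs_mean], so the positive and negative parts of 1_F
    (X_t - obs_mean) have equal integrals. *)
Lemma obs_mean_condexp : is_condexp P (filtration Y n) (X t) (fun w => obs_mean n w t).
Proof.
split; [exact: measurable_obs_mean|exact: iZ|] => F FF.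
have FFs : <<s filtration Y n >> F by exact: sub_sigma_algebra.
have mF : measurable F by exact: (filtration_measurable FF).
pose W w := \1_F w * (X t w - obs_mean n w t).
have mIG : measurable_fun [set: G * R] (fun z : G * R => \1_F z.1 : R).
  have mI : measurable_fun [set: G] (\1_F : G -> R) by exact: measurable_indic.
  exact: measurableT_comp mI measurable_fst.
have mW : measurable_fun setT W.
  by apply: measurable_funM; [exact: measurable_indic|exact: measurable_funB].
have iW : P.-integrable setT (EFin \o W).
  apply: le_integrable iXZ => //; first exact/measurable_EFinP.
  move=> w _; rewrite /W /= lee_fin normrM ler_piMl// indicE.
  by case: (_ \in _); rewrite ?normr1 ?normr0.
have mmax (g : G * R -> R) : measurable_fun [set: G * R] g ->
    measurable_fun [set: G * R] (fun z => (Num.max (g z) 0)%:E).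
  by move=> mg; apply/measurable_EFinP; apply: measurable_maxr.
have W0 : (\int[P]_w (W w)%:E = 0)%E.
  apply: integral_eq0_pos_neg => //.
  rewrite (obs_formula (Phi := fun z => (Num.max (\1_F z.1 * (z.2 - obs_mean n z.1 t)) 0)%:E)); last 2 first.
    - by apply: mmax; apply: measurable_funM.
    - by move=> z; rewrite lee_fin le_max lexx orbT.
  rewrite (obs_formula (Phi := fun z => (Num.max (- (\1_F z.1 * (z.2 - obs_mean n z.1 t))) 0)%:E)); last 2 first.
    - by apply: mmax; apply: measurable_funN; apply: measurable_funM.
    - by move=> z; rewrite lee_fin le_max lexx orbT.
  apply: eq_integral => w _; rewrite -gaussm_reflect ?obs_cov_ge0//; last 2 first.
    - by apply/measurable_EFinP; apply: measurable_maxr => //; mfun.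
    - by move=> x; rewrite lee_fin le_max lexx orbT.
  by apply: eq_integral => x _ /=; congr (Num.max _ _)%:E; ring.
have -> : (\int[P]_(w in F) (X t w)%:E =
    \int[P]_(w in F) ((X t w - obs_mean n w t)%:E + (obs_mean n w t)%:E))%E.
  by apply: eq_integral => w _; rewrite -EFinD subrK.
rewrite integralD//; [|exact: integrableS iXZ|exact: integrableS iZ].
rewrite [X in (_ = X + _)%E](_ : _ = 0)%E ?add0e//.
rewrite -W0 integral_mkcond; apply: eq_integral => w _.
by rewrite /W patchE indicE; case: (_ \in _); rewrite ?mul1r ?mul0r.
Qed.

Lemma filter_unique (xh : T -> R) : is_condexp P (filtration Y n) (X t) xh ->
  {ae P, forall w, xh w = obs_mean n w t}.
Proof.
move=> cx; apply: (condexp_unique _ cx obs_mean_condexp).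
  exact: filtration_measurable.
exact: sigma_gen_idem.
Qed.

Lemma filter_errorE (xhat : nat -> T -> R) : is_condexp P (filtration Y n) (X t) (xhat t) ->
  filter_error P X xhat t = obs_cov n t.
Proof.
move=> cx; rewrite /filter_error expectation.unlock.
have mxh : measurable_fun setT (xhat t).
  have [mx _ _] := cx; apply: sub_measurable_measurable mx.
  exact: filtration_measurable.
rewrite (ge0_ae_eq_integral measurableT (g := fun w => ((X t w - obs_mean n w t) ^+ 2)%:E)).
- by rewrite obs_error.
- by apply/measurable_EFinP; apply: measurable_funX; apply: measurable_funB.
- by apply/measurable_EFinP; apply: measurable_funX; apply: measurable_funB.
- by move=> w _; rewrite lee_fin sqr_ge0.
- by move=> w _; rewrite lee_fin sqr_ge0.
- by apply: filterS (filter_unique cx) => w -> _.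
Qed.

End ObservedFilter.

(** * Information state *)

Section StepFactors.
Context {R : realType}.
Implicit Types (a q Y h Z z k gam : R).

(** A factor of the martingale is the ratio of the masses of one observation tilt started from two
    predictors: (Z, gam) stands for Z^h and gammabar, (z, k) for the optimal predictor and its
    error. *)
Lemma tilt_mass_ratio a Y Z z gam k : 0 < 1 + a ^+ 2 * gam -> 0 < 1 + a ^+ 2 * k ->
  Num.sqrt ((1 + a ^+ 2 * k) / (1 + a ^+ 2 * gam)) *
  expR (a * (Z - z) * (Y - a * z) / (1 + a ^+ 2 * gam)
        - 2^-1 * (a ^+ 2 * (Z - z) ^+ 2 / (1 + a ^+ 2 * gam))
        - 2^-1 * (a ^+ 2 * (k - gam) * (Y - a * z) ^+ 2
                  / ((1 + a ^+ 2 * gam) * (1 + a ^+ 2 * k)))) =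
  tilt_mass (a * Y) (a ^+ 2) Z gam / tilt_mass (a * Y) (a ^+ 2) z k.
Proof.
move=> g0 k0; rewrite /tilt_mass sqrtrM ?ltW// sqrtrV ?ltW//.
rewrite [in RHS]invfM invrK [RHS]mulrACA -expRN -expRD; congr (_ * expR _); first exact: mulrC.
by field; rewrite !gt_eqF.
Qed.

(** The tilt is split into the observation, which leads to mean Ztilde and variance gammatilde,
    followed by the cost, integrated against that law. The ratio of the two denominators is 1 - q
    gammatilde. *)
Lemma tilt_mass_weight a q Y h Z gam :
  0 < 1 + a ^+ 2 * gam -> 0 < 1 + (a ^+ 2 - q) * gam ->
  expR (2^-1 * q * h ^+ 2) * tilt_mass (a * Y - q * h) (a ^+ 2 - q) Z gam =
  (Num.sqrt ((1 + (a ^+ 2 - q) * gam) / (1 + a ^+ 2 * gam)))^-1 *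
  expR (2^-1 * q * ((1 + a ^+ 2 * gam) / (1 + (a ^+ 2 - q) * gam)) *
        (h - (Z + a * gam * Y) / (1 + a ^+ 2 * gam)) ^+ 2) *
  tilt_mass (a * Y) (a ^+ 2) Z gam.
Proof.
move=> g0 D0; rewrite /tilt_mass sqrtrM ?ltW// sqrtrV ?ltW// invfM invrK.
have s0 : Num.sqrt (1 + a ^+ 2 * gam) != 0 by rewrite gt_eqF// sqrtr_gt0.
have s1 : Num.sqrt (1 + (a ^+ 2 - q) * gam) != 0 by rewrite gt_eqF// sqrtr_gt0.
rewrite mulrCA -expRD.
rewrite [RHS](_ : _ = (Num.sqrt (1 + (a ^+ 2 - q) * gam))^-1 *
   (expR (2^-1 * q * ((1 + a ^+ 2 * gam) / (1 + (a ^+ 2 - q) * gam)) *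
        (h - (Z + a * gam * Y) / (1 + a ^+ 2 * gam)) ^+ 2) *
    expR ((a * Y * Z + 2^-1 * (a * Y) ^+ 2 * gam - 2^-1 * a ^+ 2 * Z ^+ 2) /
          (1 + a ^+ 2 * gam)))).
  rewrite -expRD; congr (_ * expR _).
  by field; rewrite !gt_eqF.
move: (expR _) (expR _) => e1 e2.
by field; apply/andP.
Qed.

End StepFactors.

Section TiltExtensionality.
Context {R : realType}.
Variable (K0 : nat -> nat -> R).
Implicit Types (S b m : nat -> R).

Lemma eq_cov_after S S' n : (forall s, (1 <= s <= n)%N -> S s = S' s) ->
  cov_after S K0 n = cov_after S' K0 n.
Proof.
elim: n => // n IH SS; rewrite /= IH ?SS ?ltnSn//.
by move=> s /andP[s1 sn]; apply: SS; rewrite s1 leqW.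
Qed.

Lemma eq_mean_after S S' b b' m n : (forall s, (1 <= s <= n)%N -> S s = S' s) ->
  (forall s, (1 <= s <= n)%N -> b s = b' s) ->
  mean_after S K0 b m n = mean_after S' K0 b' m n.
Proof.
elim: n => // n IH SS bb.
have SS' s : (1 <= s <= n)%N -> S s = S' s.
  by move=> /andP[s1 sn]; apply: SS; rewrite s1 leqW.
have bb' s : (1 <= s <= n)%N -> b s = b' s.
  by move=> /andP[s1 sn]; apply: bb; rewrite s1 leqW.
by rewrite /= IH// (eq_cov_after SS') SS ?ltnSn// bb ?ltnSn.
Qed.

End TiltExtensionality.

(** * Identification with [gammabar], [Zh] and [Ztilde] *)

Section Identification.
Context {R : realType}.
Variables (T : nat) (K : nat -> nat -> R) (mu : R) (A Q : nat -> R) (g : nat -> nat -> R).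
Hypothesis C_mu : condition_C T K mu A Q g.
Let S := Scoef mu A Q.

(** The equation expresses g t s through columns l < s only, which gives a strong induction on s.
    The value g t s is the covariance of X_t and X_s after the tilts at times before s, hence the
    varying first index. *)
Lemma gammabar_cov_after t s : (1 <= s <= t)%N -> (t <= T)%N ->
  g t s = cov_after S K s.-1 t s.
Proof.
have [[_ gE] _ _ _ _] := C_mu.
elim/ltn_ind: s t => s IH t /andP[s1 st] tT.
rewrite gE ?s1// cov_afterE prednK//; congr (_ - _).
apply: eq_big_nat => l /andP[l1 ls].
rewrite (IH l ls t) ?l1 ?(ltnW (leq_trans ls st))//.
rewrite (IH l ls s) ?l1 ?(ltnW ls) ?(leq_trans st)//.
by rewrite (IH l ls l) ?l1 ?leqnn// (leq_trans (ltnW ls))// (leq_trans st).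
Qed.

Variables (d : measure_display) (Omega : measurableType d) (m : nat -> R) (Y h Zh : nat -> Omega -> R).
Hypothesis Zh_def : Zh_solution T mu A Q m g Y h Zh.

(** The two sums defining [Zh] combine, since b - S Z = A (Y - A Z) - mu Q (h - Z). *)
Lemma Zh_mean_after w s : (1 <= s <= T)%N ->
  Zh s w = mean_after S K (fun l => A l * Y l w - mu * Q l * h l w) m s.-1 s.
Proof.
elim/ltn_ind: s => s IH /andP[s1 sT].
rewrite Zh_def ?s1// mean_afterE prednK// -addrA; congr (_ + _).
rewrite -sumrN -big_split/=; apply: eq_big_nat => l /andP[l1 ls].
have lT : (l <= T)%N by rewrite (leq_trans (ltnW ls)).
rewrite -gammabar_cov_after ?l1 ?(ltnW ls)// -gammabar_cov_after ?l1 ?leqnn//.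
rewrite -IH ?l1// /S /Scoef; ring.
Qed.

End Identification.

Section ZtildeEquation.
Context {R : realType} {d : measure_display} {Omega : measurableType d}.
Variables (T : nat) (K : nat -> nat -> R) (mu : R) (A Q m : nat -> R) (g : nat -> nat -> R).
Variables (Y h Zh : nat -> Omega -> R).
Hypothesis C_mu : condition_C T K mu A Q g.
Hypothesis Zh_def : Zh_solution T mu A Q m g Y h Zh.
Let S := Scoef mu A Q.
Let Zt := Ztilde A g Y Zh.

Lemma obs_den_gt0 t : (1 <= t <= T)%N -> 0 < 1 + A t ^+ 2 * g t t.
Proof.
have [_ _ _ g0 _] := C_mu; move=> tT.
by rewrite ltr_wpDr// mulr_ge0 ?sqr_ge0// g0.
Qed.

(** The equation is implicit in its last term, which is the correction Zt - Zh = g A (Y - A Zt) at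
    time t. At earlier times the increments written with Zh and with Zt agree term by term. *)
Lemma Ztilde_solves : Ztilde_solution T mu A Q m g Y h Zt.
Proof.
have [_ _ _ g0 D0] := C_mu; move=> t w tT; have dt := obs_den_gt0 tT.
have /andP[t1 tleT] := tT.
have -> : Zt t w = Zh t w + g t t * A t * (Y t w - A t * Zt t w).
  by rewrite /Zt /Ztilde; field; rewrite gt_eqF.
rewrite Zh_def// big_nat_recr//= !addrA; congr (_ + _).
rewrite -!addrA; congr (_ + _).
rewrite -!sumrN -!big_split/=; apply: eq_big_nat => l /andP[l1 lt].
have lT : (1 <= l <= T)%N by rewrite l1 (leq_trans (ltnW lt)).
have := D0 l lT; have := obs_den_gt0 lT; rewrite /Zt /Ztilde /Scoef => dl Dl.
by field; rewrite !gt_eqF.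
Qed.

(** Once the earlier values agree, the unknown at time t has coefficient 1 + A_t^2 gammabar_t, which
    is positive. *)
Lemma Ztilde_unique Z : Ztilde_solution T mu A Q m g Y h Z ->
  forall t w, (1 <= t <= T)%N -> Z t w = Zt t w.
Proof.
move=> HZ t w; elim/ltn_ind: t => t IH tT; have dt := obs_den_gt0 tT.
have /andP[t1 tleT] := tT.
have IH' l : (1 <= l < t)%N -> Z l w = Zt l w.
  by move=> /andP[l1 lt]; apply: IH; rewrite // l1 (leq_trans (ltnW lt)).
have e1 := HZ t w tT; have e2 := Ztilde_solves w tT.
rewrite big_nat_recr//= in e1; rewrite big_nat_recr//= in e2.
rewrite (eq_big_nat _ _ (F2 := fun l =>
  g t l * (mu * Q l / (1 + Scoef mu A Q l * g l l)) * (h l w - Zt l w))) in e1; last first.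
  by move=> l /IH' ->.
rewrite [X in _ = _ + (X + _)](eq_big_nat _ _ (F2 := fun l =>
  g t l * A l * (Y l w - A l * Zt l w))) in e1; last first.
  by move=> l /IH' ->.
apply: (mulIf (x := 1 + A t ^+ 2 * g t t)); first by rewrite gt_eqF.
by move: e1 e2; lra.
Qed.

End ZtildeEquation.

(** * Uniqueness of random measures and of Lebesgue densities *)

Section RationalHalfLines.
Context {R : realType}.

Let ray (q : rat) : set R := `]ratr q, +oo[%classic.

(** A countable determining family: almost sure equalities, one per ray, can be gathered into a
    single null set. *)
Lemma finite_measure_eq_rays (mu nu : {measure set (measurableTypeR R) -> \bar R}) :
  (mu setT < +oo)%E -> (forall q : rat, mu (ray q) = nu (ray q)) ->
  forall B, measurable B -> mu B = nu B.
Proof.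
move=> muT mnE B mB.
have mray q : measurable (ray q : set (measurableTypeR R)).
  exact: (@measurable_itv R (Interval (BRight (ratr q)) +oo%O)).
refine (@measure_unique _ R (measurableTypeR R) [set C | exists q, C = ray q]
  (fun n => ray (- n%:R)) _ _ _ _ mu nu _ _ B mB).
- apply/seteqP; split; last first.
    by apply: smallest_sub; [exact: sigma_algebra_measurable|move=> _ [q ->]; exact: mray].
  rewrite [X in X `<=` _](_ : _ = <<s @RGenOInfty.G R >>); last first.
    exact: RGenOInfty.measurableE.
  apply: smallest_sub; first exact: smallest_sigma_algebra.
  move=> _ [x ->].
  pose F (q : rat) := if x < ratr q then ray q else set0.
  have -> : `]x, +oo[%classic = \bigcup_q F q.
    apply/seteqP; split => [y /=|y [q _]]; rewrite ?in_itv/= ?andbT.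
      move=> xy; have [q] := rat_in_itvoo xy; rewrite in_itv/= => /andP[xq qy].
      by exists q => //; rewrite /F xq /ray/= in_itv/= qy.
    by rewrite /F; case: ifP => // xq; rewrite /ray/= !in_itv/= !andbT; exact: lt_trans.
  apply: (@bigcupT_measurable_rat _ (g_sigma_algebraType [set C | exists q, C = ray q])) => q.
  rewrite /F; case: ifP => _; last exact: measurable0.
  by apply: sub_sigma_algebra; exists q.
- move=> _ _ [p ->] [q ->]; exists (Num.max p q); rewrite /ray.
  apply/seteqP; split => y /=; rewrite !in_itv/= !andbT.
    by move=> [py qy]; rewrite /Num.max; case: ifP.
  move=> mxy; split; apply: le_lt_trans mxy; rewrite ler_rat le_max lexx ?orbT//.
- by move=> n; exists (- n%:R).
- apply/seteqP; split => // x _; exists (Num.truncn (- x)).+1 => //=.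
  rewrite /ray /= in_itv/= andbT rmorphN/= ratr_nat ltrNl.
  exact: truncnS_gt.
- by move=> _ [q ->].
- move=> n; apply: le_lt_trans muT; apply: le_measure => //; rewrite inE//.
Qed.

End RationalHalfLines.

Section LebesgueDensity.
Context {R : realType}.
Implicit Types (nu : {measure set (measurableTypeR R) -> \bar R}) (f : R -> R).

Lemma lebesgue_density_unique nu f f' : (nu setT < +oo)%E ->
  is_lebesgue_density nu f -> is_lebesgue_density nu f' ->
  {ae lebesgue_measure, forall x, f x = f' x}.
Proof.
move=> nuT [mf f0 fE] [mf' f'0 f'E].
have mF : measurable_fun [set: R] (EFin \o f) by exact/measurable_EFinP.
have mF' : measurable_fun [set: R] (EFin \o f') by exact/measurable_EFinP.
have intf : lebesgue_measure.-integrable setT (EFin \o f).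
  apply/integrableP; split=> //.
  under eq_integral do rewrite gee0_abs ?lee_fin//=.
  by rewrite -fE//; exact: measurableT.
have := @integral_ae_eq _ _ _ lebesgue_measure setT measurableT (EFin \o f') (EFin \o f) intf mF'.
case=> [E _ mE|N [mN N0 HN]]; first by rewrite -[LHS](fE E mE) -[RHS](f'E E mE).
exists N; split => // x nx; apply: HN => /= H; apply: nx.
by have [] := H I.
Qed.

Lemma lebesgue_density_set1 nu f x : is_lebesgue_density nu f -> nu [set x] = 0%E.
Proof. by move=> [_ _ ->] //; exact: integral_set1. Qed.

Lemma lebesgue_density_gaussm m K (c : {nonneg R}) : 0 < K ->
  is_lebesgue_density (mscale c (gaussm m K)) (fun x => c%:num * normal_pdf m (Num.sqrt K) x).
Proof.
move=> K0; split.
- by apply: measurable_funM => //; exact: measurable_normal_pdf.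
- by move=> x; rewrite mulr_ge0// normal_pdf_ge0.
- move=> B mB; rewrite /gaussm gt_eqF//.
  rewrite -[LHS]/(c%:num%:E * normal_prob m (Num.sqrt K) B)%E /normal_prob.
  rewrite -ge0_integralZl//.
  + by apply: measurable_funTS; exact: measurable_EFin_normal_pdf.
  + by move=> x _; rewrite lee_fin normal_pdf_ge0.
Qed.

End LebesgueDensity.

Section InformationState.
Context {d : measure_display} {Omega : measurableType d} {R : realType}.
Variables (P : probability Omega R) (X eps : nat -> {RV P >-> R}) (A Q : nat -> R) (mu : R)
  (T : nat) (g : nat -> nat -> R) (h Zh xhat : nat -> Omega -> R).
Let Y : nat -> Omega -> R := observation A X eps.
Let K0 := cov P X.
Let m0 := mean P X.
Hypotheses (gX : gaussian_sequence P X) (iid : iid_std_normal P eps)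
  (indep : independent_sequences P X eps) (C_mu : condition_C T K0 mu A Q g)
  (h_adapted : forall t, (1 <= t)%N -> sub_measurable (filtration Y t) (h t))
  (Zh_def : Zh_solution T mu A Q m0 g Y h Zh)
  (xhat_def : forall r, (1 <= r <= T)%N ->
     is_condexp P (filtration Y r.-1) (X r) (xhat r)).

(* The exponent stops at time t - 1, so the last tilt is that of the observation alone. *)
Definition past t s : R := if (s < t)%N then mu * Q s else 0.

Variable t : nat.
Hypothesis tT : (1 <= t <= T)%N.
Let t1 : (1 <= t)%N. Proof. by case/andP: tT. Qed.
Let tleT : (t <= T)%N. Proof. by case/andP: tT. Qed.

Lemma past_cov_after s : (1 <= s <= t)%N ->
  cov_after (tilt_S A (past t)) K0 s.-1 s s = g s s.
Proof.
move=> /andP[s1 st]; rewrite (gammabar_cov_after C_mu) ?s1 ?leqnn ?(leq_trans st)//.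
rewrite (@eq_cov_after _ K0 _ (Scoef mu A Q))// => l /andP[l1 ls].
by rewrite /tilt_S /past /Scoef (leq_ltn_trans ls)// prednK.
Qed.

Lemma past_mean_after w s : (1 <= s <= t)%N ->
  mean_after (tilt_S A (past t)) K0 (tilt_b X eps A (past t) h w) m0 s.-1 s = Zh s w.
Proof.
move=> /andP[s1 st]; rewrite (Zh_mean_after C_mu Zh_def) ?s1 ?(leq_trans st)//.
have past_lt l : (1 <= l <= s.-1)%N -> past t l = mu * Q l.
  by move=> /andP[l1 ls]; rewrite /past (leq_trans _ st)// -(prednK s1) ltnS.
rewrite (@eq_mean_after _ K0 _ (Scoef mu A Q) _
  (fun l => A l * Y l w - mu * Q l * h l w))// => l ls.
  by rewrite /tilt_S /Scoef past_lt.
by rewrite /tilt_b past_lt.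
Qed.

Lemma past_step_den s : (1 <= s <= t)%N -> 0 < step_den (tilt_S A (past t)) K0 s.
Proof.
move=> st; have [_ _ _ _ D0] := C_mu; have /andP[s1 st'] := st.
have sT : (1 <= s <= T)%N by rewrite s1 (leq_trans st').
rewrite /step_den past_cov_after// /tilt_S /past; case: ifP => _; first exact: D0.
by rewrite subr0; apply: obs_den_gt0 C_mu _ sT.
Qed.

Lemma past_qcov : qcov X A (past t) t t = gammatilde A g t.
Proof.
have -> : qcov X A (past t) t t =
    tilt_cov (tilt_S A (past t) t) t (cov_after (tilt_S A (past t)) K0 t.-1) t t.
  by rewrite /qcov; case: t t1.
have D0 := obs_den_gt0 C_mu tT.
rewrite /tilt_cov past_cov_after ?t1 ?leqnn// /tilt_S /past ltnn subr0 /gammatilde.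
by field; rewrite gt_eqF.
Qed.

Lemma past_qmean w : qmean X eps A (past t) h t w t = Ztilde A g Y Zh t w.
Proof.
pose m' := mean_after (tilt_S A (past t)) K0 (tilt_b X eps A (past t) h w) m0 t.-1.
have -> : qmean X eps A (past t) h t w t =
    tilt_mean (tilt_b X eps A (past t) h w t) (tilt_S A (past t) t) t m'
      (cov_after (tilt_S A (past t)) K0 t.-1) t.
  by rewrite /m' /qmean; case: t t1.
have D0 := obs_den_gt0 C_mu tT.
rewrite /tilt_mean past_cov_after ?t1 ?leqnn// /m' past_mean_after ?t1 ?leqnn//.
rewrite /tilt_S /tilt_b /past ltnn subr0 mul0r subr0 /Ztilde -/Y.
by field; rewrite gt_eqF.
Qed.

Lemma past_qweight w : qweight X (past t) h t w = weight mu Q X h t w.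
Proof.
rewrite /qweight /weight big_nat_recr//= {2}/past ltnn mulr0 mul0r expR0 mulr1.
rewrite mulr_sumr expR_sum; apply: eq_big_nat => s /andP[_ st].
by congr expR; rewrite /past st; ring.
Qed.

Let G := g_sigma_algebraType (filtration Y t).

Let ht s : (1 <= s <= t)%N -> measurable_fun [set: G] (h s : G -> R).
Proof.
by move=> /andP[s1 st]; exact: sub_measurableS (filtrationS st) (h_adapted s1).
Qed.

Definition info_ratio w := qmass X eps A (past t) h t w / obs_mass X eps A t w.

Lemma info_ratio_gt0 w : 0 < info_ratio w.
Proof. exact: (ratio_gt0 eps gX h tleT past_step_den w). Qed.

(** The absolute value only provides the nonnegative scalar expected by [mscale]; the ratio is
    positive. *)
Definition info_kernel w : {measure set (measurableTypeR R) -> \bar R} :=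
  mscale (NngNum (normr_ge0 (info_ratio w)))
    (gaussm (Ztilde A g Y Zh t w) (gammatilde A g t)).

Lemma info_kernelE w B :
  info_kernel w B = ((info_ratio w)%:E * gaussm (Ztilde A g Y Zh t w) (gammatilde A g t) B)%E.
Proof.
have -> : info_kernel w B = ((`|info_ratio w|)%:E *
  gaussm (Ztilde A g Y Zh t w) (gammatilde A g t) B)%E by [].
by rewrite gtr0_norm// info_ratio_gt0.
Qed.

Lemma info_kernel_measure : is_info_measure P mu Q X Y h t info_kernel.
Proof.
move=> B mB.
have kE w : info_kernel w B = ((info_ratio w)%:E *
    \int[gaussm (qmean X eps A (past t) h t w t) (qcov X A (past t) t t)]_x (\1_B x)%:E)%E.
  by rewrite info_kernelE past_qmean past_qcov integral_indic// setIT.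
have mI2 : measurable_fun [set: G * R] (fun z : G * R => \1_B z.2 : R).
  apply: measurableT_comp measurable_snd; exact: measurable_indic.
split; last 2 first.
- by move=> w; exact: measure_ge0.
- move=> F FF.
  have mI1 : measurable_fun [set: G * R] (fun z : G * R => \1_F z.1 : R).
    have mI : measurable_fun [set: G] (\1_F : G -> R).
      by apply: measurable_indic; exact: sub_sigma_algebra.
    exact: measurableT_comp mI measurable_fst.
  have := filter_formula gX iid indep tleT tT past_step_den ht
    (Phi := fun z => (\1_F z.1 * \1_B z.2)%:E).
  move=> H; rewrite integral_mkcond [RHS]integral_mkcond.
  transitivity (\int[P]_w ((qweight X (past t) h t w)%:E * (\1_F w * \1_B (X t w))%:E))%E.
    rewrite H; last 2 first.
    - by apply/measurable_EFinP; apply: measurable_funM.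
    - by move=> z; rewrite lee_fin mulr_ge0.
    apply: eq_integral => w _; rewrite patchE kE.
    under [in RHS]eq_integral do rewrite /= indicE.
    case: (w \in F); first by under [in RHS]eq_integral do rewrite mul1r.
    by under [in RHS]eq_integral do rewrite mul0r; rewrite integral0 mule0.
  apply: eq_integral => w _; rewrite patchE past_qweight -EFinM.
  rewrite !indicE; case: (w \in F); last by rewrite mul0r mulr0.
  have -> : (w \in X t @^-1` B) = (X t w \in B) by apply/idP/idP; rewrite !inE.
  by rewrite mul1r mulrC.
- have mr : measurable_fun [set: G] (fun w : G => (info_ratio w)%:E).
    by apply/measurable_EFinP; exact: (measurable_ratio gX (past t) tleT ht).
  apply: eq_measurable_fun (emeasurable_funM mr _) => [w _|]; first by rewrite kE.
  apply: (measurable_inner gX iid indep tleT tT past_step_den ht (Phi := fun z => (\1_B z.2)%:E)).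
    exact/measurable_EFinP.
  by move=> z; rewrite lee_fin.
Qed.

Lemma info_measure_unique om : is_info_measure P mu Q X Y h t om ->
  {ae P, forall w, forall B : set R, measurable B -> om w B = info_kernel w B}.
Proof.
move=> omP.
have mF := @filtration_measurable _ _ _ P X eps A t.
have kfin w B : measurable B -> info_kernel w B \is a fin_num.
  move=> mB; rewrite info_kernelE fin_numM// fin_num_measure//.
have aeB B : measurable B -> {ae P, forall w, info_kernel w B = om w B}.
  move=> mB; apply: (condexp_ge0_unique mF (omP B mB) (info_kernel_measure mB)).
    by move=> w; exact: kfin.
  exact: sigma_gen_idem.
(* An enumeration of the rational rays; integers that code no rational get the ray of origin 0. *)
pose ray (n : nat) : set R := `]ratr (odflt 0 (unpickle n : option rat)), +oo[%classic.
have := ae_foralln (fun n => aeB (ray n) (measurable_itv _)).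
apply: filterS => w Hw B mB; apply/esym/finite_measure_eq_rays => //.
  by rewrite ltey_eq kfin.
by move=> q; have := Hw (pickle q); rewrite /ray pickleK.
Qed.

Lemma filter_ae : {ae P, forall w, forall r, (1 <= r <= t)%N ->
  xhat r w = obs_mean X eps A r.-1 w r}.
Proof.
have step r : {ae P, forall w, (1 <= r <= t)%N -> xhat r w = obs_mean X eps A r.-1 w r}.
  case: (boolP (1 <= r <= t)%N) => [/andP[r1 rt]|_]; last by apply: aeW.
  have rT : (1 <= r <= T)%N by rewrite r1 (leq_trans rt).
  apply: filterS (filter_unique gX iid indep _ rT (xhat_def rT)) => //.
  by rewrite (leq_trans (leq_pred r))// (leq_trans rt).
exact: (ae_foralln step).
Qed.

Lemma filter_error_obs r : (1 <= r <= t)%N ->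
  filter_error P X xhat r = obs_cov X A r.-1 r.
Proof.
move=> /andP[r1 rt]; have rT : (1 <= r <= T)%N by rewrite r1 (leq_trans rt).
apply: (filter_errorE gX iid indep _ rT (xhat_def rT)).
by rewrite (leq_trans (leq_pred r))// (leq_trans rt).
Qed.

Lemma obs_qstep w r :
  qstep X eps A (fun=> 0) (fun=> cst 0) r w =
  tilt_mass (A r * Y r w) (A r ^+ 2) (obs_mean X eps A r.-1 w r) (obs_cov X A r.-1 r).
Proof.
rewrite -[LHS]/(expR (2^-1 * 0 * 0 ^+ 2) * tilt_mass (A r * Y r w - 0 * 0) (A r ^+ 2 - 0)
  (obs_mean X eps A r.-1 w r) (obs_cov X A r.-1 r)).
by rewrite mulr0 !mul0r expR0 mul1r !subr0.
Qed.

Lemma past_qstep w r : (1 <= r <= t)%N ->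
  qstep X eps A (past t) h r w =
  expR (2^-1 * past t r * h r w ^+ 2) *
  tilt_mass (A r * Y r w - past t r * h r w) (A r ^+ 2 - past t r) (Zh r w) (g r r).
Proof. by move=> rt; rewrite /qstep /step_mass past_mean_after// past_cov_after. Qed.

(** At times r < t both [tilt_mass_weight] and [tilt_mass_ratio] apply. At r = t there is no cost,
    and the observation tilt contributes only to the martingale; this is why the two products have
    different ranges. *)
Lemma info_ratioE w : (forall r, (1 <= r <= t)%N -> xhat r w = obs_mean X eps A r.-1 w r) ->
  (\prod_(1 <= r < t)
     ((Num.sqrt ((1 + Scoef mu A Q r * g r r) / (1 + A r ^+ 2 * g r r)))^-1 *
      expR (mu / 2 * Q r * ((1 + A r ^+ 2 * g r r) / (1 + Scoef mu A Q r * g r r))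
            * (h r w - Ztilde A g Y Zh r w) ^+ 2))) * martM P A g X Y Zh xhat t w =
  info_ratio w.
Proof.
move=> xw; have [_ _ _ _ D0] := C_mu.
have rT r : (1 <= r <= t)%N -> (1 <= r <= T)%N.
  by move=> /andP[-> rt]; exact: leq_trans tleT.
have -> : martM P A g X Y Zh xhat t w = \prod_(1 <= r < t.+1)
    (tilt_mass (A r * Y r w) (A r ^+ 2) (Zh r w) (g r r) /
     qstep X eps A (fun=> 0) (fun=> cst 0) r w).
  apply: eq_big_nat => r rt.
  rewrite filter_error_obs// /innovation xw// obs_qstep.
  apply: tilt_mass_ratio; first exact: (obs_den_gt0 C_mu (rT r rt)).
  have /andP[r1 rt'] := rT r rt.
  rewrite ltr_wpDr// mulr_ge0 ?sqr_ge0// (obs_cov_ge0 A gX _ (rT r rt))//.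
  by rewrite (leq_trans (leq_pred r)).
rewrite /info_ratio /qmass /obs_mass /qmass -prodf_div !big_nat_recr//= mulrA.
rewrite past_qstep ?t1 ?leqnn//.
have -> : past t t = 0 by rewrite /past ltnn.
rewrite mulr0 !mul0r expR0 mul1r !subr0; congr (_ * _).
rewrite -big_split/=; apply: eq_big_nat => r /andP[r1 rt].
have rt' : (1 <= r <= t)%N by rewrite r1 ltnW.
rewrite past_qstep// /past rt [LHS]mulrA; congr (_ / _).
rewrite tilt_mass_weight; last 2 first.
- exact: (obs_den_gt0 C_mu (rT r rt')).
- exact: (D0 _ (rT r rt')).
congr (_ * expR _ * _); rewrite /Ztilde /Scoef; ring.
Qed.

Lemma info_densityE w x : 0 < g t t ->
  (forall r, (1 <= r <= t)%N -> xhat r w = obs_mean X eps A r.-1 w r) ->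
  info_density P mu A Q g X Y h Zh xhat t w x =
  `|info_ratio w| * normal_pdf (Ztilde A g Y Zh t w) (Num.sqrt (gammatilde A g t)) x.
Proof.
move=> gt0 xw; have gt0' : 0 < gammatilde A g t.
  by rewrite divr_gt0// (obs_den_gt0 C_mu).
rewrite /info_density -mulrA info_ratioE// gtr0_norm ?info_ratio_gt0// [RHS]mulrC.
congr (_ * _); rewrite normal_pdfE ?gt_eqF ?sqrtr_gt0// /normal_peak /normal_fun.
rewrite sqr_sqrtr ?ltW//; congr ((Num.sqrt _)^-1 * expR _); first by rewrite -mulr_natr; ring.
by rewrite mulNr -[in RHS]mulr_natr [_ * 2]mulrC.
Qed.

Lemma info_measure_density om : is_info_measure P mu Q X Y h t om -> 0 < g t t ->
  {ae P, forall w, is_lebesgue_density (om w) (info_density P mu A Q g X Y h Zh xhat t w)}.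
Proof.
move=> omP gt0; have gt0' : 0 < gammatilde A g t.
  by rewrite divr_gt0// (obs_den_gt0 C_mu).
apply: filterS2 (info_measure_unique omP) filter_ae => w omE xw.
have [mf f0 fE] := @lebesgue_density_gaussm _ (Ztilde A g Y Zh t w) (gammatilde A g t)
  (NngNum (normr_ge0 (info_ratio w))) gt0'.
rewrite (_ : info_density _ _ _ _ _ _ _ _ _ _ _ _ = fun x => `|info_ratio w| *
  normal_pdf (Ztilde A g Y Zh t w) (Num.sqrt (gammatilde A g t)) x); last first.
  by apply/funext => x; exact: info_densityE.
by split => // B mB; rewrite omE// -fE.
Qed.

Lemma info_density_unique om (lambda : Omega -> R -> R) : is_info_measure P mu Q X Y h t om ->
  {ae P, forall w, is_lebesgue_density (om w) (lambda w)} ->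
  {ae P, forall w, {ae lebesgue_measure, forall x,
     lambda w x = info_density P mu A Q g X Y h Zh xhat t w x}}.
Proof.
move=> omP lP.
have [_ _ _ g0 _] := C_mu; have := g0 t tT; rewrite le_eqVlt => /orP[/eqP gt0|gt0].
(* If gammabar_t = 0, the kernel has an atom of positive mass at Ztilde, which contradicts the
   existence of a density. *)
- apply: filterS2 lP (info_measure_unique omP) => w dw omE.
  have := lebesgue_density_set1 (Ztilde A g Y Zh t w) dw.
  rewrite omE; last exact: measurable_set1.
  rewrite info_kernelE /gammatilde -gt0 mul0r /gaussm eqxx.
  rewrite [X in (_ * X)%E](_ : _ = 1%E) ?mule1 => [[] /eqP|].
    by rewrite gt_eqF// info_ratio_gt0.
  by rewrite -[LHS]/((\1_[set Ztilde A g Y Zh t w] (Ztilde A g Y Zh t w))%:E) indicE mem_set.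
- have dP := info_measure_density omP gt0.
  apply: filterS3 lP dP (info_measure_unique omP) => w lw dw omE.
  apply: lebesgue_density_unique lw dw; rewrite omE//.
  by rewrite info_kernelE [X in (_ * X)%E]probability_setT mule1 ltry.
Qed.

End InformationState.

Unset Implicit Arguments.

Theorem mainTheorem5 (d : measure_display) (Omega : measurableType d)
    (R : realType) (P : probability Omega R)
    (X eps : nat -> {RV P >-> R}) (A Q : nat -> R) (mu : R) (T : nat)
    (Y : nat -> Omega -> R) (gammabar : nat -> nat -> R)
    (h Zh xhat : nat -> Omega -> R)
    (X_gaussian : gaussian_sequence P X)
    (eps_iid : iid_std_normal P eps)
    (X_eps_indep : independent_sequences P X eps)
    (Y_def : Y = observation A X eps)
    (Q_ge0 : forall t, (1 <= t)%N -> 0 <= Q t)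
    (C_mu : condition_C T (cov P X) mu A Q gammabar)
    (h_adapted : forall t, (1 <= t)%N -> sub_measurable (filtration Y t) (h t))
    (Zh_def : Zh_solution T mu A Q (mean P X) gammabar Y h Zh)
    (xhat_def : forall r, (1 <= r <= T)%N ->
       is_condexp P (filtration Y r.-1) (X r) (xhat r)) :
  (Ztilde_solution T mu A Q (mean P X) gammabar Y h (Ztilde A gammabar Y Zh) /\
   forall Z, Ztilde_solution T mu A Q (mean P X) gammabar Y h Z ->
     forall t w, (1 <= t <= T)%N -> Z t w = Ztilde A gammabar Y Zh t w) /\
  (forall t, (1 <= t <= T)%N ->
     let lambda_t := info_density P mu A Q gammabar X Y h Zh xhat t in
     (exists om, is_info_measure P mu Q X Y h t om) /\
     (forall om, is_info_measure P mu Q X Y h t om ->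
        (0 < gammabar t t ->
           {ae P, forall w, is_lebesgue_density (om w) (lambda_t w)}) /\
        (forall lambda : Omega -> R -> R,
           {ae P, forall w, is_lebesgue_density (om w) (lambda w)} ->
           {ae P, forall w, {ae lebesgue_measure, forall x,
              lambda w x = lambda_t w x}}))).
Proof.
subst Y; split.
  split; first exact: (Ztilde_solves C_mu Zh_def).
  by move=> Z HZ t w tT; exact: (Ztilde_unique C_mu Zh_def HZ).
move=> t tT /=; split.
  eexists; exact: (info_kernel_measure X_gaussian eps_iid X_eps_indep C_mu h_adapted Zh_def tT).
move=> om omP; split.
  exact: (info_measure_density X_gaussian eps_iid X_eps_indep C_mu h_adapted Zh_def xhat_def tT omP).
by move=> lambda; exact: (info_density_unique X_gaussian eps_iid X_eps_indep C_mu h_adapted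
  Zh_def xhat_def tT omP).
Qed.
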